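(* Let $\rho:\Gamma\to GL_2(\mathbb{C})$ be a $T$-determined, $T$-unitarizable representation and $\upsilon$ any multiplier system for $\Gamma$ with cusp parameter $m$. Write the eigenvalues of $\rho(T)$ as $\mathbf{e}(r_1),\mathbf{e}(r_2)$ with $r_j\in[0,1)$, let $\lambda_j\in[0,1)$ be the unique number with $\lambda_j\equiv r_j+\frac{m}{12}\pmod{\mathbb{Z}}$, $\lambda_0=\lambda_1+\lambda_2$, and $k_0=6\lambda_0-1$. Suppose $\mathcal{H}(\rho,\upsilon)=\bigoplus_{k\ge0}\mathcal{H}(k_0+2k,\rho,\upsilon)$ and let $F_0\in\mathcal{H}(k_0,\rho,\upsilon)$ be a nonzero vector whose components form a fundamental system of solutions of a second order MLDE in weight $k_0$. Then: (i) $\mathcal{H}(\rho,\upsilon)$ is a free $\mathcal{M}$-module of rank 2 with basis $\{F_0,DF_0\}$; (ii) $\mathcal{H}(\rho,\upsilon)=\mathcal{R}F_0$ is a cyclic $\mathcal{R}$-module; (iii) for all integers $k\ge0$, $\dim\mathcal{H}(k_0+2k,\rho,\upsilon)=\left[\frac{k}{3}\right]+1$.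
   Context: $\Gamma=SL(2,\mathbb{Z})$ acts on the upper half-plane $\mathbb{H}$ by Möbius transformations; $T=\begin{pmatrix}1&1\\0&1\end{pmatrix}$; $q=e^{2\pi iz}$, $\mathbf{e}(r)=e^{2\pi ir}$; $[x]$ is the greatest integer $\le x$. Complex powers use the principal branch of $\log$. For $k\in\mathbb{R}$, a multiplier system of weight $k$ is a map $\upsilon:\Gamma\to\{|w|=1\}$ such that $\nu(\gamma,z)=\upsilon(\gamma)(cz+d)^k$ ($\gamma=\begin{pmatrix}a&b\\c&d\end{pmatrix}$) satisfies $\nu(\gamma\sigma,z)=\nu(\gamma,\sigma z)\nu(\sigma,z)$; it is then also a multiplier system of weight $k+n$ for all $n\in\mathbb{Z}$. Its cusp parameter is the $m\in[0,12)$ with $\upsilon(T)=\mathbf{e}(m/12)$. Slash action: $(f|_k^\upsilon\gamma)(z)=\upsilon(\gamma)^{-1}(cz+d)^{-k}f(\gamma z)$. Moderate growth of holomorphic $f$ on $\mathbb{H}$: $|f(x+iy)|\le y^N$ for $y>c$, some $N,c>0$. $\mathcal{H}(k,\rho,\upsilon)$: column vectors $F$ of holomorphic moderate-growth functions with $F|_k^\upsilon\gamma=\rho(\gamma)F$ for all $\gamma\in\Gamma$; $\mathcal{H}(\rho,\upsilon)=\bigoplus_{n\in\mathbb{Z}}\mathcal{H}(k+n,\rho,\upsilon)$. $\mathcal{M}=\bigoplus_j\mathcal{M}_j=\mathbb{C}[E_4,E_6]$ is the graded ring of holomorphic integral-weight modular forms for $\Gamma$ (trivial multiplier), acting on $\mathcal{H}(\rho,\upsilon)$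 by componentwise multiplication. $T$-unitarizable: $\rho(T)$ conjugate to a unitary matrix. An irreducible $\rho$ of dimension $d$ is $T$-determined if every indecomposable $\rho':\Gamma\to GL_d(\mathbb{C})$ with $\rho'(T)$ having the same eigenvalues as $\rho(T)$ is irreducible. With $\eta=q^{1/24}\prod_{n\ge1}(1-q^n)$, $P=\frac{i}{\pi}\frac{\eta'}{\eta}$ and $D_kf=\frac{1}{2\pi i}\frac{df}{dz}+kPf$, the operator $D$ acts on $\mathcal{H}(k,\rho,\upsilon)$ componentwise as $D_k$ (landing in $\mathcal{H}(k+2,\rho,\upsilon)$), and $D^n=D_{k+2(n-1)}\circ\cdots\circ D_k$ on weight $k$. An MLDE of order $n$ in weight $k$ is $D_k^nf+M_4D_k^{n-2}f+\cdots+M_{2n}f=0$ with $M_{2j}\in\mathcal{M}_{2j}$; a fundamental system of solutions is a basis of its solution space. $\mathcal{R}$ is the skew polynomial ring $\mathcal{M}[d]$ with $dM=Md+DM$ for $M\in\mathcal{M}$, acting on $\mathcal{H}(\rho,\upsilon)$ by $d\cdot F=DF$ and multiplication by $\mathcal{M}$; so $\mathcal{H}(\rho,\upsilon)=\mathcal{R}F_0$ means every element is a finite sum $\sum_j M_jD^jF_0$ with $M_j\in\mathcal{M}$. *)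

(* Defs.v *)
(* Complex numbers are  C R := R[i]
   (mathcomp-real-closed) for an arbitrary  R : realType; complex
   differentiability is the MathComp-Analysis derivative on the regular
   normed module  (C R)^o  (increments h range over C R). *)
From HB Require Import structures.
From mathcomp Require Import all_boot all_order all_algebra.
From mathcomp Require Import complex.
From mathcomp Require Import all_classical all_reals all_analysis.
Set Implicit Arguments. Unset Strict Implicit. Unset Printing Implicit Defensive.
Import Order.TTheory GRing.Theory Num.Theory.
Local Open Scope ring_scope.

Notation C R := (complex R).

Definition Cr (R : realType) (x : R) : C R := Complex x 0.
Definition iC (R : realType) : C R := Complex 0 1.
Definition cabs (R : realType) (w : C R) : R :=
  Num.sqrt (complex.Re w ^+ 2 + complex.Im w ^+ 2).
Definition cconj (R : realType) (w : C R) : C R :=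
  Complex (complex.Re w) (- complex.Im w).
Definition cexp (R : realType) (w : C R) : C R :=
  Complex (expR (complex.Re w) * cos (complex.Im w))
          (expR (complex.Re w) * sin (complex.Im w)).
Definition ee (R : realType) (r : R) : C R :=
  Complex (cos (2 * pi * r)) (sin (2 * pi * r)).
Definition Arg (R : realType) (w : C R) : R :=
  if 0 <= complex.Im w then acos (complex.Re w / cabs w)
  else - acos (complex.Re w / cabs w).
(* principal-branch power  w^k = exp (k log w),  log w = ln|w| + i Arg w *)
Definition cpow (R : realType) (w : C R) (k : R) : C R :=
  if w == 0 then 0 else
  Complex (cabs w `^ k * cos (k * Arg w)) (cabs w `^ k * sin (k * Arg w)).

Definition i0 : 'I_2 := ord0.
Definition i1 : 'I_2 := ord_max.
Definition isSL2 (g : 'M[int]_2) : Prop := \det g = 1.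
Definition Tm : 'M[int]_2 :=
  \matrix_(i < 2, j < 2) (if (i == i1) && (j == i0) then 0 else 1).
Definition intC (R : realType) (n : int) : C R := n%:~R.
Definition jfac (R : realType) (g : 'M[int]_2) (z : C R) : C R :=
  intC R (g i1 i0) * z + intC R (g i1 i1).
Definition mob (R : realType) (g : 'M[int]_2) (z : C R) : C R :=
  (intC R (g i0 i0) * z + intC R (g i0 i1)) / jfac g z.

Definition is_multiplier (R : realType) (k : R) (u : 'M[int]_2 -> C R) : Prop :=
  (forall g, isSL2 g -> cabs (u g) = 1) /\
  (forall g s, isSL2 g -> isSL2 s -> forall z : C R, 0 < complex.Im z ->
     u (g *m s) * cpow (jfac (g *m s) z) k =
     (u g * cpow (jfac g (mob s z)) k) * (u s * cpow (jfac s z) k)).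

Definition is_rep (R : realType) (n : nat) (rho : 'M[int]_2 -> 'M[C R]_n) : Prop :=
  rho 1%:M = 1%:M /\
  (forall g s, isSL2 g -> isSL2 s -> rho (g *m s) = rho g *m rho s).
(* a subspace W of column vectors (= the row space of U^T... encoded as the
   row space of U, i.e. W = {v | v^T in rowspace U}) is rho-invariant iff
   rowspace U is stable under all rho(g)^T *)
Definition rep_invariant (R : realType) (n : nat) (rho : 'M[int]_2 -> 'M[C R]_n)
  (U : 'M[C R]_n) : Prop := forall g, isSL2 g -> stablemx U (rho g)^T.
Definition rep_irreducible (R : realType) (n : nat) (rho : 'M[int]_2 -> 'M[C R]_n) : Prop :=
  (0 < n)%N /\
  forall U : 'M[C R]_n, rep_invariant rho U -> (U == (0 : 'M[C R]_n))%MS \/ row_full U.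
Definition rep_indecomposable (R : realType) (n : nat) (rho : 'M[int]_2 -> 'M[C R]_n) : Prop :=
  (0 < n)%N /\
  forall U W : 'M[C R]_n, rep_invariant rho U -> rep_invariant rho W ->
    (U :&: W == (0 : 'M[C R]_n))%MS -> row_full (U + W)%MS -> (U == (0 : 'M[C R]_n))%MS \/ (W == (0 : 'M[C R]_n))%MS.
Definition T_determined (R : realType) (n : nat) (rho : 'M[int]_2 -> 'M[C R]_n) : Prop :=
  rep_irreducible rho /\
  forall rho' : 'M[int]_2 -> 'M[C R]_n, is_rep rho' -> rep_indecomposable rho' ->
    char_poly (rho' Tm) = char_poly (rho Tm) -> rep_irreducible rho'.
Definition unitary_mx (R : realType) (n : nat) (U : 'M[C R]_n) : Prop :=
  U *m (map_mx (@cconj R) U)^T = 1%:M.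
Definition T_unitarizable (R : realType) (n : nat) (rho : 'M[int]_2 -> 'M[C R]_n) : Prop :=
  exists P : 'M[C R]_n, P \in unitmx /\ unitary_mx (P *m rho Tm *m invmx P).

(* ---------- functions on the upper half-plane ----------
   Convention: a function on H is encoded as a map  C R -> _  vanishing
   off H (Im z <= 0). *)
Definition offH0 (R : realType) (T : zmodType) (f : C R -> T) : Prop :=
  forall z : C R, complex.Im z <= 0 -> f z = 0.
Definition holoH (R : realType) (f : C R -> C R) : Prop :=
  forall z : C R, 0 < complex.Im z -> @derivable (C R) (C R)^o (C R)^o f z 1.
Definition cderiv (R : realType) (f : C R -> C R) (z : C R) : C R :=
  @derive (C R) (C R)^o (C R)^o f z 1.
Definition moderate (R : realType) (f : C R -> C R) : Prop :=
  exists N c : R, 0 < N /\ 0 < c /\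
    forall z : C R, c < complex.Im z -> cabs (f z) <= complex.Im z `^ N.

Definition Mform (R : realType) (j : int) (f : C R -> C R) : Prop :=
  holoH f /\ moderate f /\ offH0 f /\
  forall g, isSL2 g -> forall z : C R, 0 < complex.Im z ->
    f (mob g z) = jfac g z ^ j * f z.

Definition Hspace (R : realType) (n : nat) (rho : 'M[int]_2 -> 'M[C R]_n)
  (u : 'M[int]_2 -> C R) (k : R) (F : C R -> 'cV[C R]_n) : Prop :=
  (forall i, holoH (fun z => F z i 0)) /\ (forall i, moderate (fun z => F z i 0)) /\
  offH0 F /\
  forall g, isSL2 g -> forall z : C R, 0 < complex.Im z ->
    ((u g)^-1 * (cpow (jfac g z) k)^-1) *: F (mob g z) = rho g *m F z.

Definition qexp (R : realType) (z : C R) : C R := cexp (Cr (2 * pi) * iC R * z).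
Definition eta (R : realType) (z : C R) : C R :=
  limn (fun N : nat => (cexp (Cr (2 * pi) * iC R * z / 24)
          * \prod_(1 <= m < N.+1) (1 - qexp z ^+ m)) : (C R)^o).
Definition Pfun (R : realType) (z : C R) : C R :=
  if 0 < complex.Im z then (iC R / Cr pi) * (cderiv (@eta R) z / eta z) else 0.
Definition Dop (R : realType) (k : R) (f : C R -> C R) (z : C R) : C R :=
  if 0 < complex.Im z then
    (Cr (2 * pi) * iC R)^-1 * cderiv f z + Cr k * Pfun z * f z
  else 0.
Definition DV (R : realType) (n : nat) (k : R) (F : C R -> 'cV[C R]_n)
  : C R -> 'cV[C R]_n := fun z => \col_i Dop k (fun w => F w i 0) z.
Fixpoint DVn (R : realType) (n : nat) (k : R) (j : nat) (F : C R -> 'cV[C R]_n)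
  : C R -> 'cV[C R]_n :=
  match j with
  | 0 => F
  | j'.+1 => DV (k + 2 * j'%:R) (DVn k j' F)
  end.

(* ---------- the graded objects ----------
   An element of M = (+)_j M_j is a finitely supported family  A : int -> (C R -> C R)
   with A j in M_j.  An element of H(rho,u) = (+)_{n in Z} H(kw + n, rho, u)
   (kw the weight of u) is a finitely supported family G : int -> (C R -> 'cV_n)
   with G n in H(kw + n, rho, u). *)
Definition Mgraded (R : realType) (A : int -> (C R -> C R)) : Prop :=
  (forall j, Mform j (A j)) /\ exists N : nat, forall j : int, (N < `|j|)%N -> A j = (fun _ => 0).
Definition Hgraded (R : realType) (n : nat) (rho : 'M[int]_2 -> 'M[C R]_n)
  (u : 'M[int]_2 -> C R) (kw : R) (G : int -> (C R -> 'cV[C R]_n)) : Prop :=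
  (forall j : int, Hspace rho u (kw + j%:~R) (G j)) /\
  exists N : nat, forall j : int, (N < `|j|)%N -> G j = (fun _ => 0).
(* A . V  for A in M and V homogeneous, sitting in degree d of H(rho,u) *)
Definition actM (R : realType) (n : nat) (A : int -> (C R -> C R)) (d : int)
  (V : C R -> 'cV[C R]_n) : int -> (C R -> 'cV[C R]_n) :=
  fun j z => A (j - d) z *: V z.
(* the element  sum_{j < J} M_j D^j F0  of H(rho,u), F0 in degree d, weight k0 *)
Definition Rcomb (R : realType) (n : nat) (J : nat) (Ms : nat -> int -> (C R -> C R))
  (d : int) (k0 : R) (F0 : C R -> 'cV[C R]_n) : int -> (C R -> 'cV[C R]_n) :=
  fun j z => \sum_(i < J) (Ms i (j - (d + 2 * (i : nat)%:Z)) z *: DVn k0 i F0 z).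

Definition has_dim (R : realType) (n : nat) (S : (C R -> 'cV[C R]_n) -> Prop) (d : nat) : Prop :=
  exists b : 'I_d -> (C R -> 'cV[C R]_n),
    (forall i, S (b i)) /\
    (forall c : 'I_d -> C R, (fun z => \sum_i c i *: b i z) = (fun _ => 0) -> forall i, c i = 0) /\
    (forall F, S F -> exists c : 'I_d -> C R, F = fun z => \sum_i c i *: b i z).

Definition mlde2_sol (R : realType) (k : R) (M4 : C R -> C R) (f : C R -> C R) : Prop :=
  holoH f /\ offH0 f /\
  forall z : C R, 0 < complex.Im z -> Dop (k + 2) (Dop k f) z + M4 z * f z = 0.
Definition fundamental_system_MLDE2 (R : realType) (n : nat) (k : R)
  (F : C R -> 'cV[C R]_n) : Prop :=
  exists M4 : C R -> C R, Mform 4 M4 /\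
    (forall i, mlde2_sol k M4 (fun z => F z i 0)) /\
    (forall c : 'I_n -> C R, (fun z => \sum_i c i * F z i 0) = (fun _ => 0) -> forall i, c i = 0) /\
    (forall f, mlde2_sol k M4 f -> exists c : 'I_n -> C R, f = fun z => \sum_i c i * F z i 0).

(* Main.v *)
(* Periodic holomorphic functions of moderate growth on the upper half-plane are expanded in
   powers of q by Goursat's lemma and Chernoff's telescoping argument.  Irreducibility and
   T-unitarizability force the eigenvalues of rho(T) to be distinct, so rho(T) is diagonal in
   some basis and vectors in H(rho, u) have components q^(l_j) times a power series in q.
   The Wronskian W = det(F0, D F0) satisfies D W = 0 in weight 12 (l1 + l2), hence is a nonzero
   multiple of eta^(24 (l1 + l2)) and has no zero on the upper half-plane.  Transforming the
   differential equation by gamma gives the same equation with P replaced by its quasimodular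
   transform P|gamma; comparing the two Wronskian equations yields P|gamma = P.  So D maps
   H(k) to H(k + 2), and Cramer's rule writes any G in H(rho, u) uniquely as A F0 + B D F0 with
   A = det(G, D F0) / W and B = det(F0, G) / W, which are modular forms for SL2(Z).  The
   dimension formula is then dim M_2k + dim M_(2k-2), computed with E4, E6 and Delta, where
   E4 = 144 (D P + P^2) and E6 is a multiple of D E4. *)

Require Import Defs.
From HB Require Import structures.
From mathcomp Require Import all_boot all_order all_algebra.
From mathcomp Require Import complex.
From mathcomp Require Import all_classical all_reals all_analysis.
From mathcomp Require Import ring lra zify.
Import Order.TTheory GRing.Theory Num.Theory.
Local Open Scope ring_scope.
Import numFieldNormedType.Exports.
Set Implicit Arguments. Unset Strict Implicit. Unset Printing Implicit Defensive.
Local Notation Re := complex.Re.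
Local Notation Im := complex.Im.

(** * Complex derivatives and exponentials *)

Section ComplexModulus.
Variable R : realType.
Implicit Types z w : C R.

(** The transformation law of [eta] is never proved. The law of [P] is extracted from the existence
    of [F0], so the theory of level one forms carries it as a hypothesis until the Wronskian
    argument supplies it. That argument divides by [l1 + l2], which is positive because the
    exponents are distinct and nonnegative. No valence formula is used either. Invariant functions
    are constant by contraction: a bounded periodic function that vanishes at the cusp is smaller
    than its supremum by a fixed factor once the point has been moved to height at least 1/2.
    Multiplying or dividing by the zero-free [Delta] reduces other weights to this case, except
    weight 2, where a Riccati equation and the fixed point [i] decide. The bound [l_j < 1] makes
    moderate growth sufficient: after multiplication by [q^(-l_j)] a component is still [o(1/|q|)],
    which excludes negative powers. Finally [k0 = 6 (l1 + l2) - 1] gives the Wronskian the order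
    [l1 + l2] at the cusp, the least that a determinant of two vector-valued forms can have, so
    Cramer's quotients have no pole there. *)

Lemma cabsE w : cabs w = ComplexField.Normc.normc w. Proof. by case: w. Qed.

Lemma cabs_norm w : `|w| = Complex (cabs w) 0.
Proof. by case: w. Qed.

Lemma cabs0 : cabs (0 : C R) = 0. Proof. by rewrite cabsE ComplexField.Normc.normc0. Qed.
Lemma cabs1 : cabs (1 : C R) = 1. Proof. by rewrite cabsE ComplexField.Normc.normc1. Qed.
Lemma cabsM z w : cabs (z * w) = cabs z * cabs w.
Proof. by rewrite !cabsE ComplexField.Normc.normcM. Qed.
Lemma cabsV z : cabs z^-1 = (cabs z)^-1.
Proof. by rewrite !cabsE ComplexField.Normc.normcV. Qed.
Lemma cabsN z : cabs (- z) = cabs z.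
Proof. by rewrite !cabsE normcN. Qed.
Lemma cabsD z w : cabs (z + w) <= cabs z + cabs w.
Proof. by rewrite !cabsE le_normcD. Qed.
Lemma cabsB z w : cabs (z - w) <= cabs z + cabs w.
Proof. by rewrite -(cabsN w) cabsD. Qed.
Lemma cabsC z w : cabs (z - w) = cabs (w - z).
Proof. by rewrite -cabsN opprB. Qed.
Lemma cabs_ge0 z : 0 <= cabs z. Proof. exact: sqrtr_ge0. Qed.
Lemma cabs_eq0 z : (cabs z == 0) = (z == 0).
Proof.
apply/eqP/eqP => [|->]; last exact: cabs0.
by rewrite cabsE => /ComplexField.Normc.eq0_normc.
Qed.
Lemma cabs_gt0 z : (0 < cabs z) = (z != 0).
Proof. by rewrite lt_def cabs_ge0 andbT cabs_eq0. Qed.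
Lemma cabsX z n : cabs (z ^+ n) = cabs z ^+ n.
Proof. by elim: n => [|n IH]; rewrite ?expr0 ?cabs1 // !exprS cabsM IH. Qed.
Lemma cabs_Cr (x : R) : cabs (Cr x) = `|x|.
Proof. by rewrite /cabs /= expr0n /= addr0 sqrtr_sqr. Qed.
Lemma cabs_sqr z : cabs z ^+ 2 = Re z ^+ 2 + Im z ^+ 2.
Proof. by rewrite sqr_sqrtr // addr_ge0 // sqr_ge0. Qed.
Lemma cabs_Re z : `|Re z| <= cabs z.
Proof. by rewrite -sqrtr_sqr ler_wsqrtr // lerDl sqr_ge0. Qed.
Lemma cabs_Im z : `|Im z| <= cabs z.
Proof. by rewrite -sqrtr_sqr ler_wsqrtr // lerDr sqr_ge0. Qed.
Lemma cabs_le z : cabs z <= `|Re z| + `|Im z|.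
Proof.
rewrite -(ger0_norm (cabs_ge0 z)) -ler_sqr ?nnegrE ?addr_ge0 ?normr_ge0 //.
rewrite real_normK ?num_real // cabs_sqr sqrrD !real_normK ?num_real //.
by rewrite -addrA lerD2l lerDr mulrn_wge0 // mulr_ge0.
Qed.
Lemma cabs_sub z w : cabs z - cabs w <= cabs (z - w).
Proof. by rewrite lerBlDr; apply: le_trans (cabsD _ _); rewrite subrK. Qed.

Lemma CrD (x y : R) : Cr (x + y) = Cr x + Cr y.
Proof. by rewrite /Cr; apply/eqP; rewrite eq_complex /= !addr0 !eqxx. Qed.
Lemma CrM (x y : R) : Cr (x * y) = Cr x * Cr y.
Proof. by apply/eqP; rewrite eq_complex /= !mul0r !mulr0 subr0 addr0 !eqxx. Qed.
Lemma CrN (x : R) : Cr (- x) = - Cr x.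
Proof. by apply/eqP; rewrite eq_complex /= oppr0 !eqxx. Qed.
Lemma Cr0 : Cr (0 : R) = 0. Proof. by []. Qed.
Lemma Cr1 : Cr (1 : R) = 1. Proof. by []. Qed.
Lemma CrV (x : R) : Cr x^-1 = (Cr x)^-1.
Proof.
have [->|x0] := eqVneq x 0; first by rewrite invr0 Cr0 invr0.
have Crx0 : Cr x != 0 by rewrite eq_complex /= negb_and x0.
by apply: (mulfI Crx0); rewrite -CrM !divff.
Qed.
Lemma Cr_nat n : Cr (n%:R : R) = n%:R.
Proof. by elim: n => [|n IH] //; rewrite -[n.+1]addn1 !natrD CrD IH Cr1. Qed.
Lemma Cr_int n : Cr (n%:~R : R) = n%:~R.
Proof. by case: n => n; rewrite ?NegzE ?mulrNz ?CrN -!pmulrn Cr_nat. Qed.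
Lemma Cr_eq0 (x : R) : (Cr x == 0) = (x == 0).
Proof. by rewrite eq_complex /= eqxx andbT. Qed.

Lemma iC_sqr : iC R * iC R = -1.
Proof. by apply/eqP; rewrite eq_complex /= !mul0r !mulr0 mulr1 sub0r oppr0 addr0 !eqxx. Qed.
Lemma iC_neq0 : iC R != 0.
Proof. by rewrite eq_complex /= oner_eq0 andbF. Qed.
Lemma cabs_iC : cabs (iC R) = 1.
Proof. by rewrite /cabs /= expr0n /= add0r expr1n sqrtr1. Qed.
Lemma complex_split z : z = Cr (Re z) + Cr (Im z) * iC R.
Proof.
by case: z => a b; apply/eqP; rewrite eq_complex /= !mulr0 !mul0r mulr1 !subr0 !addr0 add0r !eqxx.
Qed.
Lemma ReD z w : Re (z + w) = Re z + Re w.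
Proof. by case: z; case: w. Qed.
Lemma ImD z w : Im (z + w) = Im z + Im w.
Proof. by case: z; case: w. Qed.
Lemma ReN z : Re (- z) = - Re z. Proof. by case: z. Qed.
Lemma ImN z : Im (- z) = - Im z. Proof. by case: z. Qed.
Lemma ReM z w : Re (z * w) =
  Re z * Re w - Im z * Im w.
Proof. by case: z; case: w. Qed.
Lemma ImM z w : Im (z * w) =
  Re z * Im w + Im z * Re w.
Proof. by case: z => a b; case: w => c d /=; rewrite [b * c]mulrC. Qed.
Lemma ReCrM (x : R) z : Re (Cr x * z) = x * Re z.
Proof. by case: z => a b /=; rewrite mul0r subr0. Qed.
Lemma ImCrM (x : R) z : Im (Cr x * z) = x * Im z.
Proof. by case: z => a b /=; rewrite mul0r addr0. Qed.

End ComplexModulus.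

Section ComplexDerivative.
Variable R : realType.
Implicit Types (f g : C R -> C R) (z w l m : C R).

(** The remainder form contains no division, so [h = 0] needs no exclusion and the chain rule
    composes two estimates directly. [cdv_derivable] and [derivable_cdv] connect it with the
    derivative of the statement. *)
Definition cdv f z l := forall e : R, 0 < e -> exists2 d : R, 0 < d &
  forall h : C R, cabs h < d -> cabs (f (z + h) - f z - l * h) <= e * cabs h.

Definition ccont f z := forall e : R, 0 < e -> exists2 d : R, 0 < d &
  forall h : C R, cabs h < d -> cabs (f (z + h) - f z) < e.

Lemma cdv_derivable f z l : cdv f z l ->
  @derivable (C R) (C R)^o (C R)^o f z 1 /\ cderiv f z = l.
Proof.
move=> fl.
have H : ((fun h : (C R)^o => h^-1 *: ((f \o shift z) (h *: (1 : (C R)^o)) - f z) : (C R)^o)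
    @ ((0 : (C R)^o)^') --> (l : (C R)^o))%classic.
  apply/cvgrPdist_le => /= e e0.
  have [er ei] : 0 < Re e /\ e = Cr (Re e).
    by move: e0; case: e => a b; rewrite ltcE /= => /andP[/eqP-> ].
  have [d d0 fd] := fl _ er.
  near=> h.
  have h0 : h != 0 by near: h; exact: nbhs_dnbhs_neq.
  have hd : cabs h < d.
    have : `|h| < (Cr d : C R).
      by near: h; apply: dnbhs0_lt; rewrite ltcE /= eqxx d0.
    by rewrite cabs_norm ltcE /= => /andP[].
  have := fd h hd; rewrite /= [h *: _]mulr1 [h + z]addrC.
  set D := f (z + h) - f z => Dh.
  have -> : l - h^-1 *: (D : (C R)^o) = - (h^-1 * (D - l * h)).
    by rewrite /GRing.scale /=; field.
  rewrite normrN cabs_norm ei lecE /= eqxx /= cabsM cabsV ler_pdivrMl ?cabs_gt0 //.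
  by rewrite [cabs h * _]mulrC.
split; first by apply/cvg_ex; exists l.
by rewrite /cderiv /derive; apply: (@cvg_lim (C R)^o) => //; exact: norm_hausdorff.
Unshelve. all: by end_near. Qed.

Lemma derivable_cdv f z : @derivable (C R) (C R)^o (C R)^o f z 1 -> cdv f z (cderiv f z).
Proof.
move=> /= H e e0.
have e0' : 0 < Cr e by rewrite ltcE /= eqxx e0.
have /cvgrPdist_le /(_ _ e0') := H.
rewrite /dnbhs => /nbhs_ballP [d /= d0 Hd].
have [dr di] : 0 < Re d /\ d = Cr (Re d).
  by move: d0; case: (d) => a b; rewrite ltcE /= => /andP[/eqP-> ].
exists (Re d) => // h hd.
have [->|h0] := eqVneq h 0.
  by rewrite addr0 mulr0 subrr subr0 cabs0 mulr0.
have : `|cderiv f z - h^-1 *: ((f (h *: (1 : (C R)^o) + z) - f z) : (C R)^o)| <= Cr e.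
  apply: Hd => //.
  by rewrite /ball /= sub0r normrN cabs_norm di ltcE /= eqxx.
rewrite [h *: _]mulr1 addrC [h + z]addrC; set D := f (z + h) - f z.
have -> : h^-1 *: (D : (C R)^o) = h^-1 * D by [].
rewrite cabs_norm lecE /= eqxx /= => He.
have -> : D - cderiv f z * h = - h * (- (h^-1 * D) + cderiv f z) by field.
by rewrite cabsM cabsN mulrC ler_wpM2r ?cabs_ge0.
Qed.

Lemma cdv_cderiv f z l : cdv f z l -> cderiv f z = l.
Proof. by case/cdv_derivable. Qed.

Lemma cdv_uniq f z l m : cdv f z l -> cdv f z m -> l = m.
Proof. by move=> /cdv_cderiv <- /cdv_cderiv <-. Qed.

Lemma cdv_cont f z l : cdv f z l -> ccont f z.
Proof.
move=> fl e e0; have [d d0 H] := fl 1 ltr01.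
have k0 : 0 < 1 + cabs l by rewrite ltr_pwDl // cabs_ge0.
exists (Num.min d (e / 2 / (1 + cabs l))); first by rewrite lt_min d0 !divr_gt0.
move=> h; rewrite lt_min => /andP[hd he].
have : cabs (f (z + h) - f z) <= cabs h * (1 + cabs l).
  have -> : f (z + h) - f z = (f (z + h) - f z - l * h) + l * h by rewrite subrK.
  by apply: le_trans (cabsD _ _) _; rewrite [cabs h * _]mulrC mulrDl lerD ?H // cabsM.
move/le_lt_trans; apply; rewrite -ltr_pdivlMr //.
by apply: lt_trans he _; rewrite ltr_pM2r ?invr_gt0 // ltr_pdivrMr // ltr_pMr // ltr1n.
Qed.

Lemma cdv_cst (c z : C R) : cdv (fun _ => c) z 0.
Proof. by move=> e e0; exists 1 => // h _; rewrite subrr mul0r subr0 cabs0 mulr_ge0 ?cabs_ge0 ?ltW. Qed.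

Lemma cdv_id z : cdv (fun w => w) z 1.
Proof.
move=> e e0; exists 1 => // h _.
have -> : z + h - z - 1 * h = 0 by ring.
by rewrite cabs0 mulr_ge0 ?cabs_ge0 ?ltW.
Qed.

Lemma cdv_eq f z l m : cdv f z l -> l = m -> cdv f z m.
Proof. by move=> ? <-. Qed.

Lemma cdvD f g z l m : cdv f z l -> cdv g z m -> cdv (fun w => f w + g w) z (l + m).
Proof.
move=> fl gm e e0; have e2 : 0 < e / 2 by rewrite divr_gt0.
have [d1 d10 H1] := fl _ e2; have [d2 d20 H2] := gm _ e2.
exists (Num.min d1 d2); first by rewrite lt_min d10.
move=> h; rewrite lt_min => /andP[h1 h2].
have -> : f (z + h) + g (z + h) - (f z + g z) - (l + m) * h =
  (f (z + h) - f z - l * h) + (g (z + h) - g z - m * h) by ring.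
apply: le_trans (cabsD _ _) _.
rewrite (splitr e) mulrDl; exact: lerD (H1 _ h1) (H2 _ h2).
Qed.

Lemma cdv_near f g z l (d : R) : 0 < d -> (forall w, cabs (w - z) < d -> f w = g w) ->
  cdv f z l -> cdv g z l.
Proof.
move=> d0 fg fl e e0; have [d1 d10 H1] := fl _ e0.
exists (Num.min d d1); first by rewrite lt_min d0.
move=> h; rewrite lt_min => /andP[h1 h2].
by rewrite -!fg ?subrr ?cabs0 // ?H1 // [z + h]addrC addrK.
Qed.

Lemma cdvM f g z l m : cdv f z l -> cdv g z m ->
  cdv (fun w => f w * g w) z (l * g z + f z * m).
Proof.
move=> fl gm e e0.
have gc := cdv_cont gm.
(* One constant dominates the cofactors of all three error terms, so each of them receives a third
   of [e]. *)
pose A := 1 + cabs (g z) + cabs (f z) + cabs l.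
have A0 : 0 < A by rewrite /A -!addrA ltr_pwDl // ?addr_ge0 ?cabs_ge0.
pose e' := e / 3 / A.
have e'0 : 0 < e' by rewrite !divr_gt0.
have [d1 d10 H1] := fl _ e'0; have [d2 d20 H2] := gm _ e'0.
have [d3 d30 H3] := gc _ (ltr01 : 0 < 1 :> R); have [d4 d40 H4] := gc _ e'0.
exists (Num.min (Num.min d1 d2) (Num.min d3 d4)); first by rewrite !lt_min d10 d20 d30 d40.
move=> h; rewrite !lt_min => /andP[/andP[h1 h2] /andP[h3 h4]].
have -> : f (z + h) * g (z + h) - f z * g z - (l * g z + f z * m) * h =
  (f (z + h) - f z - l * h) * g (z + h) + f z * (g (z + h) - g z - m * h)
  + l * h * (g (z + h) - g z) by ring.
have hh := cabs_ge0 h.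
have B1 : cabs ((f (z + h) - f z - l * h) * g (z + h)) <= e / 3 * cabs h.
  have gA : cabs (g (z + h)) <= A.
    have -> : g (z + h) = (g (z + h) - g z) + g z by rewrite subrK.
    apply: le_trans (cabsD _ _) _; rewrite /A -!addrA; apply: lerD; first exact: ltW (H3 _ h3).
    by rewrite lerDl addr_ge0 ?cabs_ge0.
  rewrite cabsM; apply: le_trans (ler_pM (cabs_ge0 _) (cabs_ge0 _) (H1 _ h1) gA) _.
  by rewrite mulrAC /e' divfK // gt_eqF.
have B2 : cabs (f z * (g (z + h) - g z - m * h)) <= e / 3 * cabs h.
  have fA : cabs (f z) <= A by rewrite /A; have := cabs_ge0 (g z); have := cabs_ge0 l; lra.
  rewrite cabsM; apply: le_trans (ler_pM (cabs_ge0 _) (cabs_ge0 _) fA (H2 _ h2)) _.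
  by rewrite mulrA [A * _]mulrC /e' divfK // gt_eqF.
have B3 : cabs (l * h * (g (z + h) - g z)) <= e / 3 * cabs h.
  have lA : cabs l <= A by rewrite /A; have := cabs_ge0 (g z); have := cabs_ge0 (f z); lra.
  rewrite cabsM cabsM mulrAC.
  apply: ler_wpM2r => //.
  apply: le_trans (ler_pM (cabs_ge0 _) (cabs_ge0 _) lA (ltW (H4 _ h4))) _.
  by rewrite [A * _]mulrC /e' divfK // gt_eqF.
have -> : e * cabs h = e / 3 * cabs h + e / 3 * cabs h + e / 3 * cabs h by field.
apply: le_trans (cabsD _ _) _; apply: lerD => //.
by apply: le_trans (cabsD _ _) _; apply: lerD.
Qed.

Lemma cdv_cstM (c : C R) f z l : cdv f z l -> cdv (fun w => c * f w) z (c * l).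
Proof. move=> fl; apply: cdv_eq (cdvM (cdv_cst c z) fl) _; by rewrite mul0r add0r. Qed.

Lemma cdvN f z l : cdv f z l -> cdv (fun w => - f w) z (- l).
Proof.
move=> fl; have := cdv_cstM (-1) fl; rewrite mulN1r.
by apply: cdv_near ltr01 _ => w _; rewrite mulN1r.
Qed.

Lemma cdvB f g z l m : cdv f z l -> cdv g z m -> cdv (fun w => f w - g w) z (l - m).
Proof. by move=> fl /cdvN; exact: cdvD. Qed.

Lemma cdv_comp f g z l m : cdv f z l -> cdv g (f z) m -> cdv (fun w => g (f w)) z (m * l).
Proof.
move=> fl gm e e0.
have A0 : 0 < 1 + cabs l by rewrite ltr_pwDl // cabs_ge0.
have B0 : 0 < 1 + cabs m by rewrite ltr_pwDl // cabs_ge0.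
have e1 : 0 < e / 2 / (1 + cabs l) by rewrite !divr_gt0.
have e2 : 0 < e / 2 / (1 + cabs m) by rewrite !divr_gt0.
have [d1 d10 H1] := gm _ e1.
have [d2 d20 H2] := fl _ e2.
have [d3 d30 H3] := fl _ (ltr01 : 0 < 1 :> R).
have [d4 d40 H4] := cdv_cont fl d10.
exists (Num.min (Num.min d4 d2) d3); first by rewrite !lt_min d20 d30 d40.
move=> h; rewrite !lt_min => /andP[/andP[h1 h2] h3].
set k := f (z + h) - f z.
have fk : f (z + h) = f z + k by rewrite /k addrCA subrr addr0.
have kA : cabs k <= (1 + cabs l) * cabs h.
  have -> : k = (k - l * h) + l * h by rewrite subrK.
  by apply: le_trans (cabsD _ _) _; rewrite cabsM mulrDl lerD ?H3.
rewrite fk.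
have -> : g (f z + k) - g (f z) - m * l * h = (g (f z + k) - g (f z) - m * k) + m * (k - l * h).
  by ring.
apply: le_trans (cabsD _ _) _; rewrite (splitr e) mulrDl; apply: lerD.
  apply: le_trans (H1 k (H4 _ h1)) _.
  apply: le_trans (ler_wpM2l (ltW e1) kA) _.
  by rewrite mulrA divfK // gt_eqF.
rewrite cabsM; apply: le_trans (ler_wpM2l (cabs_ge0 _) (H2 _ h2)) _.
rewrite mulrA ler_wpM2r ?cabs_ge0 // mulrCA -[X in _ <= X]mulr1 ler_wpM2l // ?divr_ge0 ?ltW //.
by rewrite ltr_pdivrMr // mul1r ltrDr.
Qed.

Lemma ccont_neq0 f z : ccont f z -> f z != 0 ->
  exists2 d : R, 0 < d & forall h, cabs h < d -> f (z + h) != 0.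
Proof.
move=> fc fz; have fz' : 0 < cabs (f z) by rewrite cabs_gt0.
have [d d0 H] := fc _ fz'.
exists d => // h /H; apply: contraTneq => ->; by rewrite sub0r cabsN ltxx.
Qed.

Lemma cdv_inv z : z != 0 -> cdv (fun w => w^-1) z (- (z ^- 2)).
Proof.
move=> z0 e e0.
have cz : 0 < cabs z by rewrite cabs_gt0.
exists (Num.min (cabs z / 2) (e * cabs z ^+ 3 / 2)).
  by rewrite lt_min !divr_gt0 // mulr_gt0 // exprn_gt0.
move=> h; rewrite lt_min => /andP[h1 h2].
have zh : cabs z / 2 < cabs (z + h).
  have := cabs_sub z (- h); rewrite cabsN opprK; lra.
have zh0 : z + h != 0 by rewrite -cabs_gt0; apply: lt_trans zh; rewrite divr_gt0.
have -> : (z + h)^-1 - z^-1 - - z ^- 2 * h = h ^+ 2 / (z ^+ 2 * (z + h)).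
  by field; rewrite zh0 z0.
rewrite cabsM cabsV cabsM !cabsX expr2 ler_pdivrMr; last first.
  by rewrite mulr_gt0 ?exprn_gt0 // cabs_gt0.
rewrite -mulrA [e * _]mulrC -mulrA ler_wpM2l ?cabs_ge0 //.
apply: le_trans (ltW h2) _.
rewrite exprSr [_ * e]mulrC -mulrA ler_wpM2l ?(ltW e0) // -mulrA ler_wpM2l ?exprn_ge0 ?(ltW cz) //.
by rewrite ltW.
Qed.

Lemma cdvV f z l : cdv f z l -> f z != 0 ->
  cdv (fun w => (f w)^-1) z (- l / f z ^+ 2).
Proof.
move=> fl f0; apply: cdv_eq (cdv_comp fl (cdv_inv f0)) _.
by rewrite mulNr mulNr mulrC.
Qed.

Lemma cdv_div f g z l m : cdv f z l -> cdv g z m -> g z != 0 ->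
  cdv (fun w => f w / g w) z ((l * g z - f z * m) / g z ^+ 2).
Proof.
move=> fl gm g0; apply: cdv_eq (cdvM fl (cdvV gm g0)) _; by field.
Qed.

Lemma cdvX f z l n : cdv f z l -> cdv (fun w => f w ^+ n) z (n%:R * f z ^+ n.-1 * l).
Proof.
move=> fl; elim: n => [|n IH]; first by rewrite mul0r mul0r; exact: cdv_cst.
apply: cdv_near ltr01 _ _; last first.
  apply: cdv_eq (cdvM fl IH) _; last first.
  case: n {IH} => [|n] /=; rewrite ?expr0 ?expr1; first by ring.
  by rewrite exprS; ring.
by move=> w _; rewrite exprS.
Qed.

End ComplexDerivative.

(** * Derivatives along real paths and mean value estimates *)

Section Paths.
Variable R : realType.

Lemma eps_is_derive (f : R -> R) (x l : R) :
  (forall e : R, 0 < e -> exists2 d : R, 0 < d &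
    forall h, `|h| < d -> `|f (x + h) - f x - l * h| <= e * `|h|) ->
  is_derive x 1 f l.
Proof.
move=> fl.
have H : ((fun h : R => h^-1 *: ((f \o shift x) (h *: (1 : R)) - f x))
    @ ((0 : R)^') --> l)%classic.
  apply/cvgrPdist_le => /= e e0.
  have [d d0 fd] := fl _ e0.
  near=> h.
  have h0 : h != 0 by near: h; exact: nbhs_dnbhs_neq.
  have hd : `|h| < d by near: h; apply: dnbhs0_lt.
  have := fd h hd; rewrite /= [h *: _]mulr1 [h + x]addrC.
  set D := f (x + h) - f x => Dh.
  have -> : l - h^-1 *: D = - (h^-1 * (D - l * h)).
    by rewrite /GRing.scale /=; field.
  by rewrite normrN normrM normfV ler_pdivrMl ?normr_gt0 // [`|h| * _]mulrC.
have D : derivable f x 1 by apply/cvg_ex; exists l.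
by apply: DeriveDef => //; apply: cvg_lim => //.
Unshelve. all: by end_near. Qed.

(** Taken componentwise so that the real mean value theorem and the real fundamental theorem of
    calculus apply. *)
Definition rdv (f : R -> C R) (t : R) (l : C R) :=
  is_derive t 1 (fun s => Re (f s)) (Re l) /\
  is_derive t 1 (fun s => Im (f s)) (Im l).

Lemma cdv_path (f : C R -> C R) (z w l : C R) (t : R) :
  cdv f (z + Cr t * w) l -> rdv (fun s => f (z + Cr s * w)) t (l * w).
Proof.
move=> fl.
have H e : 0 < e -> exists2 d : R, 0 < d & forall h : R, `|h| < d ->
   cabs (f (z + Cr (t + h) * w) - f (z + Cr t * w) - l * w * Cr h) <= e * `|h|.
  move=> e0; have k0 : 0 < 1 + cabs w by rewrite ltr_pwDl // cabs_ge0.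
  have e1 : 0 < e / (1 + cabs w) by rewrite divr_gt0.
  have [d d0 Hd] := fl _ e1; exists (d / (1 + cabs w)); first by rewrite divr_gt0.
  move=> h; rewrite ltr_pdivlMr // => hd.
  have hw : cabs (Cr h * w) <= `|h| * (1 + cabs w).
    by rewrite cabsM cabs_Cr ler_wpM2l // lerDr.
  have := Hd (Cr h * w) (le_lt_trans hw hd).
  rewrite CrD mulrDl addrA -!mulrA [w * Cr h]mulrC => /le_trans; apply.
  by rewrite (ler_pM2l e0) ler_pdivrMl // [_ * `|h|]mulrC.
split; apply: eps_is_derive => e /H [d d0 Hd]; exists d => // h /Hd; apply: le_trans.
  apply: le_trans (cabs_Re _).
  by rewrite !(ReD, ReN) [_ * Cr h]mulrC ReCrM [h * _]mulrC.
apply: le_trans (cabs_Im _).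
by rewrite !(ImD, ImN) [_ * Cr h]mulrC ImCrM [h * _]mulrC.
Qed.

Lemma rdv_eq (f : R -> C R) t l m : rdv f t l -> l = m -> rdv f t m.
Proof. by move=> ? <-. Qed.

Lemma rdvB (f g : R -> C R) t l m :
  rdv f t l -> rdv g t m -> rdv (fun s => f s - g s) t (l - m).
Proof.
move=> [f1 f2] [g1 g2]; rewrite /rdv !(ReD, ReN, ImD, ImN); split.
  rewrite (_ : (fun s => _) = (fun s => Re (f s)) - (fun s => Re (g s))).
    exact: is_deriveB.
  by apply/funext => s; rewrite ReD ReN.
rewrite (_ : (fun s => _) = (fun s => Im (f s)) - (fun s => Im (g s))).
  exact: is_deriveB.
by apply/funext => s; rewrite ImD ImN.
Qed.

Lemma real_mean_value_bound (f df : R -> R) (a b M : R) : a <= b ->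
  (forall t, a <= t <= b -> is_derive t 1 f (df t)) ->
  (forall t, a <= t <= b -> `|df t| <= M) -> `|f b - f a| <= M * (b - a).
Proof.
move=> ab fd fM.
have [||c] := @MVT_segment R f df a b ab.
- by move=> x; rewrite in_itv /= => /andP[? ?]; apply: fd; rewrite !ltW.
- apply: derivable_within_continuous => x; rewrite in_itv /= => /fd H.
  exact: ex_derive.
rewrite in_itv /= => /fM cM ->.
by rewrite normrM [`|b - a|]ger0_norm ?subr_ge0 // ler_wpM2r // subr_ge0.
Qed.

(** The factor 2 is the cost of applying the real mean value theorem to the real and imaginary parts
    separately. *)
Lemma mean_value_bound (f df : R -> C R) (a b M : R) : a <= b ->
  (forall t, a <= t <= b -> rdv f t (df t)) ->
  (forall t, a <= t <= b -> cabs (df t) <= M) ->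
  cabs (f b - f a) <= 2 * M * (b - a).
Proof.
move=> ab fd fM; apply: le_trans (cabs_le _) _; rewrite !(ReD, ReN, ImD, ImN).
rewrite -mulrA [2 * _]mulr_natl mulr2n; apply: lerD.
  apply: (@real_mean_value_bound (fun s => Re (f s)) (fun s => Re (df s))) => // t /[dup] /fd[? ?] /fM //.
  exact: le_trans (cabs_Re _).
apply: (@real_mean_value_bound (fun s => Im (f s)) (fun s => Im (df s))) => // t /[dup] /fd[? ?] /fM //.
exact: le_trans (cabs_Im _).
Qed.

Lemma segment_bound (f df : C R -> C R) (z w : C R) (M : R) :
  (forall t, 0 <= t <= 1 -> cdv f (z + Cr t * w) (df (z + Cr t * w))) ->
  (forall t, 0 <= t <= 1 -> cabs (df (z + Cr t * w)) <= M) ->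
  cabs (f (z + w) - f z) <= 2 * M * cabs w.
Proof.
move=> fd fM.
have := @mean_value_bound (fun s => f (z + Cr s * w))
  (fun s => df (z + Cr s * w) * w) 0 1 (M * cabs w) ler01.
rewrite Cr1 Cr0 mul1r mul0r addr0 subr0 mulr1 mulrA; apply.
  by move=> t /fd /cdv_path.
by move=> t /fM H; rewrite cabsM ler_wpM2r // cabs_ge0.
Qed.

End Paths.

(** * The complex exponential and real powers of q *)

Section Exponential.
Variable R : realType.
Implicit Types z w : C R.

Lemma cexpD z w : cexp (z + w) = cexp z * cexp w.
Proof.
apply/eqP; rewrite eq_complex /= !ReD !ImD expRD cosD sinD.
by apply/andP; split; apply/eqP; ring.
Qed.
Lemma cexp0 : cexp (0 : C R) = 1.
Proof. by apply/eqP; rewrite eq_complex /= expR0 cos0 sin0 mulr0 mulr1 !eqxx. Qed.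
Lemma cabs_cexp w : cabs (cexp w) = expR (Re w).
Proof.
rewrite /cabs /= !exprMn -mulrDr cos2Dsin2 mulr1 sqrtr_sqr ger0_norm //.
Qed.
Lemma cexp_neq0 w : cexp w != 0.
Proof. by rewrite -cabs_gt0 cabs_cexp expR_gt0. Qed.
Lemma cexpN w : cexp (- w) = (cexp w)^-1.
Proof. by apply: (mulfI (cexp_neq0 w)); rewrite -cexpD subrr cexp0 divff // cexp_neq0. Qed.

(** On a line through 0 only real functions of one variable occur. The Taylor estimate at 0 obtained
    from this, together with [cexpD], gives the complex derivative everywhere without the
    Cauchy-Riemann equations. *)
Lemma rdv_cexp_line w t : rdv (fun s => cexp (Cr s * w)) t (w * cexp (Cr t * w)).
Proof.
case: w => a b.
have lin (c : R) : is_derive t 1 (fun s : R => s * c) c.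
  by apply: is_derive_eq; rewrite /GRing.scale /= ?mulr0 ?addr0 ?add0r ?mulr1.
have Ha := lin a; have Hb := lin b.
have HE : is_derive t 1 (fun s : R => expR (s * a)) (a * expR (t * a)).
  by apply: is_derive_eq; rewrite /GRing.scale /= ?mulr0 ?addr0 ?add0r ?mulr1 // mulrC.
have HC : is_derive t 1 (fun s : R => cos (s * b)) (b * - sin (t * b)).
  by apply: is_derive_eq; rewrite /GRing.scale /= ?mulr0 ?addr0 ?add0r ?mulr1 // mulrC.
have HS : is_derive t 1 (fun s : R => sin (s * b)) (b * cos (t * b)).
  by apply: is_derive_eq; rewrite /GRing.scale /= ?mulr0 ?addr0 ?add0r ?mulr1 // mulrC.
split.
  rewrite (_ : (fun s => _) = (fun s => expR (s * a) * cos (s * b))); last first.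
    by apply/funext => s /=; rewrite !mul0r subr0 addr0.
  by apply: is_derive_eq; rewrite /GRing.scale /= !mul0r subr0 addr0; ring.
rewrite (_ : (fun s => _) = (fun s => expR (s * a) * sin (s * b))); last first.
  by apply/funext => s /=; rewrite !mul0r subr0 addr0.
by apply: is_derive_eq; rewrite /GRing.scale /= !mul0r subr0 addr0; ring.
Qed.

Lemma cexp_line_bound w t : 0 <= t <= 1 -> cabs (cexp (Cr t * w)) <= expR (cabs w).
Proof.
case/andP=> t0 t1; rewrite cabs_cexp ReCrM ler_expR.
apply: le_trans (ler_norm _) _; rewrite normrM ger0_norm //.
by apply: le_trans (ler_wpM2l t0 (cabs_Re _)) _; rewrite ler_piMl // cabs_ge0.
Qed.

Lemma cexp_sub1_bound w : cabs (cexp w - 1) <= 2 * (cabs w * expR (cabs w)).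
Proof.
have := @mean_value_bound R (fun s => cexp (Cr s * w)) (fun s => w * cexp (Cr s * w)) 0 1
  (cabs w * expR (cabs w)) ler01.
rewrite Cr1 Cr0 mul0r mul1r cexp0 subr0 mulr1; apply.
  by move=> t _; exact: rdv_cexp_line.
by move=> t t01; rewrite cabsM ler_wpM2l ?cabs_ge0 // cexp_line_bound.
Qed.

Lemma rdv_line w t : rdv (fun s => Cr s * w) t w.
Proof.
case: w => a b; split.
  rewrite (_ : (fun s => _) = (fun s => s * a)).
    by apply: is_derive_eq; rewrite /GRing.scale /= ?mulr0 ?addr0 ?add0r ?mulr1.
  by apply/funext => s /=; rewrite mul0r subr0.
rewrite (_ : (fun s => _) = (fun s => s * b)).
  by apply: is_derive_eq; rewrite /GRing.scale /= ?mulr0 ?addr0 ?add0r ?mulr1.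
by apply/funext => s /=; rewrite mul0r addr0.
Qed.

(** Mean value bound for [cexp (s w) - s w], whose derivative [w (cexp (s w) - 1)] is controlled by
    the first order estimate. *)
Lemma cexp_taylor_bound w :
  cabs (cexp w - 1 - w) <= 4 * (cabs w ^+ 2 * expR (cabs w)).
Proof.
have := @mean_value_bound R (fun s => cexp (Cr s * w) - Cr s * w)
  (fun s => w * cexp (Cr s * w) - w) 0 1 (2 * (cabs w ^+ 2 * expR (cabs w))) ler01.
rewrite Cr1 Cr0 mul0r mul1r cexp0 !subr0 mulr1.
rewrite (_ : cexp w - w - 1 = cexp w - 1 - w); last by ring.
rewrite (_ : 4 * (cabs w ^+ 2 * expR (cabs w)) = 2 * (2 * (cabs w ^+ 2 * expR (cabs w)))); last by ring.
apply.
  by move=> t _; apply: rdvB; [exact: rdv_cexp_line | exact: rdv_line].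
move=> t /[dup] t01 /andP[t0 t1].
rewrite -[X in _ - X]mulr1 -mulrBr cabsM expr2 mulrCA -mulrA ler_wpM2l ?cabs_ge0 //.
apply: le_trans (cexp_sub1_bound _) _.
rewrite mulrCA; rewrite ler_pM2l // cabsM cabs_Cr ger0_norm //.
have tw : t * cabs w <= cabs w by rewrite ler_piMl // cabs_ge0.
by apply: ler_pM; rewrite ?mulr_ge0 ?cabs_ge0 ?expR_ge0 // ler_expR.
Qed.

Lemma cdv_cexp z : cdv (@cexp R) z (cexp z).
Proof.
move=> e e0.
pose K := 4 * expR 1 * cabs (cexp z).
have K0 : 0 < K by rewrite !mulr_gt0 ?expR_gt0 // cabs_gt0 cexp_neq0.
exists (Num.min 1 (e / K)); first by rewrite lt_min ltr01 divr_gt0.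
move=> h; rewrite lt_min => /andP[h1 h2].
rewrite cexpD (_ : _ - _ - _ = cexp z * (cexp h - 1 - h)); last by ring.
rewrite cabsM; apply: le_trans (ler_wpM2l (cabs_ge0 _) (cexp_taylor_bound h)) _.
rewrite ltr_pdivlMr // in h2.
have e1 : expR (cabs h) <= expR 1 by rewrite ler_expR ltW.
apply: (@le_trans _ _ (cabs h * K * cabs h)); last by rewrite ler_wpM2r ?cabs_ge0 // ltW.
rewrite (_ : cabs h * K * cabs h = cabs (cexp z) * (4 * (cabs h ^+ 2 * expR 1))).
  by rewrite !ler_wpM2l ?cabs_ge0 ?exprn_ge0 ?cabs_ge0.
by rewrite /K; ring.
Qed.

(** This is [q^s] for real [s]; as an exponential in [z] it involves no choice of branch. *)
Definition qq (s : R) z := cexp (Cr (2 * pi * s) * iC R * z).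

Lemma Re_qq s z : Re (Cr (2 * pi * s) * iC R * z) = - (2 * pi * s * Im z).
Proof. by rewrite -mulrA ReCrM ReM /= mul0r mul1r sub0r mulrN. Qed.

Lemma cabs_qq s z : cabs (qq s z) = expR (- (2 * pi * s * Im z)).
Proof. by rewrite cabs_cexp Re_qq. Qed.
Lemma qq_neq0 s z : qq s z != 0. Proof. exact: cexp_neq0. Qed.
Lemma qqD s t z : qq (s + t) z = qq s z * qq t z.
Proof. by rewrite /qq -cexpD mulrDr CrD !mulrDl. Qed.
Lemma qq0 z : qq 0 z = 1.
Proof. by rewrite /qq mulr0 Cr0 !mul0r cexp0. Qed.
Lemma qqN s z : qq (- s) z = (qq s z)^-1.
Proof. by rewrite /qq mulrN CrN !mulNr cexpN. Qed.
Lemma qqB s t z : qq (s - t) z = qq s z / qq t z.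
Proof. by rewrite qqD qqN. Qed.
Lemma qexp_qq z : qexp z = qq 1 z.
Proof. by rewrite /qexp /qq mulr1. Qed.
Lemma qqDz s z w : qq s (z + w) = qq s z * qq s w.
Proof. by rewrite /qq mulrDr cexpD. Qed.
Lemma qq_real s x : qq s (Cr x) = ee (s * x).
Proof.
rewrite /qq (_ : Cr (2 * pi * s) * iC R * Cr x = Complex 0 (2 * pi * (s * x))).
  by rewrite /cexp /= expR0 !mul1r.
by apply/eqP; rewrite eq_complex /= !mul0r !mulr0 !mulr1 !subr0 !addr0 mul0r add0r !mulrA !eqxx.
Qed.
Lemma qq_shift s z : qq s (z + 1) = ee s * qq s z.
Proof. by rewrite qqDz -[1]/(Cr 1) qq_real mulr1 mulrC. Qed.
Lemma eeD (a b : R) : ee (a + b) = ee a * ee b.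
Proof. by rewrite -[a + b]mulr1 -qq_real qqD !qq_real !mulr1. Qed.
Lemma ee0 : ee (0 : R) = 1.
Proof. by rewrite -[0]mulr1 -qq_real qq0. Qed.
Lemma ee1 : ee (1 : R) = 1.
Proof. by apply/eqP; rewrite eq_complex /ee /= mulr1 mulr_natl cos2pi sin2pi !eqxx. Qed.
Lemma ee_nat n : ee (n%:R : R) = 1.
Proof. by elim: n => [|n IH]; rewrite ?ee0 // -addn1 natrD eeD IH ee1 mul1r. Qed.
Lemma eeN (a : R) : ee (- a) = (ee a)^-1.
Proof. by rewrite -[- a]mulr1 -[a in RHS]mulr1 -!qq_real qqN. Qed.
Lemma ee_int (n : int) : ee (n%:~R : R) = 1.
Proof. by case: n => n; rewrite ?NegzE ?mulrNz ?eeN -!pmulrn ee_nat ?invr1. Qed.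
Lemma ee_neq0 (a : R) : ee a != 0.
Proof. by rewrite -[a]mulr1 -qq_real qq_neq0. Qed.
Lemma cabs_ee (a : R) : cabs (ee a) = 1.
Proof. by rewrite -[a]mulr1 -qq_real cabs_qq /= mulr0 oppr0 expR0. Qed.

Definition twopii : C R := Cr (2 * pi) * iC R.
Lemma twopii_neq0 : twopii != 0.
Proof. by rewrite mulf_neq0 ?iC_neq0 // Cr_eq0 gt_eqF // mulr_gt0 // pi_gt0. Qed.
Lemma cabs_twopii : cabs twopii = 2 * pi.
Proof. by rewrite cabsM cabs_iC mulr1 cabs_Cr gtr0_norm // mulr_gt0 // pi_gt0. Qed.

Lemma cdv_qq s z : cdv (qq s) z (Cr s * twopii * qq s z).
Proof.
apply: cdv_eq (cdv_comp (cdv_cstM _ (cdv_id z)) (cdv_cexp _)) _.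
by rewrite mulr1 /qq /twopii; set E := cexp _; rewrite CrM; ring.
Qed.

(** The dependence on [s] is explicit because series in [q] are later differentiated termwise, with
    [s = n]. *)
Lemma qq_taylor_bound s z h :
  cabs (qq s (z + h) - qq s z - Cr s * twopii * qq s z * h) <=
  4 * ((2 * pi * `|s| * cabs h) ^+ 2 *
       expR (- (2 * pi * s * Im z) + 2 * pi * `|s| * cabs h)).
Proof.
rewrite qqDz; set w := Cr s * twopii * h.
have cw : cabs w = 2 * pi * `|s| * cabs h.
  by rewrite /w 2!cabsM cabs_Cr cabs_twopii [`|s| * _]mulrC.
have -> : qq s h = cexp w.
  by rewrite /qq /w /twopii CrM; congr cexp; ring.
rewrite (_ : _ - _ - _ = qq s z * (cexp w - 1 - w)); last by rewrite /w; ring.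
rewrite cabsM -cw expRD cabs_qq.
apply: le_trans (ler_wpM2l (expR_ge0 _) (cexp_taylor_bound w)) _.
by rewrite mulrCA ler_pM2l // mulrCA.
Qed.

End Exponential.

(** * Goursat's lemma *)

Section Primitives.
Variable R : realType.
Implicit Types (f g : R -> C R) (a b t : R).

Definition rcont f t := forall e : R, 0 < e -> exists2 d : R, 0 < d &
  forall h : R, `|h| < d -> cabs (f (t + h) - f t) < e.

Lemma ccont_path (f : C R -> C R) (z w : C R) t :
  ccont f (z + Cr t * w) -> rcont (fun s => f (z + Cr s * w)) t.
Proof.
move=> fc e e0; have [d d0 H] := fc _ e0.
have k0 : 0 < 1 + cabs w by rewrite ltr_pwDl // cabs_ge0.
exists (d / (1 + cabs w)); first by rewrite divr_gt0.
move=> h; rewrite ltr_pdivlMr // => hd.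
have hw : cabs (Cr h * w) < d.
  by apply: le_lt_trans hd; rewrite cabsM cabs_Cr ler_wpM2l // lerDr.
by have := H _ hw; rewrite CrD mulrDl addrA.
Qed.

Lemma real_continuous_at (f : R -> R) (t : R) :
  (forall e : R, 0 < e -> exists2 d : R, 0 < d &
     forall h : R, `|h| < d -> `|f (t + h) - f t| < e) -> {for t, continuous f}.
Proof.
move=> H; apply/cvgrPdist_lt => /= e /H [d d0 Hd].
near=> s.
have hs : `|s - t| < d.
  rewrite distrC; near: s; exact: cvgr_dist_lt.
by have := Hd _ hs; rewrite [t + _]addrC subrK distrC.
Unshelve. all: by end_near. Qed.

Lemma rcont_Re f t : rcont f t -> {for t, continuous (fun s => Re (f s))}.
Proof.
move=> H; apply: real_continuous_at => e /H [d d0 Hd]; exists d => // h /Hd.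
by apply: le_lt_trans; rewrite -ReN -ReD cabs_Re.
Qed.

Lemma rcont_Im f t : rcont f t -> {for t, continuous (fun s => Im (f s))}.
Proof.
move=> H; apply: real_continuous_at => e /H [d d0 Hd]; exists d => // h /Hd.
by apply: le_lt_trans; rewrite -ImN -ImD cabs_Im.
Qed.

Lemma rcont_cabs f t : rcont f t -> {for t, continuous (fun s => cabs (f s))}.
Proof.
move=> H; apply: real_continuous_at => e /H [d d0 Hd]; exists d => // h /Hd.
apply: le_lt_trans; rewrite ler_norml cabs_sub andbT lerNl opprB.
by rewrite [X in _ <= X]cabsC cabs_sub.
Qed.

(** The fundamental theorem of calculus for the Lebesgue integral. It gives the derivative in the
    interior only, which is why paths of integration are always placed inside a larger interval. *)
Lemma real_primitive_exists (f : R -> R) a b :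
  (forall t, a <= t <= b -> {for t, continuous f}) ->
  exists F : R -> R, forall t, a < t < b -> is_derive t 1 F (f t).
Proof.
move=> fc; have [ba|ab] := leP b a.
  by exists (fun => 0) => t /andP[at' tb]; have := lt_trans at' tb; rewrite ltNge ba.
have fi : (@lebesgue_measure R).-integrable `[a, b]%classic (EFin \o f).
  apply: continuous_compact_integrable; first exact: segment_compact.
  apply: continuous_in_subspaceT => x; rewrite inE /= in_itv /= => H; exact: fc.
exists (fun x => \int[@lebesgue_measure R]_(t in [set` `[a, x]]) f t).
move=> t /andP[at' tb].
have [|H1 H2] := @continuous_FTC1_closed R f a t b tb fi at'.
  by apply: fc; rewrite !ltW.
exact: (DeriveDef H1 (etrans (esym (derive1E _ _)) H2)).
Qed.

Lemma primitive_exists a b f : (forall t, a <= t <= b -> rcont f t) ->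
  exists F : R -> C R, forall t, a < t < b -> rdv F t (f t).
Proof.
move=> fc.
have [F1 H1] := @real_primitive_exists _ a b (fun t at' => rcont_Re (fc t at')).
have [F2 H2] := @real_primitive_exists _ a b (fun t at' => rcont_Im (fc t at')).
by exists (fun t => Complex (F1 t) (F2 t)) => t at'; split; [exact: H1|exact: H2].
Qed.

(** A chosen antiderivative stands for the integral: only its increments are used, and additivity
    over adjacent intervals becomes telescoping. *)
Definition prim a b f : R -> C R :=
  xget (fun => 0) [set F : R -> C R | forall t, a < t < b -> rdv F t (f t)]%classic.

Lemma primP a b f : (forall t, a <= t <= b -> rcont f t) ->
  forall t, a < t < b -> rdv (prim a b f) t (f t).
Proof. by move=> /primitive_exists H; rewrite /prim; exact: (xgetPex (fun => 0) H). Qed.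

Lemma line_bounded f a b : (forall t, a <= t <= b -> rcont f t) ->
  exists2 M : R, 0 <= M & forall t, a <= t <= b -> cabs (f t) <= M.
Proof.
move=> fc; have [ba|ab] := ltP b a.
  by exists 0 => // t /andP[at' tb]; have := le_trans at' tb; rewrite leNgt ba.
have [|c _ cM] := @EVT_max R (fun t => cabs (f t)) a b ab.
  apply: continuous_in_subspaceT => x; rewrite inE /= in_itv /= => H.
  exact: rcont_cabs (fc _ H).
by exists (cabs (f c)); rewrite ?cabs_ge0 // => t at'; apply: cM; rewrite in_itv.
Qed.

End Primitives.

Lemma four_parts (R : realDomainType) (q q1 q2 q3 q4 : R) : q <= q1 + q2 + q3 + q4 ->
  4 * q1 < q -> 4 * q2 < q -> 4 * q3 < q -> q <= 4 * q4.
Proof. by lra. Qed.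

Lemma dist_in_itv (R : realDomainType) (a w x y : R) : a <= x -> x <= a + w ->
  a <= y -> y <= a + w -> `|x - y| <= w.
Proof. by move=> ? ? ? ?; rewrite ler_norml; apply/andP; split; lra. Qed.

Section Goursat.
Variable R : realType.
Variables (f : C R -> C R) (A B c0 d0 : R).

(** The factor [iC R] in [vert] is [dz = i dy]. As the sides of a rectangle are increments of
    antiderivatives fixed on the large rectangle, subdividing [rect_int] is a ring identity. *)
Definition horiz y := prim A B (fun s => f (Complex s y)).
Definition vert x := prim c0 d0 (fun s => iC R * f (Complex x s)).

Definition rect_int a b c d : C R :=
  (horiz c b - horiz c a) + (vert b d - vert b c)
  - (horiz d b - horiz d a) - (vert a d - vert a c).

Lemma rect_int_splitx m a b c d :
  rect_int a b c d = rect_int a m c d + rect_int m b c d.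
Proof. by rewrite /rect_int; ring. Qed.

Lemma rect_int_splity m a b c d :
  rect_int a b c d = rect_int a b c m + rect_int a b m d.
Proof. by rewrite /rect_int; ring. Qed.

Hypothesis fcont : forall x y, A <= x <= B -> c0 <= y <= d0 -> ccont f (Complex x y).

Lemma Complex_h (x y : R) : Complex x y = Complex 0 y + Cr x * 1.
Proof. by apply/eqP; rewrite eq_complex /= !mulr0 mul0r mulr1 !addr0 subr0 add0r !eqxx. Qed.
Lemma Complex_v (x y : R) : Complex x y = Cr x + Cr y * iC R.
Proof. by apply/eqP; rewrite eq_complex /= !mulr0 mul0r mulr1 !addr0 subr0 add0r addr0 !eqxx. Qed.

Lemma rcont_h x y : ccont f (Complex x y) -> rcont (fun s => f (Complex s y)) x.
Proof.
move=> fc; rewrite (_ : (fun s => _) = (fun s => f (Complex 0 y + Cr s * 1))).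
  by apply: ccont_path; rewrite -Complex_h.
by apply/funext => s; rewrite -Complex_h.
Qed.

Lemma rcont_v x y : ccont f (Complex x y) -> rcont (fun s => iC R * f (Complex x s)) y.
Proof.
move=> fc.
have H : rcont (fun s => f (Complex x s)) y.
  rewrite (_ : (fun s => _) = (fun s => f (Cr x + Cr s * iC R))).
    by apply: ccont_path; rewrite -Complex_v.
  by apply/funext => s; rewrite -Complex_v.
move=> e /H [d dd Hd]; exists d => // h /Hd.
by rewrite -mulrBr cabsM cabs_iC mul1r.
Qed.

Lemma horizP x y : A < x < B -> c0 <= y <= d0 -> rdv (horiz y) x (f (Complex x y)).
Proof. by move=> xAB yc; apply: primP xAB => t tAB; apply/rcont_h/fcont. Qed.

Lemma vertP x y : A <= x <= B -> c0 < y < d0 -> rdv (vert x) y (iC R * f (Complex x y)).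
Proof. by move=> xAB yc; apply: primP yc => t tAB; apply/rcont_v/fcont. Qed.

Lemma horiz_bound F a b y (p : C R -> C R) M :
  A < a -> a <= b -> b < B -> c0 <= y <= d0 ->
  (forall z, cdv F z (p z)) ->
  (forall x, a <= x <= b -> cabs (f (Complex x y) - p (Complex x y)) <= M) ->
  cabs ((horiz y b - horiz y a) - (F (Complex b y) - F (Complex a y))) <= 2 * M * (b - a).
Proof.
move=> Aa ab bB yc Fp H.
have := @mean_value_bound R (fun s => horiz y s - F (Complex s y))
  (fun s => f (Complex s y) - p (Complex s y)) a b M ab _ H.
rewrite (_ : _ - _ - (_ - _) = (horiz y b - horiz y a) - (F (Complex b y) - F (Complex a y))); last by ring.
apply => t /andP[t1 t2]; apply: rdvB.
  by apply: horizP => //; rewrite (lt_le_trans Aa) // (le_lt_trans t2).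
rewrite (_ : (fun s => _) = (fun s => F (Complex 0 y + Cr s * 1))).
  have := @cdv_path R F (Complex 0 y) 1 (p (Complex t y)) t.
  by rewrite -Complex_h mulr1; apply.
by apply/funext => s; rewrite -Complex_h.
Qed.

Lemma vert_bound F c d x (p : C R -> C R) M :
  c0 < c -> c <= d -> d < d0 -> A <= x <= B ->
  (forall z, cdv F z (p z)) ->
  (forall y, c <= y <= d -> cabs (f (Complex x y) - p (Complex x y)) <= M) ->
  cabs ((vert x d - vert x c) - (F (Complex x d) - F (Complex x c))) <= 2 * M * (d - c).
Proof.
move=> Aa ab bB xc Fp H.
have := @mean_value_bound R (fun s => vert x s - F (Complex x s))
  (fun s => iC R * f (Complex x s) - p (Complex x s) * iC R) c d M ab.
rewrite (_ : _ - _ - (_ - _) = (vert x d - vert x c) - (F (Complex x d) - F (Complex x c))); last by ring.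
apply.
  move=> t /andP[t1 t2]; apply: rdvB.
    by apply: vertP => //; rewrite (lt_le_trans Aa) // (le_lt_trans t2).
  rewrite (_ : (fun s => _) = (fun s => F (Cr x + Cr s * iC R))).
    have := @cdv_path R F (Cr x) (iC R) (p (Complex x t)) t.
    by rewrite -Complex_v; apply.
  by apply/funext => s; rewrite -Complex_v.
by move=> t tc; rewrite mulrC -mulrBl cabsM cabs_iC mulr1 H.
Qed.

(* An affine function has a primitive, so only its distance to [f] contributes. *)
Lemma rect_int_bound a b c d (z0 p l : C R) M :
  A < a -> a <= b -> b < B -> c0 < c -> c <= d -> d < d0 ->
  (forall x y, a <= x <= b -> c <= y <= d ->
     cabs (f (Complex x y) - (p + l * (Complex x y - z0))) <= M) ->
  cabs (rect_int a b c d) <= 4 * M * ((b - a) + (d - c)).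
Proof.
move=> Aa ab bB cc cd dd H.
pose P z := p + l * (z - z0).
pose F z := p * z + l / 2 * (z - z0) ^+ 2.
have FP z : cdv F z (P z).
  have H1 := cdvB (cdv_id z) (cdv_cst z0 z).
  have H2 := cdvX 2 H1.
  apply: cdv_eq (cdvD (cdv_cstM p (cdv_id z)) (cdv_cstM (l / 2) H2)) _.
  by rewrite /P /= expr1; field.
have cB : c < d0 by apply: le_lt_trans dd.
have dB : c0 < d by apply: lt_le_trans cd.
have aB : a < B by apply: le_lt_trans bB.
have bA : A < b by apply: lt_le_trans ab.
have aa : a <= a <= b by rewrite lexx.
have bb : a <= b <= b by rewrite lexx andbT.
have cdc : c <= c <= d by rewrite lexx.
have cdd : c <= d <= d by rewrite lexx andbT.
have E1 := @horiz_bound F a b c P M Aa ab bB _ FP (fun x xa => H x c xa cdc).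
have E2 := @horiz_bound F a b d P M Aa ab bB _ FP (fun x xa => H x d xa cdd).
have E3 := @vert_bound F c d a P M cc cd dd _ FP (fun y yc => H a y aa yc).
have E4 := @vert_bound F c d b P M cc cd dd _ FP (fun y yc => H b y bb yc).
have {}E1 := E1 (introT andP (conj (ltW cc) (ltW cB))).
have {}E2 := E2 (introT andP (conj (ltW dB) (ltW dd))).
have {}E3 := E3 (introT andP (conj (ltW Aa) (ltW aB))).
have {}E4 := E4 (introT andP (conj (ltW bA) (ltW bB))).
rewrite (_ : rect_int a b c d =
  ((horiz c b - horiz c a) - (F (Complex b c) - F (Complex a c)))
  + ((vert b d - vert b c) - (F (Complex b d) - F (Complex b c)))
  - ((horiz d b - horiz d a) - (F (Complex b d) - F (Complex a d)))
  - ((vert a d - vert a c) - (F (Complex a d) - F (Complex a c)))); last first.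
  by rewrite /rect_int; ring.
apply: le_trans (cabsB _ _) _; rewrite (_ : 4 * M * (b - a + (d - c)) =
  2 * M * (b - a) + 2 * M * (d - c) + 2 * M * (b - a) + 2 * M * (d - c)); last by ring.
apply: lerD => //; apply: le_trans (cabsB _ _) _; apply: lerD => //.
by apply: le_trans (cabsD _ _) _; apply: lerD.
Qed.

Lemma pow2_large (x d : R) : 0 < d -> exists n, x / 2 ^+ n < d.
Proof.
move=> dd; have := archi_boundP (normr_ge0 (x / d)).
set n := Num.bound _ => xn; exists n.
rewrite ltr_pdivrMr ?exprn_gt0 // mulrC -ltr_pdivrMr //.
apply: le_lt_trans (ler_norm _) _; apply: lt_trans xn _.
by rewrite -natrX ltr_nat ltn_expl.
Qed.

Section Bisection.
Variables (a b c d : R).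
Hypotheses (Aa : A < a) (ab : a <= b) (bB : b < B) (cc : c0 < c) (cd : c <= d) (dd : d < d0).

Let w n := (b - a) / 2 ^+ n.
Let h n := (d - c) / 2 ^+ n.
Let Q n (p : R * R) := cabs (rect_int p.1 (p.1 + w n) p.2 (p.2 + h n)).

Let half_w n : w n = w n.+1 + w n.+1.
Proof. by rewrite /w exprS invfM; field; rewrite expf_neq0. Qed.
Let half_h n : h n = h n.+1 + h n.+1.
Proof. by rewrite /h exprS invfM; field; rewrite expf_neq0. Qed.
Let w_ge0 n : 0 <= w n. Proof. by rewrite divr_ge0 ?subr_ge0 // exprn_ge0. Qed.
Let h_ge0 n : 0 <= h n. Proof. by rewrite divr_ge0 ?subr_ge0 // exprn_ge0. Qed.

(** Pigeonhole: if three quarters each carry less than a fourth of the modulus, the last one carries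
    at least a fourth. *)
Lemma bisect_step n (p : R * R) : exists p' : R * R,
  [/\ p.1 <= p'.1, p'.1 + w n.+1 <= p.1 + w n, p.2 <= p'.2, p'.2 + h n.+1 <= p.2 + h n &
   Q n p <= 4 * Q n.+1 p'].
Proof.
have w1 := w_ge0 n.+1; have h1 := h_ge0 n.+1.
pose p1 := (p.1, p.2); pose p2 := (p.1 + w n.+1, p.2).
pose p3 := (p.1, p.2 + h n.+1); pose p4 := (p.1 + w n.+1, p.2 + h n.+1).
have QE : Q n p <= Q n.+1 p1 + Q n.+1 p2 + Q n.+1 p3 + Q n.+1 p4.
  rewrite /Q /= half_w half_h !addrA.
  rewrite (rect_int_splitx (p.1 + w n.+1)) (rect_int_splity (p.2 + h n.+1)).
  rewrite (rect_int_splity (p.2 + h n.+1) (p.1 + w n.+1)).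
  set q1 := rect_int _ _ _ _; set q2 := rect_int _ _ _ _.
  set q3 := rect_int _ _ _ _; set q4 := rect_int _ _ _ _.
  rewrite (_ : q1 + q2 + (q3 + q4) = q1 + q3 + q2 + q4); last by ring.
  by do 3! [apply: le_trans (cabsD _ _) _; rewrite lerD2r].
have [H1|H1] := leP (Q n p) (4 * Q n.+1 p1).
  by exists p1; split=> //=; rewrite ?(half_w n) ?(half_h n) -?addrA ?lerD2l ?lerDl.
have [H2|H2] := leP (Q n p) (4 * Q n.+1 p2).
  by exists p2; split=> //=; rewrite ?(half_w n) ?(half_h n) -?addrA ?lerD2l ?lerDl.
have [H3|H3] := leP (Q n p) (4 * Q n.+1 p3).
  by exists p3; split=> //=; rewrite ?(half_w n) ?(half_h n) -?addrA ?lerD2l ?lerDl.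
exists p4; split=> //=; rewrite ?(half_w n) ?(half_h n) -?addrA ?lerD2l ?lerDl //.
exact: four_parts QE H1 H2 H3.
Qed.

Hypothesis fdiff : forall x y, a <= x <= b -> c <= y <= d -> exists l, cdv f (Complex x y) l.

Lemma nested_point (s t : nat -> R) : (forall n, s n <= s n.+1) -> (forall n, t n.+1 <= t n) ->
  (forall n, s n <= t n) -> exists x, forall n, s n <= x <= t n.
Proof.
move=> sn tn st.
have s_mono n k : s n <= s (n + k)%N.
  by elim: k => [|k IH]; rewrite ?addn0 // addnS (le_trans IH).
have t_mono n k : t (n + k)%N <= t n.
  by elim: k => [|k IH]; rewrite ?addn0 // addnS (le_trans _ IH).
have sup_t n : ubound (range s) (t n).
  move=> _ [m _ <-]; apply: le_trans (s_mono m n) _; apply: le_trans (st _) _.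
  by rewrite addnC.
exists (sup (range s)) => n; apply/andP; split.
  apply: ub_le_sup; last by exists n.
  by exists (t 0%N); exact: sup_t.
by apply: ge_sup; [exists (s 0%N), 0%N|exact: sup_t].
Qed.

(** After [n] bisections the affine approximation at the limit point bounds the integral by a
    multiple of [e * (S / 2 ^ n) ^ 2], which absorbs the factor [4 ^ n] lost by the pigeonhole
    steps. *)
Lemma goursat : rect_int a b c d = 0.
Proof.
pose next n p := projT1 (cid (bisect_step n p)).
pose st := fix st n := if n is m.+1 then next m (st m) else (a, c).
have stP n := projT2 (cid (bisect_step n (st n))).
have QQ n : cabs (rect_int a b c d) <= 4 ^+ n * Q n (st n).
  elim: n => [|n IH].
    by rewrite expr0 mul1r /Q /w /h /= expr0 !divr1 ![_ + (_ - _)]addrC !subrK.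
  apply: le_trans IH _; rewrite exprSr -mulrA ler_wpM2l ?exprn_ge0 //.
  by case: (stP n).
have [x xP] : exists x, forall n, (st n).1 <= x <= (st n).1 + w n.
  apply: nested_point => n; [by case: (stP n)|by case: (stP n)|by rewrite lerDl].
have [y yP] : exists y, forall n, (st n).2 <= y <= (st n).2 + h n.
  apply: nested_point => n; [by case: (stP n)|by case: (stP n)|by rewrite lerDl].
have bnd n : [/\ a <= (st n).1, (st n).1 + w n <= b, c <= (st n).2 & (st n).2 + h n <= d].
  elim: n => [|n [I1 I2 I3 I4]].
    by rewrite /w /h /= expr0 !divr1 ![_ + (_ - _)]addrC !subrK.
  case: (stP n) => J1 J2 J3 J4 _; split.
  - exact: le_trans J1.
  - exact: le_trans I2.
  - exact: le_trans J3.
  - exact: le_trans I4.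
have xab : a <= x <= b.
  by have [I1 I2 _ _] := bnd 0%N; have /andP[? ?] := xP 0%N; rewrite (le_trans I1) //= (le_trans _ I2).
have ycd : c <= y <= d.
  by have [_ _ I1 I2] := bnd 0%N; have /andP[? ?] := yP 0%N; rewrite (le_trans I1) //= (le_trans _ I2).
have [l fl] := fdiff xab ycd.
pose S := (b - a) + (d - c).
have S0 : 0 <= S by rewrite addr_ge0 ?subr_ge0.
apply/eqP; rewrite -cabs_eq0 eq_le cabs_ge0 andbT.
apply/ler_addgt0Pl => e e0; rewrite addr0.
have k0 : 0 < 1 + S ^+ 2 by rewrite ltr_pwDl // exprn_ge0.
(* The 4 comes from [rect_int_bound]; [1 + S ^+ 2] replaces [S ^+ 2] so that a degenerate rectangle
   causes no division by zero. *)
have e1 : 0 < e / 4 / (1 + S ^+ 2) by rewrite !divr_gt0.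
have [r r0 fr] := fl _ e1.
have [n nr] := pow2_large S r0.
have Sn : S / 2 ^+ n = w n + h n by rewrite /S mulrDl.
have [I1 I2 I3 I4] := bnd n.
have := @rect_int_bound (st n).1 ((st n).1 + w n) (st n).2 ((st n).2 + h n)
  (Complex x y) (f (Complex x y)) l (e / 4 / (1 + S ^+ 2) * (w n + h n)).
have wn := w_ge0 n; have hn := h_ge0 n.
have C1 : A < (st n).1 by exact: lt_le_trans Aa I1.
have C2 : (st n).1 + w n < B by exact: le_lt_trans I2 bB.
have C3 : c0 < (st n).2 by exact: lt_le_trans cc I3.
have C4 : (st n).2 + h n < d0 by exact: le_lt_trans I4 dd.
have C5 : (st n).1 <= (st n).1 + w n by rewrite lerDl.
have C6 : (st n).2 <= (st n).2 + h n by rewrite lerDl.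
move=> /(_ C1 C5 C2 C3 C6 C4) H.
have {}H := H _.
have {}H : Q n (st n) <= 4 * (e / 4 / (1 + S ^+ 2) * (w n + h n)) *
    ((st n).1 + w n - (st n).1 + ((st n).2 + h n - (st n).2)).
  apply: H => s t /andP[s1 s2] /andP[t1 t2].
  have /andP[x1 x2] := xP n; have /andP[y1 y2] := yP n.
  have sx : cabs (Complex s t - Complex x y) <= w n + h n.
    apply: le_trans (cabs_le _) _ => /=.
    by apply: lerD; [exact: (@dist_in_itv _ (st n).1)|exact: (@dist_in_itv _ (st n).2)].
  have := fr (Complex s t - Complex x y).
  rewrite [_ + (_ - _)]addrC subrK opprD addrA => H.
  apply: le_trans (H _) _; first by rewrite (le_lt_trans sx) // -Sn.
  by rewrite ler_wpM2l // ltW.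
apply: le_trans (QQ n) _; apply: le_trans (ler_wpM2l _ H) _; first by rewrite exprn_ge0.
rewrite [X in X <= _](_ : _ = e * (S ^+ 2 / (1 + S ^+ 2))).
  by rewrite ler_piMr ?(ltW e0) // ler_pdivrMr // mul1r lerDr.
rewrite ![(st n).1 + _ - _]addrC ![(st n).2 + _ - _]addrC !addKr -Sn.
have -> : 4 ^+ n = 2 ^+ n * 2 ^+ n :> R by rewrite -exprMn -natrM.
by field; rewrite (gt_eqF k0) expf_neq0.
Qed.

End Bisection.

End Goursat.

Section RdvRules.
Variable R : realType.
Implicit Types (f g : R -> C R) (t : R) (l m c : C R).

Lemma rdvD f g t l m : rdv f t l -> rdv g t m -> rdv (fun s => f s + g s) t (l + m).
Proof.
move=> [f1 f2] [g1 g2]; rewrite /rdv !(ReD, ImD); split.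
  rewrite (_ : (fun s => _) = (fun s => Re (f s)) + (fun s => Re (g s))).
    exact: is_deriveD.
  by apply/funext => s; rewrite ReD.
rewrite (_ : (fun s => _) = (fun s => Im (f s)) + (fun s => Im (g s))).
  exact: is_deriveD.
by apply/funext => s; rewrite ImD.
Qed.

Lemma rdv_scale f t l c : rdv f t l -> rdv (fun s => c * f s) t (c * l).
Proof.
move=> [f1 f2]; rewrite /rdv ReM ImM; split.
  rewrite (_ : (fun s => _) = Re c *: (fun s => Re (f s))
                       - Im c *: (fun s => Im (f s))).
    by apply: is_deriveB; apply: is_deriveZ.
  by apply/funext => s; rewrite ReM.
rewrite (_ : (fun s => _) = Re c *: (fun s => Im (f s))
                       + Im c *: (fun s => Re (f s))).
  by apply: is_deriveD; apply: is_deriveZ.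
by apply/funext => s; rewrite ImM.
Qed.

Lemma rdv_shift f t k l : rdv f (t + k) l -> rdv (fun s => f (s + k)) t l.
Proof.
have sh : is_derive t 1 (fun s : R => s + k) 1.
  by apply: is_derive_eq; rewrite addr0.
case=> f1 f2; split.
  have := @is_derive1_comp R (fun s => Re (f s)) (fun s : R => s + k) t _ _ f1 sh.
  by rewrite mulr1.
have := @is_derive1_comp R (fun s => Im (f s)) (fun s : R => s + k) t _ _ f2 sh.
by rewrite mulr1.
Qed.

Lemma rdv_increment_unique f g (df : R -> C R) a b : a <= b ->
  (forall t, a <= t <= b -> rdv f t (df t)) ->
  (forall t, a <= t <= b -> rdv g t (df t)) -> f b - f a = g b - g a.
Proof.
move=> ab fd gd; apply/eqP; rewrite -subr_eq0 -cabs_eq0 eq_le cabs_ge0 andbT.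
have := @mean_value_bound R (fun s => f s - g s) (fun s => 0) a b 0 ab.
rewrite mulr0 mul0r (_ : f b - g b - (f a - g a) = f b - f a - (g b - g a)); last by ring.
apply; last by move=> t _; rewrite cabs0.
by move=> t tab; apply: rdv_eq (rdvB (fd t tab) (gd t tab)) _; rewrite subrr.
Qed.

End RdvRules.

(** * Integrals over one period and their independence of the height *)

Section FourierIntegral.
Variable R : realType.
Implicit Types (f g F G : C R -> C R) (z : C R).

Definition holH f := forall z, 0 < Im z -> exists l, cdv f z l.
Definition contH f := forall z, 0 < Im z -> ccont f z.
Definition per1 f := forall z, 0 < Im z -> f (z + 1) = f z.

Lemma holH_cont f : holH f -> contH f.
Proof. by move=> fh z /fh [l]; exact: cdv_cont. Qed.

(* The margins [-2] and [3] leave room to slide the period interval by one unit. *)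
Definition fint F y : C R := horiz F (-2) 3 y 1 - horiz F (-2) 3 y 0.

Lemma horiz_rdv F x y : contH F -> 0 < y -> -2 < x < 3 ->
  rdv (horiz F (-2) 3 y) x (F (Complex x y)).
Proof.
move=> Fc y0 x23; apply: (@horizP R F (-2) 3 y y) => //; last by rewrite lexx.
by move=> s t _; rewrite -eq_le => /eqP <-; exact: Fc.
Qed.

Let in01 (t : R) : 0 <= t <= 1 -> -2 < t < 3.
Proof. by lra. Qed.

Lemma fint_prim F P y : contH F -> 0 < y ->
  (forall t, 0 <= t <= 1 -> rdv P t (F (Complex t y))) -> fint F y = P 1 - P 0.
Proof.
move=> Fc y0 PF; apply: rdv_increment_unique ler01 _ PF => t /in01 t01.
exact: horiz_rdv.
Qed.

Lemma fint_bound F y M : contH F -> 0 < y ->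
  (forall t, 0 <= t <= 1 -> cabs (F (Complex t y)) <= M) -> cabs (fint F y) <= 2 * M.
Proof.
move=> Fc y0 FM.
have := @mean_value_bound R (horiz F (-2) 3 y) (fun t => F (Complex t y)) 0 1 M ler01.
rewrite subr0 mulr1; apply=> // t /in01 t01; exact: horiz_rdv.
Qed.

Lemma fint_lin3 F G1 G2 G3 (a1 a2 a3 : C R) y : contH F -> contH G1 -> contH G2 -> contH G3 ->
  0 < y ->
  (forall t, F (Complex t y) =
     a1 * G1 (Complex t y) + a2 * G2 (Complex t y) + a3 * G3 (Complex t y)) ->
  fint F y = a1 * fint G1 y + a2 * fint G2 y + a3 * fint G3 y.
Proof.
move=> Fc c1 c2 c3 y0 FE.
rewrite (@fint_prim F (fun t => a1 * horiz G1 (-2) 3 y t + a2 * horiz G2 (-2) 3 y t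
  + a3 * horiz G3 (-2) 3 y t)) //.
  by rewrite /fint; ring.
move=> t /in01 t01; rewrite FE.
by apply: rdvD; [apply: rdvD|]; apply: rdv_scale; exact: horiz_rdv.
Qed.

Lemma shift1 (t y : R) : Complex (t + 1) y = Complex t y + 1.
Proof. by apply/eqP; rewrite eq_complex /= addr0 !eqxx. Qed.

(** By periodicity [h (t + 1)] and [h t] have the same derivative, so their difference does not
    depend on [t]. *)
Lemma fint_shift F y a : contH F -> per1 F -> 0 < y -> -1 <= a <= 1 ->
  horiz F (-2) 3 y (a + 1) - horiz F (-2) 3 y a = fint F y.
Proof.
move=> Fc Fp y0 a11.
pose h := horiz F (-2) 3 y.
have hd t : -1 <= t <= 1 -> rdv h t (F (Complex t y)).
  by move=> t11; apply: horiz_rdv => //; move: t11; clear; lra.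
have hd1 t : -1 <= t <= 1 -> rdv (fun s => h (s + 1)) t (F (Complex t y)).
  move=> t11; apply: rdv_shift; rewrite -Fp // -shift1; apply: horiz_rdv => //.
  by move: t11; clear; lra.
have key s t : -1 <= s -> s <= t -> t <= 1 -> h (t + 1) - h t = h (s + 1) - h s.
  move=> s1 st t1.
  have H u : s <= u <= t -> -1 <= u <= 1 by move: s1 st t1; clear; lra.
  have := @rdv_increment_unique R (fun s => h (s + 1)) h (fun t => F (Complex t y)) s t st
    (fun u ust => hd1 u (H u ust)) (fun u ust => hd u (H u ust)).
  by move/eqP; rewrite -subr_eq0 => /eqP E; apply/eqP; rewrite -subr_eq0 -E; apply/eqP; ring.
rewrite /fint -/h -[1 in RHS]add0r.
case/andP: a11 => a1 a2; have [a0|/ltW a0] := leP a 0.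
  by rewrite (key a 0) // ler01.
by rewrite (key 0 a) // lerN10.
Qed.

(** One exceptional point is allowed because Chernoff's quotient is only known to be continuous at
    its removable singularity. The period strip is centred at [x0], so its vertical sides stay away
    from that point and cancel by periodicity. A small square around the point contributes little,
    by boundedness alone. *)
Lemma strip F (x0 y0 y1 y2 : R) : contH F -> per1 F -> 0 <= x0 < 1 -> 0 < y1 ->
  y1 < y0 < y2 ->
  (forall x y, x0 - 2^-1 <= x <= x0 + 2^-1 -> 0 < y -> (x, y) <> (x0, y0) ->
     exists l, cdv F (Complex x y) l) -> fint F y1 = fint F y2.
Proof.
move=> Fc Fp /andP[x00 x01] y10 /andP[y01 y02] Fd.
pose a := x0 - 2^-1.
have a1E : a + 1 = x0 + 2^-1 by rewrite /a; field.
have c00 : 0 < y1 / 2 by rewrite divr_gt0.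
have fc x y : -2 <= x <= 3 -> y1 / 2 <= y <= y2 + 1 -> ccont F (Complex x y).
  by move=> _ /andP[y1y _]; apply: Fc; exact: lt_le_trans y1y.
have half0 : 0 < 2^-1 :> R by rewrite invr_gt0.
have half1 : 2^-1 < 1 :> R by rewrite invf_lt1 // ltr1n.
have y12 : y1 < y2 by apply: lt_trans y02.
have b1 : -2 < a by rewrite /a; move: half1 x00; clear; lra.
have b2 : a + 1 < 3 by rewrite a1E; move: half1 x01; clear; lra.
have b3 : y1 / 2 < y1 by rewrite ltr_pdivrMr // ltr_pMr // ltr1n.
have b4 : y2 < y2 + 1 by rewrite ltrDl.
pose Q := rect_int F (-2) 3 (y1 / 2) (y2 + 1).
have QE : Q a (a + 1) y1 y2 = fint F y1 - fint F y2.
  have a11 : -1 <= a <= 1 by move: half1 half0 x00 x01; rewrite /a; clear; lra.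
  rewrite /Q /rect_int !fint_shift // ?(lt_trans y10 y12) //.
  set h := vert F (y1 / 2) (y2 + 1).
  suff E : h (a + 1) y2 - h (a + 1) y1 = h a y2 - h a y1.
    by rewrite E; ring.
  have yy y : y1 <= y <= y2 -> y1 / 2 < y < y2 + 1.
    by move=> /andP[u1 u2]; rewrite (lt_le_trans b3) // (le_lt_trans u2).
  apply: (@rdv_increment_unique R _ _ (fun y => iC R * F (Complex a y))); first exact: ltW.
    move=> y yy'; have y0' : 0 < y by case/andP: yy' => + _; exact: lt_le_trans.
    rewrite -[F (Complex a y)]Fp // -shift1; apply: (@vertP R F (-2) 3); [exact: fc| |exact: yy].
    by rewrite !ltW // (lt_trans b1) // ltrDl.
  move=> y yy'; apply: (@vertP R F (-2) 3); [exact: fc| |exact: yy].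
  by rewrite !ltW // (lt_trans _ b2) // ltrDl.
apply/eqP; rewrite -subr_eq0 -QE -cabs_eq0 eq_le cabs_ge0 andbT.
apply/ler_addgt0Pl => e e0; rewrite addr0.
have [r r0 Hr] := Fc (Complex x0 y0) (lt_trans y10 y01) 1 ltr01.
pose M := cabs (F (Complex x0 y0)) + 1.
have M0 : 0 < M by rewrite ltr_wpDl // cabs_ge0.
(* In order: the square lies where [F] is bounded by [M], inside the vertical sides, above [y1],
   below [y2], and its boundary contribution [16 * M * d] is at most [e]. *)
pose d := Num.min (Num.min (r / 4) (2^-1 / 2)) (Num.min (Num.min ((y0 - y1) / 2) ((y2 - y0) / 2)) (e / (16 * M))).
have [d0 [d1 d2] [d3 d4 d5]] : [/\ 0 < d, d <= r / 4 /\ d <= 2^-1 / 2 &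
    [/\ d <= (y0 - y1) / 2, d <= (y2 - y0) / 2 & d <= e / (16 * M)]].
  rewrite !lt_min !divr_gt0 ?mulr_gt0 ?subr_gt0 //.
  by rewrite /d; split=> //; split; rewrite ?ge_min ?lexx ?orbT // ge_min lexx ?orbT.
have [e1 e2] : a < x0 - d /\ x0 + d < a + 1.
  by rewrite a1E /a; move: d2 half0; clear; split; lra.
have [e3 e4] : y1 < y0 - d /\ y0 + d < y2 by move: d3 d4 y01 y02; clear; split; lra.
have Qz a' b' c' d' : a <= a' -> a' <= b' -> b' <= a + 1 -> y1 <= c' -> c' <= d' -> d' <= y2 ->
    (forall x y, a' <= x <= b' -> c' <= y <= d' -> (x, y) <> (x0, y0)) -> Q a' b' c' d' = 0.
  move=> i1 i2 i3 i4 i5 i6 ne.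
  apply: goursat => //.
  - exact: lt_le_trans b1 i1.
  - exact: le_lt_trans i3 b2.
  - exact: lt_le_trans b3 i4.
  - exact: le_lt_trans i6 b4.
  move=> x y xb yb; apply: Fd; last exact: ne.
    by case/andP: xb => x1 x2; rewrite -a1E (le_trans i1) // (le_trans x2).
  by case/andP: yb => h1 h2; rewrite (lt_le_trans y10) // (le_trans i4).
(* Three columns, the middle one cut into three; Goursat applies to every piece except the square
   around the exceptional point. *)
rewrite /Q (rect_int_splitx _ _ _ _ _ (x0 - d)) (rect_int_splitx _ _ _ _ _ (x0 + d) (x0 - d)).
rewrite (rect_int_splity _ _ _ _ _ (y0 - d) (x0 - d)) (rect_int_splity _ _ _ _ _ (y0 + d) (x0 - d) _ (y0 - d)).
have l1 : x0 - d <= x0 + d by move: d0; clear; lra.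
have l2 : y0 - d <= y0 + d by move: d0; clear; lra.
rewrite -/Q; rewrite (Qz a) ?(Qz (x0 + d)) ?(Qz (x0 - d) (x0 + d) y1) ?(Qz (x0 - d) (x0 + d) (y0 + d)) //;
  rewrite ?(ltW e1) ?(ltW e2) ?(ltW e3) ?(ltW e4) ?(le_trans (ltW e1) l1) ?(le_trans l1 (ltW e2)) ?lexx
   ?(le_trans (ltW e3) l2) ?(le_trans l2 (ltW e4)) ?(ltW y12) //.
- rewrite !add0r !addr0.
  apply: le_trans (@rect_int_bound R F (-2) 3 (y1 / 2) (y2 + 1) _ (x0 - d) (x0 + d) (y0 - d) (y0 + d) 0 0 0 M _ _ _ _ _ _ _) _ => //.
  + exact: lt_trans e1.
  + exact: lt_trans b2.
  + exact: lt_trans e3.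
  + exact: lt_trans b4.
  + move=> x y xx yy; rewrite mul0r addr0 subr0.
    have dx : cabs (Complex x y - Complex x0 y0) < r.
      apply: le_lt_trans (cabs_le _) _ => /=.
      apply: (@le_lt_trans _ _ (d + d)); last by move: d1 r0; clear; lra.
      by apply: lerD; rewrite ler_norml; move: xx yy d0; clear; lra.
    have := Hr _ dx; rewrite [_ + (_ - _)]addrC subrK => FF.
    rewrite -[F (Complex x y)](subrK (F (Complex x0 y0))).
    by apply: le_trans (cabsD _ _) _; rewrite /M addrC lerD2l ltW.
  rewrite (_ : _ * _ = d * (16 * M)); last by ring.
  by rewrite -ler_pdivlMr // mulr_gt0.
- by move=> x y _ yy [_ E]; move: yy d0; rewrite E; clear; lra.
- by move=> x y _ yy [_ E]; move: yy d0; rewrite E; clear; lra.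
- by move=> x y xx _ [E _]; move: xx d0; rewrite E; clear; lra.
- by move=> x y xx _ [E _]; move: xx d0; rewrite E; clear; lra.
Qed.

Lemma fint_indep F y1 y2 : holH F -> per1 F -> 0 < y1 -> 0 < y2 -> fint F y1 = fint F y2.
Proof.
move=> Fh Fp.
wlog y12 : y1 y2 / y1 <= y2.
  by move=> H; have [|/ltW] := leP y1 y2; [exact: H|move=> ? ? ?; rewrite (H y2 y1)].
move: y12; rewrite le_eqVlt => /predU1P[->//|y12] y10 y20.
apply: (@strip F 0 ((y1 + y2) / 2)) => //.
- exact: holH_cont.
- by rewrite lexx ltr01.
- by rewrite !midf_lt.
- by move=> x y _ y0 _; exact: Fh.
Qed.

End FourierIntegral.

(** * Expansions in powers of q *)

Section Periods.
Variable R : realType.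

(** Halving the angle turns [cos (2 pi a) = 1] into [sin (pi a) = 0], whereas the sine is positive
    strictly between 0 and pi. *)
Lemma ee_eq1 (a : R) : 0 <= a < 1 -> ee a = 1 -> a = 0.
Proof.
case/andP=> a0 a1 /(congr1 (@Re R)) /=.
rewrite -mulrA mulr_natl cos_mulr2n => /eqP.
rewrite subr_eq -mulr2n eqr_pMn2r // => /eqP c1.
have s0 : sin (pi * a) = 0.
  by apply: cos1sin0; apply/eqP; rewrite -sqrp_eq1 // -normrX c1 normr1.
apply/eqP; move: a0; rewrite le_eqVlt => /predU1P[<-//|a0].
have := @sin_gt0_pi R (pi * a); rewrite s0 ltxx => H.
by have := H; rewrite mulr_gt0 ?pi_gt0 //= -[X in _ < X]mulr1 ltr_pM2l ?pi_gt0 // a1 => /(_ isT).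
Qed.

Lemma ee_inj01 (a b : R) : 0 <= a < 1 -> 0 <= b < 1 -> ee a = ee b -> a = b.
Proof.
wlog ba : a b / b <= a.
  move=> H; have [/H//|/ltW ab] := leP b a.
  by move=> ha hb e; symmetry; apply: H.
move=> ha hb e; apply/eqP; rewrite -subr_eq0; apply/eqP/ee_eq1.
  by move: ha hb ba; clear; lra.
by rewrite eeD eeN e divff // ee_neq0.
Qed.

Lemma frac_part (x : R) : exists n : int, 0 <= x - n%:~R < 1.
Proof.
exists (Num.floor x); have /andP[h1 h2] := floor_itv x.
by rewrite subr_ge0 h1 ltrBlDr addrC -[1]/(1%:~R) -intrD.
Qed.

(** Locates the points at which the denominator of Chernoff's quotient vanishes: the integer
    translates of the centre. *)
Lemma qq1_eq1 (w : C R) : qq 1 w = 1 -> exists n : int, w = n%:~R.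
Proof.
move=> H.
have y0 : Im w = 0.
  have := congr1 (@cabs R) H; rewrite cabs_qq cabs1 => /(congr1 (@ln R)); rewrite expRK ln1 => /eqP.
  by rewrite oppr_eq0 mulr1 mulf_eq0 (gt_eqF (mulr_gt0 _ (pi_gt0 R))) //= => /eqP.
have wE : w = Cr (Re w) by rewrite {1}(complex_split w) y0 Cr0 mul0r addr0.
have [n n01] := frac_part (Re w).
exists n; rewrite wE -Cr_int; congr Cr; apply/eqP; rewrite -subr_eq0; apply/eqP/ee_eq1 => //.
by rewrite eeD eeN ee_int invr1 mulr1 -[Re w]mul1r -qq_real -wE.
Qed.

Lemma Im_add_int (z : C R) (n : int) : Im (z + n%:~R) = Im z.
Proof. by rewrite -Cr_int ImD /= addr0. Qed.

Lemma per1_int (f : C R -> C R) (z : C R) (n : int) : per1 f -> 0 < Im z ->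
  f (z + n%:~R) = f z.
Proof.
move=> fp z0.
have Hn (m : nat) w : 0 < Im w -> f (w + m%:R) = f w.
  elim: m w => [|m IH] w w0; first by rewrite addr0.
  by rewrite mulrS addrA IH ?fp // -[1]/(1%:~R) Im_add_int.
case: n => n; first by rewrite -pmulrn Hn.
by rewrite NegzE mulrNz -pmulrn -[in RHS](subrK (n.+1%:R) z) Hn // pmulrn -mulrNz Im_add_int.
Qed.

Lemma qq_int_shift (s : int) (z : C R) (n : int) : qq s%:~R (z + n%:~R) = qq s%:~R z.
Proof. by rewrite qqDz -Cr_int qq_real -intrM ee_int mulr1. Qed.

Lemma qq_per1 (s : int) : per1 (qq (s%:~R : R)).
Proof. by move=> z _; exact: (qq_int_shift s z 1). Qed.

Lemma expRN_small (c M e : R) : 0 < c -> 0 < e -> exists N0 : nat, forall N, (N0 <= N)%N ->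
  M * expR (- (c * N%:R)) < e.
Proof.
move=> c0 e0; have [M0|M0] := leP M 0.
  by exists 0%N => N _; apply: le_lt_trans e0; rewrite mulr_le0_ge0 ?expR_ge0.
have /archi_boundP := ltW (mulr_gt0 (etrans (invr_gt0 c) c0) (mulr_gt0 (etrans (invr_gt0 e) e0) M0)).
set n := Num.bound _ => nP; exists n => N nN.
rewrite expRN ltr_pdivrMr ?expR_gt0 //.
apply: (@lt_le_trans _ _ (e * (1 + c * N%:R))); last by rewrite ler_wpM2l ?(ltW e0) // expR_ge1Dx.
rewrite mulrDr mulr1; apply: ltr_wpDl; first exact: ltW.
rewrite -ltr_pdivrMl // -ltr_pdivrMl //.
by apply: lt_le_trans nP _; rewrite ler_nat.
Qed.

Definition clim (u : nat -> C R) l := forall e : R, 0 < e -> exists N0 : nat,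
  forall N, (N0 <= N)%N -> cabs (u N - l) < e.

End Periods.

Section Estimates.
Variable R : realType.
Implicit Types a b c e h t v : R.

Lemma lower_half t b c h : 2 * h <= t -> t - b <= c -> b <= h -> h <= c.
Proof. lra. Qed.
Lemma quarter_lt e h : 0 < e -> 0 < h -> e / 4 * h + e / 4 * h < e * h.
Proof. by move=> e0 h0; rewrite -mulrDl ltr_pM2r //; lra. Qed.
Lemma itv_half_dist a b : b - 2^-1 <= a <= b + 2^-1 -> -1 < a - b /\ a - b < 1.
Proof. by move=> H; split; lra. Qed.
Lemma pi_mul_ge v : 0 < v -> 2 * v <= pi * v.
Proof. by move=> v0; rewrite ler_pM2r // pi_ge2. Qed.
Lemma two_le_expR v : 1 < v -> 2 <= expR (2 * pi * v).
Proof.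
move=> v1; apply: le_trans (expR_ge1Dx _); rewrite -mulrA.
by have := pi_mul_ge (lt_trans ltr01 v1); lra.
Qed.
Lemma le_expR_2pi v : 0 < v -> v <= expR (2 * pi * v).
Proof.
move=> v0; apply: le_trans (expR_ge1Dx _); rewrite -mulrA.
by have := pi_mul_ge v0; lra.
Qed.
Lemma half_le_sub a b : a <= 2^-1 -> 1 - a <= b -> 2^-1 <= b.
Proof. lra. Qed.
Lemma quarters_half a b c e : a <= e / 4 * c -> b <= e / 4 * c -> a + b <= e * c * 2^-1.
Proof. lra. Qed.
End Estimates.

Section Expansion.
Variable R : realType.
Implicit Types (f g F G : C R -> C R) (z : C R).

Lemma contHM F G : contH F -> contH G -> contH (fun z => F z * G z).
Proof.
move=> Fc Gc z z0 e e0.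
pose A := 1 + cabs (G z) + cabs (F z).
have A0 : 0 < A by rewrite /A -!addrA ltr_pwDl // ?addr_ge0 ?cabs_ge0.
have e1 : 0 < e / 2 / A by rewrite !divr_gt0.
have [d1 d10 H1] := Fc z z0 _ e1; have [d2 d20 H2] := Gc z z0 _ e1.
have [d3 d30 H3] := Gc z z0 _ (ltr01 : 0 < 1 :> R).
exists (Num.min (Num.min d1 d2) d3); first by rewrite !lt_min d10 d20 d30.
move=> h; rewrite !lt_min => /andP[/andP[h1 h2] h3].
rewrite (_ : _ - _ = (F (z + h) - F z) * G (z + h) + F z * (G (z + h) - G z)); last by ring.
have gA : cabs (G (z + h)) <= A.
  have -> : G (z + h) = (G (z + h) - G z) + G z by rewrite subrK.
  apply: le_trans (cabsD _ _) _; rewrite /A -!addrA; apply: lerD; first exact: ltW (H3 _ h3).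
  by rewrite lerDl cabs_ge0.
have fA : cabs (F z) < A by rewrite /A; have := cabs_ge0 (G z); lra.
apply: le_lt_trans (cabsD _ _) _; rewrite (splitr e) !cabsM; apply: ltr_leD.
  rewrite -[X in _ < X](@divfK _ A) ?gt_eqF //.
  apply: le_lt_trans (ler_wpM2l (cabs_ge0 _) gA) _.
  by rewrite ltr_pM2r // H1.
rewrite -[X in _ <= X](@divfK _ A) ?gt_eqF // mulrC.
by apply: ler_pM; rewrite ?cabs_ge0 // ltW // H2.
Qed.

Lemma qq_holH s : holH (@qq R s).
Proof. by move=> z _; eexists; exact: cdv_qq. Qed.

(** Growth [o(1/|q|)] at the cusp: just enough to exclude negative powers of [q]. *)
Definition growth1 f := forall e : R, 0 < e -> exists Y : R,
  forall z, Y < Im z -> cabs (f z) <= e * expR (2 * pi * Im z).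

Definition coef f (n : nat) : C R := fint (fun z => f z * qq (- n%:R) z) 1.

Lemma holHM F G : holH F -> holH G -> holH (fun z => F z * G z).
Proof. by move=> Fh Gh z z0; have [l Fl] := Fh z z0; have [m Gm] := Gh z z0; eexists; exact: cdvM Fl Gm. Qed.

Lemma per1M F G : per1 F -> per1 G -> per1 (fun z => F z * G z).
Proof. by move=> Fp Gp z z0; rewrite Fp // Gp. Qed.

Lemma qqNnat_per1 n : per1 (@qq R (- n%:R)).
Proof. by rewrite pmulrn -mulrNz; exact: qq_per1. Qed.

(** The line of integration may be moved to any height [y], so the bound holds at all heights
    simultaneously. *)
Lemma coef_bound f n y M : holH f -> per1 f -> 0 < y ->
  (forall x, cabs (f (Complex x y)) <= M) -> cabs (coef f n) <= 2 * M * expR (2 * pi * n%:R * y).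
Proof.
move=> fh fp y0 fM.
have Fh : holH (fun z => f z * qq (- n%:R) z) by apply: holHM => //; exact: qq_holH.
have Fp : per1 (fun z => f z * qq (- n%:R) z) by apply: per1M => //; exact: qqNnat_per1.
rewrite /coef (@fint_indep _ _ _ y) // -mulrA; apply: fint_bound => //; first exact: holH_cont.
move=> t _; rewrite cabsM cabs_qq /= mulrN mulNr opprK.
by rewrite ler_wpM2r ?expR_ge0.
Qed.

Lemma fint_qq n y : 0 < y -> fint (@qq R (- n%:R)) y = (n == 0%N)%:R.
Proof.
move=> y0; have qc : contH (@qq R (- n%:R)) by apply/holH_cont/qq_holH.
case: n qc => [|n] qc.
  rewrite oppr0 (@fint_prim _ _ (fun t => Cr t * 1)) ?Cr1 ?Cr0 ?mulr1 ?mul0r ?subr0 //.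
    by move: qc; rewrite oppr0.
  by move=> t _; apply: rdv_eq (rdv_line 1 t) _; rewrite qq0.
pose c : C R := (Cr (- n.+1%:R) * twopii R)^-1.
have c0 : Cr (- n.+1%:R) * twopii R != 0.
  by rewrite mulf_neq0 ?twopii_neq0 // Cr_eq0 oppr_eq0 pnatr_eq0.
rewrite (@fint_prim _ _ (fun t => c * qq (- n.+1%:R) (Complex 0 y + Cr t * 1))) //.
  rewrite !mulr1 Cr0 addr0 Cr1 (qqNnat_per1 _ (_ : 0 < Im (Complex 0 y))) //.
  by rewrite subrr.
move=> t _; apply: rdv_eq (rdv_scale c (cdv_path (cdv_qq _ _))) _.
by rewrite -Complex_h mulr1 /c mulrA mulVf // mul1r.
Qed.

Section AtPoint.
Variables (f : C R -> C R) (z0 l : C R).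
Hypotheses (fh : holH f) (fp : per1 f) (fg : growth1 f).
Hypotheses (y00 : 0 < Im z0) (x01 : 0 <= Re z0 < 1) (fl : cdv f z0 l).

Let y0 := Im z0.
Let r z := qq 1 (z - z0).
(* Chernoff's quotient: [f = f z0 + g * (q / q0 - 1)] makes the partial sums of the expansion
   of [f] at [z0] telescope. *)
Let g z := if r z == 1 then l / twopii R else (f z - f z0) / (r z - 1).

Let rE z : r z = qq 1 z / qq 1 z0.
Proof. by rewrite /r qqDz -[qq 1 (- z0)]/(cexp _) mulrN cexpN. Qed.

Let r1 z : 0 < Im z -> r z = 1 -> exists n : int, z = z0 + n%:~R.
Proof. by move=> _ /qq1_eq1 [n nE]; exists n; rewrite -nE addrC subrK. Qed.

Let r_per z (n : int) : r (z + n%:~R) = r z.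
Proof. by rewrite /r addrAC -[1]/(1%:~R) qq_int_shift. Qed.

Let g_per_int z (n : int) : 0 < Im z -> g (z + n%:~R) = g z.
Proof. by move=> zp; rewrite /g r_per per1_int. Qed.

Let g_per : per1 g.
Proof. by move=> z zp; rewrite -[1 in LHS]/(1%:~R) g_per_int. Qed.

Let cdv_r z : cdv r z (twopii R * r z).
Proof.
apply: cdv_eq (cdv_comp (cdvB (cdv_id z) (cdv_cst z0 z)) (cdv_qq 1 _)) _.
by rewrite subr0 mulr1 Cr1 mul1r.
Qed.

Let f_eq z : 0 < Im z -> f z = f z0 + g z * (r z - 1).
Proof.
move=> zp; rewrite /g; case: eqP => [E|/eqP ne].
  by have [n ->] := r1 zp E; rewrite per1_int // r_per /r !subrr /qq mulr0 cexp0 subrr mulr0 addr0.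
by rewrite divfK ?subr_eq0 // addrC subrK.
Qed.

Let g_hol z : 0 < Im z -> r z <> 1 -> exists m, cdv g z m.
Proof.
move=> zp rz.
have [m fm] := fh zp.
have rm : cdv (fun w => r w - 1) z (twopii R * r z - 0) by exact: cdvB (cdv_r z) (cdv_cst 1 z).
have rne : r z - 1 != 0 by rewrite subr_eq0; apply/eqP.
have [d d0 Hd] := ccont_neq0 (cdv_cont rm) rne.
eexists; apply: (cdv_near d0 _ (cdv_div (cdvB fm (cdv_cst (f z0) z)) rm rne)).
move=> w wd; rewrite /g ifF //; apply/negbTE; rewrite -subr_eq0.
by have := Hd _ wd; rewrite [z + _]addrC subrK.
Qed.

Let r_z0 : r z0 = 1. Proof. by rewrite /r subrr /qq mulr0 cexp0. Qed.

Let g_cont_z0 : ccont g z0.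
Proof.
move=> e e0; set k := l / twopii R.
have K0 : 0 < 1 + cabs k by rewrite ltr_pwDl // cabs_ge0.
pose e2 := e / 4; pose e1 := Num.min 1 (e / 4 / (1 + cabs k)).
have e20 : 0 < e2 by rewrite divr_gt0.
have e10 : 0 < e1 by rewrite lt_min ltr01 !divr_gt0.
have [d1 d10 H1] := cdv_r z0 e10; have [d2 d20 H2] := fl e20.
exists (Num.min d1 d2); first by rewrite lt_min d10.
move=> h; rewrite lt_min => /andP[hd1 hd2].
have gz0 : g z0 = k by rewrite /g r_z0 eqxx.
rewrite gz0 /g; case: eqP => [_|/eqP ne]; first by rewrite subrr cabs0.
have ne' : r (z0 + h) - 1 != 0 by rewrite subr_eq0.
have h0 : 0 < cabs h.
  by rewrite cabs_gt0; apply: contraNneq ne => ->; rewrite addr0 r_z0.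
move: (H1 h hd1) (H2 h hd2); rewrite r_z0 mulr1 => B1 B2.
(* The linear part [2 pi i h] of [r (z0 + h) - 1] has modulus at least [2 |h|] and the error is at
   most [|h|], since [e1 <= 1]. *)
have rlow : cabs h <= cabs (r (z0 + h) - 1).
  have := cabs_sub (twopii R * h) (- (r (z0 + h) - 1 - twopii R * h)).
  rewrite opprK [_ + (_ - _)]addrC subrK cabsM cabs_twopii cabsN => B3.
  have B4 : cabs (r (z0 + h) - 1 - twopii R * h) <= cabs h.
    by apply: le_trans B1 _; rewrite ler_piMl ?cabs_ge0 // ge_min lexx.
  have B5 : 2 * cabs h <= 2 * pi * cabs h.
    by rewrite ler_wpM2r ?cabs_ge0 // ler_pMr // (le_trans _ (pi_ge2 R)) // ler1n.
  exact: lower_half B5 B3 B4.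
have E : (f (z0 + h) - f z0) / (r (z0 + h) - 1) - k =
   ((f (z0 + h) - f z0 - l * h) - k * (r (z0 + h) - 1 - twopii R * h)) / (r (z0 + h) - 1).
  by rewrite /k; field; rewrite twopii_neq0 ne'.
rewrite E cabsM cabsV ltr_pdivrMr; last by rewrite cabs_gt0.
apply: (@lt_le_trans _ _ (e * cabs h)); last by rewrite ler_wpM2l // ltW.
apply: le_lt_trans (cabsB _ _) _.
apply: (@le_lt_trans _ _ (e / 4 * cabs h + e / 4 * cabs h)); last exact: quarter_lt.
apply: lerD => //; rewrite cabsM.
apply: le_trans (ler_wpM2l (cabs_ge0 _) B1) _.
rewrite mulrA ler_wpM2r ?cabs_ge0 //.
have e1b : e1 <= e / 4 / (1 + cabs k) by rewrite ge_min lexx orbT.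
apply: le_trans (ler_wpM2l (cabs_ge0 _) e1b) _.
by rewrite mulrA ler_pdivrMr // mulrC ler_wpM2l ?(ltW e20) // lerDr.
Qed.

Let g_cont : contH g.
Proof.
move=> z zp; have [E|ne] := eqVneq (r z) 1; last first.
  by have [|m gm] := g_hol zp; [exact/eqP|exact: cdv_cont gm].
have [n zE] := r1 zp E.
move=> e /g_cont_z0 [d d0 Hd]; exists (Num.min d y0); first by rewrite lt_min d0.
move=> h; rewrite lt_min => /andP[/Hd h1 h2].
rewrite zE addrAC !g_per_int // ImD -ltrBlDl sub0r.
apply: lt_le_trans (_ : - cabs h <= _); first by rewrite ltrN2.
by rewrite lerNl; apply: le_trans (cabs_Im h); rewrite -normrN ler_norm.
Qed.

Let G (s : int) z := g z * qq s%:~R z.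

Let G_cont s : contH (G s).
Proof. by apply: contHM => //; apply/holH_cont/qq_holH. Qed.

Let G_per s : per1 (G s).
Proof. by apply: per1M => //; exact: qq_per1. Qed.

Let G_strip s Y : y0 < Y -> fint (G s) (y0 / 2) = fint (G s) Y.
Proof.
move=> yY; apply: (@strip R (G s) (Re z0) y0) => //.
- by rewrite divr_gt0.
- by rewrite yY andbT ltr_pdivrMr // ltr_pMr // ltr1n.
move=> x y xx yp ne.
have [||m gm] := @g_hol (Complex x y); first exact: yp; last first.
  by eexists; apply: cdvM gm (cdv_qq _ _).
move=> /qq1_eq1 [n nE]; apply: ne.
have e1 := congr1 (@Re R) nE; have e2 := congr1 (@Im R) nE.
move: e1 e2; rewrite -Cr_int ReD ReN ImD ImN /= => e1 e2.
have n0 : n = 0.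
  have [] := itv_half_dist xx; rewrite e1 => h1 h2.
  have h3 : -1 < n by rewrite -(ltr_int R).
  have h4 : n < 1 by rewrite -(ltr_int R).
  lia.
move: e1 e2; rewrite n0 => /eqP; rewrite subr_eq0 => /eqP -> /eqP; rewrite subr_eq0 => /eqP ->.
by [].
Qed.

Let g_growth : growth1 g.
Proof.
move=> e e0; have e4 : 0 < e / 4 by rewrite divr_gt0.
have [Y HY] := fg e4.
exists (Num.max Y (Num.max (y0 + 1) (cabs (f z0) / (e / 4)))) => z.
rewrite !gt_max => /andP[zY /andP[zy zf]].
have rz : cabs (r z) <= 2^-1.
  rewrite /r cabs_qq mulr1 expRN lef_pV2 ?posrE ?expR_gt0 //.
  by apply: two_le_expR; rewrite ImD ImN ltrBrDr addrC.
have rne : r z - 1 != 0.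
  rewrite subr_eq0; apply: contraTneq rz => ->; rewrite cabs1 -ltNge invf_lt1 ?ltr1n //.
have r1' : 2^-1 <= cabs (r z - 1).
  by have := cabs_sub 1 (r z); rewrite cabs1 cabsC; exact: half_le_sub.
rewrite /g ifF; last by apply/negbTE; rewrite -subr_eq0.
rewrite cabsM cabsV ler_pdivrMr ?cabs_gt0 //.
apply: (@le_trans _ _ (e * expR (2 * pi * Im z) * 2^-1)); last first.
  by rewrite ler_wpM2l // mulr_ge0 ?expR_ge0 // ltW.
apply: le_trans (cabsB _ _) _.
have B1 := HY z zY.
have B2 : cabs (f z0) <= e / 4 * expR (2 * pi * Im z).
  rewrite mulrC -ler_pdivrMr //; apply: le_trans (ltW zf) _.
  by apply: le_expR_2pi; apply: lt_trans zy; rewrite addr_gt0.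
exact: quarters_half B1 B2.
Qed.

(** The [s]-th term of the expansion of [g] at [z0]. The integral is taken below [z0], at half its
    height, so that the factor [q0^s] outweighs the growth of the coefficient. *)
Let T (s : int) := fint (G (- s)) (y0 / 2) * qq s%:~R z0.

(** The lower boundary term of the telescoping sum. As [g * q] tends to 0 at the cusp, the integral
    vanishes when the line of integration is pushed to infinity. *)
Let T_N1 : T (-1) = 0.
Proof.
rewrite /T opprK; suff -> : fint (G 1) (y0 / 2) = 0 by rewrite mul0r.
apply/eqP; rewrite -cabs_eq0 eq_le cabs_ge0 andbT.
apply/ler_addgt0Pl => e e0; rewrite addr0.
have e2 : 0 < e / 2 by rewrite divr_gt0.
have [Y HY] := g_growth e2.
pose Y' := Num.max Y y0 + 1.
have Yy : y0 < Y' by rewrite /Y' ltr_pwDr // le_max lexx orbT.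
have YY : Y < Y' by rewrite /Y' ltr_pwDr // le_max lexx.
rewrite (G_strip _ Yy) (_ : e = 2 * (e / 2)); last by field.
apply: fint_bound => //; first exact: lt_trans Yy.
move=> t _; rewrite /G cabsM cabs_qq mulr1 expRN ler_pdivrMr ?expR_gt0 //.
exact: HY.
Qed.

Let T_lim e : 0 < e -> exists N0 : nat, forall N, (N0 <= N)%N -> cabs (T N) < e.
Proof.
move=> e0; have yh : 0 < y0 / 2 by rewrite divr_gt0.
have [|M M0 HM] := @line_bounded R (fun t => g (Complex t (y0 / 2))) 0 1.
  by move=> t _; apply: rcont_h; exact: g_cont.
have c0 : 0 < pi * y0 by rewrite mulr_gt0 // pi_gt0.
have [N0 HN] := expRN_small (2 * M) c0 e0.
exists N0 => N /HN; apply: le_lt_trans.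
have -> : expR (- (pi * y0 * N%:R)) = expR (2 * pi * N%:R * (y0 / 2)) * expR (- (2 * pi * N%:R * y0)).
  by rewrite -expRD; congr expR; field.
rewrite /T cabsM mulrA cabs_qq -[Im z0]/y0 -pmulrn ler_wpM2r ?expR_ge0 // -mulrA.
apply: fint_bound => //.
move=> t t01; rewrite /G cabsM cabs_qq mulrNz -pmulrn /= mulrN mulNr opprK.
by rewrite ler_wpM2r ?expR_ge0 // HM.
Qed.

(** Integrate [f = f z0 + g (q / q0 - 1)] against [q^(-n) q0^n]: the extra power of [q] makes the
    two terms in [g] consecutive values of [T]. Integer indices let [n = 0] reach [T (-1)]. *)
Let coef_T (n : nat) : coef f n * qq n%:R z0 = f z0 * (n == 0%N)%:R + (T (n%:Z - 1) - T n%:Z).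
Proof.
have yh : 0 < y0 / 2 by rewrite divr_gt0.
have Fh : holH (fun z => f z * qq (- n%:R) z) by apply: holHM => //; exact: qq_holH.
have Fp : per1 (fun z => f z * qq (- n%:R) z) by apply: per1M => //; exact: qqNnat_per1.
rewrite /coef (@fint_indep _ _ _ (y0 / 2)) //.
rewrite (@fint_lin3 R _ (qq (- n%:R)) (G (1 - n%:Z)) (G (- n%:Z)) (f z0) (qq 1 z0)^-1 (-1)) //.
- rewrite fint_qq // mulN1r /T; have -> : - (n%:Z - 1) = 1 - n%:Z by rewrite opprB.
  have -> : qq (n%:Z - 1)%:~R z0 = qq n%:R z0 / qq 1 z0 by rewrite intrB qqB -pmulrn.
  rewrite -pmulrn; case: n {Fh Fp} => [|n] /=; rewrite ?qq0; first by ring.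
  by rewrite !mulr0 !add0r; field; rewrite qq_neq0.
- exact: holH_cont.
- by apply/holH_cont/qq_holH.
move=> t; set z := Complex t _.
rewrite f_eq // /G rE intrB intrN qqD -pmulrn qqN; field.
by rewrite !qq_neq0.
Qed.

Lemma expansion_at : clim (fun N => \sum_(n < N) coef f n * qq n%:R z0) (f z0).
Proof.
have S (N : nat) : \sum_(n < N.+1) coef f n * qq n%:R z0 = f z0 - T N%:Z.
  elim: N => [|N IH].
    by rewrite big_ord_recr big_ord0 /= coef_T mulr1 sub0r T_N1; ring.
  rewrite big_ord_recr IH /= coef_T mulr0 add0r.
  have -> : (N.+1%:Z - 1) = N%:Z by lia.
  by ring.
move=> e /T_lim [N0 H]; exists N0.+1 => N NN; case: N NN => // N NN.
by rewrite S addrC addKr cabsN H.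
Qed.

End AtPoint.

Theorem expansion f z : holH f -> per1 f -> growth1 f -> 0 < Im z ->
  clim (fun N => \sum_(n < N) coef f n * qq n%:R z) (f z).
Proof.
move=> fh fp fg zp.
have [m m01] := frac_part (Re z).
(* Translate into the strip [0 <= Re < 1], the range covered by the antiderivatives on [[-2, 3]]. *)
pose w := z + (- m)%:~R.
have wp : 0 < Im w by rewrite Im_add_int.
have [l fl] := fh w wp.
have -> : f z = f w by rewrite per1_int.
have -> : (fun N => \sum_(n < N) coef f n * qq n%:R z) =
          (fun N => \sum_(n < N) coef f n * qq n%:R w).
  apply/funext => N; apply: eq_bigr => n _.
  by rewrite pmulrn qq_int_shift.
apply: (expansion_at fh fp fg wp _ fl).
by rewrite /w -Cr_int ReD /= intrN.
Qed.

End Expansion.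

Section Limits.
Variable R : realType.
Implicit Types (u v : nat -> C R) (l m : C R).

Lemma clim_le u l K : clim u l -> (forall N, cabs (u N) <= K) -> cabs l <= K.
Proof.
move=> ul uK; apply/ler_addgt0Pl => e /ul [N0 /(_ N0 (leqnn _)) H].
rewrite cabsC in H; rewrite -[l](subrK (u N0)).
by apply: le_trans (cabsD _ _) _; apply: lerD => //; exact: ltW.
Qed.

Lemma climD u v l m : clim u l -> clim v m -> clim (fun N => u N + v N) (l + m).
Proof.
move=> ul vm e e0; have e2 : 0 < e / 2 by rewrite divr_gt0.
have [N1 H1] := ul _ e2; have [N2 H2] := vm _ e2; exists (maxn N1 N2) => N.
rewrite geq_max => /andP[n1 n2]; rewrite (_ : _ - _ = (u N - l) + (v N - m)); last by ring.
by apply: le_lt_trans (cabsD _ _) _; rewrite (splitr e) ltrD ?H1 ?H2.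
Qed.

Lemma clim_scale c u l : clim u l -> clim (fun N => c * u N) (c * l).
Proof.
move=> ul e e0; have k0 : 0 < 1 + cabs c by rewrite ltr_pwDl // cabs_ge0.
have [N1 H1] := ul _ (divr_gt0 e0 k0); exists N1 => N /H1 H.
rewrite -mulrBr cabsM; rewrite ltr_pdivlMr // in H; apply: le_lt_trans H.
by rewrite mulrC ler_wpM2l ?cabs_ge0 // lerDr.
Qed.

Lemma climN u l : clim u l -> clim (fun N => - u N) (- l).
Proof. by move=> ul e /ul [N0 H]; exists N0 => N /H; rewrite -opprD cabsN. Qed.

Lemma climB u v l m : clim u l -> clim v m -> clim (fun N => u N - v N) (l - m).
Proof. by move=> ul /climN vm; exact: climD. Qed.

Lemma clim_cst l : clim (fun=> l) l.
Proof. by move=> e e0; exists 0%N => N _; rewrite subrr cabs0. Qed.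

Lemma clim_uniq u l m : clim u l -> clim u m -> l = m.
Proof.
move=> ul um; apply/eqP; rewrite -subr_eq0 -cabs_eq0 eq_le cabs_ge0 andbT.
by apply: clim_le (climB ul um) _ => N; rewrite subrr cabs0.
Qed.

Lemma clim_ext u v l : u =1 v -> clim u l -> clim v l.
Proof. by move=> uv; rewrite (_ : u = v) //; exact/funext. Qed.

Lemma clim_shift u l : clim u l -> clim (fun N => u N.+1) l.
Proof. by move=> ul e /ul [N0 H]; exists N0 => N NN; apply: H; exact: leqW. Qed.

Lemma expRMn (s : R) n : expR (s * n%:R) = expR s ^+ n.
Proof.
elim: n => [|n IH]; first by rewrite mulr0 expR0.
by rewrite exprS -IH -expRD -natr1 mulrDr mulr1 addrC.
Qed.

Lemma geo_sum_le (s : R) N : 0 < s ->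
  \sum_(n < N) expR (- (s * n%:R)) <= (1 - expR (- s))^-1.
Proof.
move=> s0; have r1 : expR (- s) < 1 by rewrite -expR0 ltr_expR oppr_lt0.
have d0 : 0 < 1 - expR (- s) by rewrite subr_gt0.
under eq_bigr do rewrite -mulNr expRMn.
rewrite -[X in _ <= X]mulr1 ler_pdivlMl //.
have := subrX1 (expR (- s)) N; set S := \sum_(_ < _) _ => H.
have -> : (1 - expR (- s)) * S = 1 - expR (- s) ^+ N by rewrite -[RHS]opprB H; ring.
by rewrite gerBl exprn_ge0 // expR_ge0.
Qed.

Lemma real_series_cvg (u : nat -> R) (M s : R) : 0 < s ->
  (forall n, `|u n| <= M * expR (- (s * n%:R))) -> exists l : R,
   forall e : R, 0 < e -> exists N0 : nat, forall N, (N0 <= N)%N -> `|\sum_(n < N) u n - l| < e.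
Proof.
move=> s0 uM; have r1 : expR (- s) < 1 by rewrite -expR0 ltr_expR oppr_lt0.
have : cvgn (series (u : R^o^nat)).
  apply: normed_cvg; apply: (@series_le_cvg R _ (geometric M (expR (- s)))) => //.
  - by move=> n; exact: normr_ge0.
  - by move=> n /=; rewrite -expRMn mulNr; apply: le_trans (uM n).
  - by move=> n /=; rewrite -expRMn mulNr.
  by apply: is_cvg_geometric_series; rewrite ger0_norm ?expR_ge0.
move=> /cvg_ex [l /cvgrPdistC_lt ul]; exists l => e /ul [N0 _ H]; exists N0 => N /H /=.
by rewrite /series /= big_mkord.
Qed.

Lemma series_clim (u : nat -> C R) (M s : R) : 0 < s ->
  (forall n, cabs (u n) <= M * expR (- (s * n%:R))) ->
  exists l, clim (fun N => \sum_(n < N) u n) l.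
Proof.
move=> s0 uM.
have [l1 H1] := real_series_cvg s0 (fun n => le_trans (cabs_Re (u n)) (uM n)).
have [l2 H2] := real_series_cvg s0 (fun n => le_trans (cabs_Im (u n)) (uM n)).
exists (Complex l1 l2) => e e0; have e2 : 0 < e / 2 by rewrite divr_gt0.
have [N1 {}H1] := H1 _ e2; have [N2 {}H2] := H2 _ e2; exists (maxn N1 N2) => N.
rewrite geq_max => /andP[/H1 h1 /H2 h2].
have Rs : Re (\sum_(n < N) u n) = \sum_(n < N) Re (u n).
  by elim: (N) => [|k IH]; rewrite ?big_ord0 // !big_ord_recr /= ReD IH.
have Is : Im (\sum_(n < N) u n) = \sum_(n < N) Im (u n).
  by elim: (N) => [|k IH]; rewrite ?big_ord0 // !big_ord_recr /= ImD IH.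
apply: le_lt_trans (cabs_le _) _; rewrite ReD ReN ImD ImN Rs Is /= (splitr e).
exact: ltrD.
Qed.

End Limits.

(** * Power series in q: convergence, derivatives, primitives *)

Section QSeries.
Variable R : realType.
Implicit Types (a b : nat -> C R) (f g : C R -> C R) (z h : C R) (c M : R).

Definition qsum a (z : C R) (N : nat) := \sum_(n < N) a n * qq n%:R z.

(** Radius of convergence at least one in [q], written on the exponential scale that [coef_bound]
    produces. *)
Definition subexp a := forall y : R, 0 < y -> exists2 M, 0 <= M &
  forall n, cabs (a n) <= M * expR (2 * pi * n%:R * y).

Definition QS a f := subexp a /\ forall z, 0 < Im z -> clim (qsum a z) (f z).

Definition qderiv a : nat -> C R := fun n => n%:R * twopii R * a n.

Definition wt c := pi * c / 8.
(* Bounds [\sum_n (n+1)^2 exp(-pi c n / 2)]; the factor [(n+1)^2] absorbs two derivatives. *)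
Definition bigK c := (1 + (wt c)^-1) ^+ 2 / (1 - expR (- (2 * wt c))).

Lemma wt_gt0 c : 0 < c -> 0 < wt c.
Proof. by move=> c0; rewrite divr_gt0 // mulr_gt0 // pi_gt0. Qed.

Lemma bigK_ge0 c : 0 < c -> 0 <= bigK c.
Proof.
move=> /wt_gt0 c0; rewrite divr_ge0 ?exprn_even_ge0 // subr_ge0 -expR0 ler_expR oppr_le0.
by rewrite mulr_ge0 // ltW.
Qed.

Lemma succ_le_expR (s : R) n : 0 < s -> n.+1%:R <= (1 + s^-1) * expR (s * n%:R).
Proof.
move=> s0; rewrite -natr1 addrC mulrDl mul1r; apply: lerD.
  by rewrite -expR0 ler_expR mulr_ge0 // ltW.
rewrite ler_pdivlMl //; apply: le_trans (expR_ge1Dx _); by rewrite lerDr.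
Qed.

Lemma weighted_sum_le a c M N : 0 < c -> 0 <= M ->
  (forall n, cabs (a n) <= M * expR (2 * pi * n%:R * (c / 4))) ->
  \sum_(n < N) cabs (a n) * (n.+1%:R ^+ 2 * expR (- (pi * c * n%:R))) <= M * bigK c.
Proof.
move=> c0 M0 aM; have s0 := wt_gt0 c0; set s := wt c in s0 *.
have sE : pi * c = 8 * s by rewrite /s /wt; field.
(* In units of [s = pi c / 8]: the coefficients grow at rate 4, the square of [n + 1] costs 2, the
   power of [q] decays at rate 8, which leaves a geometric series of rate 2. *)
have st n : cabs (a n) * (n.+1%:R ^+ 2 * expR (- (pi * c * n%:R))) <=
   M * (1 + s^-1) ^+ 2 * expR (- (2 * s * n%:R)).
  have -> : M * (1 + s^-1) ^+ 2 * expR (- (2 * s * n%:R)) =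
    (M * expR (2 * pi * n%:R * (c / 4))) *
     (((1 + s^-1) * expR (s * n%:R)) ^+ 2 * expR (- (pi * c * n%:R))).
    have -> : 2 * pi * n%:R * (c / 4) = 4 * s * n%:R by rewrite /s /wt; field.
    rewrite sE exprMn -[expR (s * _) ^+ 2]expRMn.
    have -> : expR (- (2 * s * n%:R)) =
      expR (4 * s * n%:R) * (expR (s * n%:R * 2) * expR (- (8 * s * n%:R))).
      by rewrite -!expRD; congr expR; ring.
    by ring.
  apply: ler_pM (aM n) _; rewrite ?cabs_ge0 ?mulr_ge0 ?expR_ge0 ?exprn_ge0 //.
  by rewrite ler_wpM2r ?expR_ge0 // lerXn2r ?nnegrE // ?mulr_ge0 ?expR_ge0 ?addr_ge0 ?invr_ge0 ?(ltW s0) //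
    succ_le_expR.
apply: (@le_trans _ _ (\sum_(n < N) M * (1 + s^-1) ^+ 2 * expR (- (2 * s * n%:R)))).
  by apply: ler_sum => n _; exact: st.
rewrite -mulr_sumr.
have -> : M * bigK c = M * (1 + s^-1) ^+ 2 * (1 - expR (- (2 * s)))^-1 by rewrite /bigK -/s mulrA.
apply: ler_wpM2l; first by rewrite mulr_ge0 // exprn_even_ge0.
by apply: geo_sum_le; rewrite mulr_gt0.
Qed.

Lemma csum_le N (u : 'I_N -> C R) (v : 'I_N -> R) : (forall n, cabs (u n) <= v n) ->
  cabs (\sum_(n < N) u n) <= \sum_(n < N) v n.
Proof.
elim: N u v => [|N IH] u v uv; first by rewrite !big_ord0 cabs0.
rewrite !big_ord_recr /=; apply: le_trans (cabsD _ _) _; apply: lerD => //.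
exact: IH.
Qed.

Lemma cabs_qq_nat_le c z n : c / 2 <= Im z -> cabs (qq n%:R z) <= expR (- (pi * c * n%:R)).
Proof.
move=> cz; rewrite cabs_qq ler_expR lerN2 (_ : pi * c * n%:R = 2 * pi * n%:R * (c / 2)); last by field.
by rewrite ler_wpM2l // !mulr_ge0 // pi_ge0.
Qed.

Lemma qsum_le a c M z N : 0 < c -> 0 <= M ->
  (forall n, cabs (a n) <= M * expR (2 * pi * n%:R * (c / 4))) ->
  c / 2 <= Im z -> cabs (qsum a z N) <= M * bigK c.
Proof.
move=> c0 M0 aM cz; apply: le_trans (weighted_sum_le N c0 M0 aM).
apply: csum_le => n.
rewrite cabsM ler_wpM2l ?cabs_ge0 //; apply: le_trans (cabs_qq_nat_le n cz) _.
by rewrite ler_peMl ?expR_ge0 // exprn_ege1 // ler1n.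
Qed.

Lemma natrC_cabs n : cabs (n%:R : C R) = n%:R.
Proof. by rewrite -Cr_nat cabs_Cr ger0_norm. Qed.

Lemma qderiv_sum_le a c M z N : 0 < c -> 0 <= M ->
  (forall n, cabs (a n) <= M * expR (2 * pi * n%:R * (c / 4))) ->
  c / 2 <= Im z -> cabs (qsum (qderiv a) z N) <= 2 * pi * (M * bigK c).
Proof.
move=> c0 M0 aM cz; have p0 := pi_ge0 R.
apply: le_trans (ler_wpM2l (mulr_ge0 _ p0) (weighted_sum_le N c0 M0 aM)); last by [].
rewrite mulr_sumr; apply: csum_le => n.
rewrite /qderiv 3!cabsM natrC_cabs cabs_twopii.
rewrite (_ : n%:R * _ * _ * _ = 2 * pi * (cabs (a n) * (n%:R * cabs (qq n%:R z)))); last by ring.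
apply: ler_wpM2l; first exact: mulr_ge0.
apply: ler_wpM2l; first exact: cabs_ge0.
apply: ler_pM; rewrite ?cabs_ge0 //; last exact: cabs_qq_nat_le.
by rewrite -natrX ler_nat; apply: (@leq_trans n.+1) => //; rewrite -[X in (X <= _)%N]expn1 leq_pexp2l.
Qed.

(** The quadratic remainder is uniform in [N], so it survives the limit and yields the derivative of
    the sum in [QS_taylor]. *)
Lemma qsum_taylor a c M z h N : 0 < c -> 0 <= M ->
  (forall n, cabs (a n) <= M * expR (2 * pi * n%:R * (c / 4))) ->
  c <= Im z -> cabs h <= c / 2 ->
  cabs (qsum a (z + h) N - qsum a z N - qsum (qderiv a) z N * h) <=
  4 * (2 * pi) ^+ 2 * (M * bigK c) * cabs h ^+ 2.
Proof.
move=> c0 M0 aM cz hc; have p0 := pi_ge0 R.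
have K0 : 0 <= 4 * (2 * pi) ^+ 2 :> R by rewrite mulr_ge0 // exprn_even_ge0.
apply: le_trans (ler_wpM2r _ (ler_wpM2l K0 (weighted_sum_le N c0 M0 aM))); last first.
  by rewrite exprn_even_ge0.
rewrite (_ : _ - _ - _ = \sum_(n < N) a n * (qq n%:R (z + h) - qq n%:R z
     - Cr n%:R * twopii R * qq n%:R z * h)); last first.
  rewrite /qsum mulr_suml -!sumrB; apply: eq_bigr => n _.
  by rewrite /qderiv Cr_nat; ring.
rewrite mulr_sumr mulr_suml; apply: csum_le => n.
set E0 := expR _.
rewrite cabsM [X in _ <= X](_ : _ =
  cabs (a n) * (4 * (2 * pi) ^+ 2 * (n.+1%:R ^+ 2 * E0) * cabs h ^+ 2)); last by ring.
apply: ler_wpM2l; first exact: cabs_ge0.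
apply: le_trans (qq_taylor_bound _ _ _) _; rewrite ger0_norm //.
have E1 : expR (- (2 * pi * n%:R * Im z) + 2 * pi * n%:R * cabs h) <=
          expR (- (pi * c * n%:R)).
  rewrite ler_expR (_ : - (pi * c * n%:R) = - (2 * pi * n%:R * c) + 2 * pi * n%:R * (c / 2)); last by field.
  by apply: lerD; [rewrite lerN2|]; rewrite ler_wpM2l // !mulr_ge0.
apply: (@le_trans _ _ (4 * ((2 * pi * n%:R * cabs h) ^+ 2 * E0))).
  by rewrite ler_wpM2l // ler_wpM2l ?exprn_even_ge0.
rewrite [X in X <= _](_ : _ = 4 * (2 * pi) ^+ 2 * (n%:R ^+ 2 * E0) * cabs h ^+ 2); last by ring.
apply: ler_wpM2r; first by rewrite exprn_even_ge0.
apply: ler_wpM2l => //; apply: ler_wpM2r; first exact: expR_ge0.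
by rewrite lerXn2r ?nnegrE // ler_nat.
Qed.

Lemma subexp_exists a : subexp a -> exists f, QS a f.
Proof.
move=> ab.
have H z : exists l, 0 < Im z -> clim (qsum a z) l.
  have [y0|_] := boolP (0 < Im z); last by exists 0.
  have [M M0 aM] := ab _ (divr_gt0 y0 (ltr0n _ 2)).
  have [||l Hl] := @series_clim R (fun n => a n * qq n%:R z) M (pi * Im z).
  - by rewrite mulr_gt0 // pi_gt0.
  - move=> n; rewrite cabsM cabs_qq.
    apply: le_trans (ler_wpM2r (expR_ge0 _) (aM n)) _.
    set E1 := expR _; set E2 := expR _; rewrite (_ : expR _ = E1 * E2) ?mulrA //.
    by rewrite /E1 /E2 -expRD; congr expR; field.
  by exists l.
by have [f fP] := choice H; exists f.
Qed.

Lemma subexp_qderiv a : subexp a -> subexp (qderiv a).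
Proof.
move=> ab y y0; have y2 : 0 < y / 2 by rewrite divr_gt0.
have [M M0 aM] := ab _ y2; have p0 := pi_gt0 R.
have s0 : 0 < pi * y by rewrite mulr_gt0.
exists (2 * pi * (1 + (pi * y)^-1) * M).
  by rewrite mulr_ge0 // mulr_ge0 ?addr_ge0 ?invr_ge0 ?(ltW s0) // mulr_ge0 // ltW.
move=> n; rewrite /qderiv 2!cabsM natrC_cabs cabs_twopii.
have := succ_le_expR n s0 => H.
have {}H : n%:R <= (1 + (pi * y)^-1) * expR (pi * y * n%:R).
  by apply: le_trans H; rewrite ler_nat.
rewrite (_ : expR (2 * pi * n%:R * y) = expR (pi * y * n%:R) * expR (2 * pi * n%:R * (y / 2))); last first.
  by rewrite -expRD; congr expR; field.
set E1 := expR _ in H *; set E2 := expR _.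
rewrite (_ : n%:R * (2 * pi) * cabs (a n) = 2 * pi * (n%:R * cabs (a n))); last by ring.
rewrite [X in _ <= X](_ : _ = 2 * pi * (((1 + (pi * y)^-1) * E1) * (M * E2))); last by ring.
apply: ler_wpM2l; first by rewrite mulr_ge0 // ltW.
by apply: ler_pM; rewrite ?cabs_ge0 //; exact: aM.
Qed.

Lemma qs_level c : 0 < c -> 0 < c / 4. Proof. by move=> c0; rewrite divr_gt0. Qed.

Lemma QS_taylor a f g c M z h : QS a f -> QS (qderiv a) g -> 0 < c -> 0 <= M ->
  (forall n, cabs (a n) <= M * expR (2 * pi * n%:R * (c / 4))) ->
  c <= Im z -> cabs h <= c / 2 ->
  cabs (f (z + h) - f z - g z * h) <= 4 * (2 * pi) ^+ 2 * (M * bigK c) * cabs h ^+ 2.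
Proof.
move=> [_ af] [_ ag] c0 M0 aM cz hc.
have z0 : 0 < Im z by exact: lt_le_trans cz.
have zh : 0 < Im (z + h).
  have := cabs_Im h; rewrite ler_norml ImD => /andP[h1 _].
  by have := ler_ltD h1 (lt_le_trans c0 cz); lra.
apply: (@clim_le _ (fun N => qsum a (z + h) N - qsum a z N - qsum (qderiv a) z N * h)).
  apply: climB; first by apply: climB; exact: af.
  by rewrite mulrC; apply: clim_ext (clim_scale h (ag z z0)) => N; rewrite mulrC.
by move=> N; exact: qsum_taylor.
Qed.

Lemma cdv_quadratic f z l (r K : R) : 0 < r -> 0 <= K ->
  (forall h, cabs h <= r -> cabs (f (z + h) - f z - l * h) <= K * cabs h ^+ 2) -> cdv f z l.
Proof.
move=> r0 K0 H e e0; have k0 : 0 < 1 + K by rewrite ltr_pwDl.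
exists (Num.min r (e / (1 + K))); first by rewrite lt_min r0 divr_gt0.
move=> h; rewrite lt_min => /andP[hr he].
apply: le_trans (H h (ltW hr)) _; rewrite expr2 mulrA ler_wpM2r ?cabs_ge0 //.
rewrite ltr_pdivlMr // in he; apply: le_trans (ltW he).
by rewrite mulrC ler_wpM2l ?cabs_ge0 // lerDr.
Qed.

Lemma QS_deriv a f : QS a f ->
  exists2 g, QS (qderiv a) g & forall z, 0 < Im z -> cdv f z (g z).
Proof.
move=> af; have [g ag] := subexp_exists (subexp_qderiv af.1); exists g => // z z0.
have [M M0 aM] := af.1 _ (qs_level z0).
apply: (@cdv_quadratic _ _ _ (Im z / 2) (4 * (2 * pi) ^+ 2 * (M * bigK (Im z)))).
- by rewrite divr_gt0.
- apply: mulr_ge0; first by rewrite mulr_ge0 // exprn_even_ge0.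
  by apply: mulr_ge0 => //; exact: bigK_ge0.
by move=> h hz; exact: (QS_taylor af ag z0 M0 aM).
Qed.

Lemma QS_bounded a f c : QS a f -> 0 < c -> exists2 K, 0 <= K &
  forall z, c <= Im z -> cabs (f z) <= K.
Proof.
move=> [ab af] c0; have [M M0 aM] := ab _ (qs_level c0).
exists (M * bigK c); first by rewrite mulr_ge0 ?bigK_ge0.
move=> z cz; apply: clim_le (af z (lt_le_trans c0 cz)) _ => N.
apply: qsum_le => //; apply: le_trans cz; by rewrite ler_pdivrMr // ler_pMr // ler1n.
Qed.

Lemma QS_per a f : QS a f -> per1 f.
Proof.
move=> [_ af] z z0; have z1 : 0 < Im (z + 1) by rewrite ImD /= addr0.
apply: clim_uniq (af _ z1) _; apply: clim_ext (af z z0) => N.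
by apply: eq_bigr => n _; rewrite pmulrn qq_per1.
Qed.

Lemma QS_tail a f : QS a f -> QS (fun n => a n.+1) (fun z => (f z - a 0%N) / qq 1 z).
Proof.
move=> [ab af]; split.
  move=> y y0; have [M M0 aM] := ab y y0; exists (M * expR (2 * pi * y)).
    by rewrite mulr_ge0 ?expR_ge0.
  move=> n; apply: le_trans (aM n.+1) _.
  have -> : 2 * pi * n.+1%:R * y = 2 * pi * y + 2 * pi * n%:R * y by rewrite -natr1; ring.
  by rewrite expRD mulrA.
move=> z z0; rewrite mulrC.
apply: clim_ext (clim_scale (qq 1 z)^-1 (climB (clim_shift (af z z0)) (clim_cst (a 0%N)))) => N.
rewrite /qsum big_ord_recl /= qq0 mulr1 [a 0%N + _]addrC addrK mulr_sumr.
apply: eq_bigr => n _; rewrite /bump /= -natr1 qqD.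
by field; rewrite qq_neq0.
Qed.

(** The constant term is removed because its primitive [a 0 * z] is not periodic. *)
Lemma QS_prim a f : QS a f -> exists b L, [/\ QS b L, b 0%N = 0 &
  forall z, 0 < Im z -> cdv L z (f z - a 0%N)].
Proof.
move=> [ab af].
(* At [n = 0] the quotient is 0 because division by zero gives zero; this fixes the constant of
   integration. *)
pose b n := a n / (n%:R * twopii R).
have bb : subexp b.
  move=> y y0; have [M M0 aM] := ab y y0; exists M => // n.
  apply: le_trans (aM n); rewrite /b cabsM cabsV cabsM natrC_cabs cabs_twopii.
  case: n => [|n]; first by rewrite mul0r invr0 mulr0 cabs_ge0.
  rewrite ler_piMr ?cabs_ge0 // invf_le1; last by rewrite !mulr_gt0 // pi_gt0.
  rewrite mulrA; apply: (@le_trans _ _ (1 * 2 * 1)); first by rewrite mulr1 mul1r ler1n.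
  have p1 : 1 <= pi :> R by apply: le_trans (pi_ge2 R); rewrite ler1n.
  by apply: ler_pM => //; apply: ler_pM => //; rewrite ler1n.
have [L bL] := subexp_exists bb; have [g bg Lg] := QS_deriv bL.
exists b, L; split=> //; first by rewrite /b mul0r invr0 mulr0.
move=> z z0; apply: cdv_eq (Lg z z0) _.
apply: clim_uniq (clim_shift (bg.2 z z0)) _.
apply: clim_ext (climB (clim_shift (af z z0)) (clim_cst (a 0%N))) => N.
have d0 : qderiv b 0%N = 0 by rewrite /qderiv !mul0r.
rewrite /qsum !big_ord_recl /= d0 mul0r add0r qq0 mulr1 [a 0%N + _]addrC addrK.
apply: eq_bigr => n _; rewrite /qderiv /b /bump /=; field.
by rewrite twopii_neq0 -mulrS pnatr_eq0.
Qed.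

End QSeries.

Lemma cancel_bound (F : fieldType) (e B p : F) : B + 1 != 0 -> p != 0 -> (2 : F) != 0 -> (8 : F) != 0 ->
  2 * p * (2 * (e / (8 * p * (B + 1)) * 2) * B) = e * (B / (B + 1)).
Proof. by move=> B0 p0 h2 h8; field; rewrite h8 B0 p0. Qed.

(** * Periodic functions bounded at the cusp *)

Section BoundedPeriodic.
Variable R : realType.
Implicit Types (f g h L : C R -> C R) (z w a b c : C R).

Lemma segment_Im z w (t : R) : 0 <= t <= 1 -> 0 < Im z -> 0 < Im w ->
  0 < Im (z + Cr t * (w - z)).
Proof.
case/andP=> t0 t1 z0 w0; rewrite ImD ImCrM ImD ImN.
have : Num.min (Im z) (Im w) <= Im z + t * (Im w - Im z).
  by rewrite ge_min; case: (leP (Im z) (Im w)) => H; apply/orP; [left|right]; nra.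
by apply: lt_le_trans; rewrite lt_min z0.
Qed.

Lemma deriv0_const f : (forall z, 0 < Im z -> cdv f z 0) ->
  forall z w, 0 < Im z -> 0 < Im w -> f w = f z.
Proof.
move=> fd z w z0 w0; apply/eqP; rewrite -subr_eq0 -cabs_eq0 eq_le cabs_ge0 andbT.
have := @segment_bound R f (fun=> 0) z (w - z) 0.
rewrite [z + _]addrC subrK mulr0 mul0r; apply; last by move=> t _; rewrite cabs0.
by move=> t t01; apply: fd; exact: segment_Im.
Qed.

Lemma cauchy_clim (u : nat -> C R) :
  (forall e : R, 0 < e -> exists N0 : nat, forall N M, (N0 <= N)%N -> (N0 <= M)%N ->
     cabs (u N - u M) <= e) -> exists l, clim u l.
Proof.
have real (v : nat -> R) :
  (forall e : R, 0 < e -> exists N0 : nat, forall N M, (N0 <= N)%N -> (N0 <= M)%N ->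
     `|v N - v M| <= e) ->
  exists l : R, forall e : R, 0 < e -> exists N0 : nat, forall N, (N0 <= N)%N -> `|v N - l| <= e.
  (* The supremum of the eventual lower bounds is the limit inferior. *)
  move=> vc; pose S := [set x : R | exists N0 : nat, forall N, (N0 <= N)%N -> x <= v N]%classic.
  exists (sup S) => e e0; have [N0 HN] := vc _ e0; exists N0 => N NN.
  have inS : S (v N - e).
    exists N0 => M MM; have := HN N M NN MM; rewrite ler_norml => /andP[_]; lra.
  have ubS : ubound S (v N + e).
    move=> x [N1 H1]; have := HN N (maxn N0 N1) NN (leq_maxl _ _).
    by have := H1 _ (leq_maxr N0 N1); rewrite ler_norml => + /andP[+ _]; lra.
  have l1 : v N - e <= sup S by apply: ub_le_sup => //; exists (v N + e).
  have l2 : sup S <= v N + e by apply: ge_sup => //; exists (v N - e).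
  by rewrite ler_norml; apply/andP; split; lra.
move=> uc.
have [|l1 H1] := real (fun N => Re (u N)).
  move=> e /uc [N0 H]; exists N0 => N M NN MM; apply: le_trans (H N M NN MM).
  by rewrite -ReN -ReD cabs_Re.
have [|l2 H2] := real (fun N => Im (u N)).
  move=> e /uc [N0 H]; exists N0 => N M NN MM; apply: le_trans (H N M NN MM).
  by rewrite -ImN -ImD cabs_Im.
exists (Complex l1 l2) => e e0; have e4 : 0 < e / 4 by rewrite divr_gt0.
have [N1 {}H1] := H1 _ e4; have [N2 {}H2] := H2 _ e4; exists (maxn N1 N2) => N.
rewrite geq_max => /andP[/H1 h1 /H2 h2].
apply: le_lt_trans (cabs_le _) _; rewrite ReD ReN ImD ImN /=.
by apply: le_lt_trans (lerD h1 h2) _; lra.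
Qed.

(** By [BB_QS] and [QS_BB] these are the holomorphic functions of [q] on the unit disc, read on the
    upper half-plane; boundedness at the cusp is the removable singularity at [q = 0]. *)
Definition BB f := [/\ holH f, per1 f &
  exists y K : R, [/\ 0 < y, 0 <= K & forall z, y <= Im z -> cabs (f z) <= K]].

(** The value at [q = 0], together with the rate [O(|q|)] that any function in [BB] attains; keeping
    the rate makes the notion stable under products. *)
Definition qlim f a := exists y K : R, [/\ 0 < y, 0 <= K & forall z, y <= Im z ->
  cabs (f z - a) <= K * cabs (qq 1 z)].

Lemma BB_growth1 f : BB f -> growth1 f.
Proof.
case=> _ _ [y [K [y0 K0 fK]]] e e0.
exists (Num.max y (K / e)) => z; rewrite gt_max => /andP[zy zK].
apply: le_trans (fK z (ltW zy)) _; rewrite mulrC -ler_pdivrMr //.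
by apply: le_trans (ltW zK) (le_expR_2pi _); apply: lt_trans zy.
Qed.

Lemma line_bounded_per f y : holH f -> per1 f -> 0 < y ->
  exists2 K, 0 <= K & forall x, cabs (f (Complex x y)) <= K.
Proof.
move=> fh fp y0.
have [|K K0 fK] := @line_bounded R (fun t => f (Complex t y)) 0 1.
  by move=> t _; apply: rcont_h; exact: holH_cont.
exists K => // x; have [n /andP[n0 n1]] := frac_part x.
rewrite -(@per1_int R f (Complex x y) (- n)) //.
have -> : Complex x y + (- n)%:~R = Complex (x - n%:~R) y.
  by rewrite -Cr_int; apply/eqP; rewrite eq_complex /= intrN addr0 !eqxx.
by apply: fK; rewrite n0 ltW.
Qed.

Lemma QS_intro f : holH f -> per1 f -> growth1 f -> QS (coef f) f.
Proof.
move=> fh fp fg; split; last by move=> z z0; exact: expansion.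
move=> y y0; have [K K0 fK] := line_bounded_per fh fp y0.
by exists (2 * K); [rewrite mulr_ge0|move=> n; exact: coef_bound].
Qed.

Lemma BB_QS f : BB f -> QS (coef f) f.
Proof. by move=> fB; case: (fB) => fh fp _; apply: QS_intro => //; exact: BB_growth1. Qed.

Lemma QS_holH (u : nat -> C R) f : QS u f -> holH f.
Proof. by move=> /QS_deriv [g _ H] z z0; exists (g z); exact: H. Qed.

Lemma QS_BB (u : nat -> C R) f : QS u f -> BB f.
Proof.
move=> uf; split; [exact: QS_holH uf|exact: QS_per uf|].
by have [K K0 fK] := QS_bounded uf ltr01; exists 1, K; split.
Qed.

(** Removable singularity at the cusp: the expansion has no negative powers, so growth [o(1/|q|)]
    improves to boundedness. *)
Lemma BB_of_growth1 f : holH f -> per1 f -> growth1 f -> BB f.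
Proof. by move=> fh fp fg; apply: QS_BB (QS_intro fh fp fg). Qed.

Lemma BB_bounded f (y : R) : BB f -> 0 < y -> exists2 K, 0 <= K &
  forall z, y <= Im z -> cabs (f z) <= K.
Proof. by move=> /BB_QS fq; exact: QS_bounded fq. Qed.

Lemma Im_near z w : cabs (w - z) < Im z -> 0 < Im w.
Proof.
have := cabs_Im (w - z); rewrite ImD ImN ler_norml => /andP[h _] H.
by move: h H; lra.
Qed.

Lemma holH_ext f g : (forall z, 0 < Im z -> f z = g z) -> holH f -> holH g.
Proof.
move=> fg fh z z0; have [l fl] := fh z z0; exists l.
by apply: cdv_near z0 _ fl => w /Im_near; exact: fg.
Qed.

Lemma cdv_extH f g z l : (forall z, 0 < Im z -> f z = g z) -> 0 < Im z ->
  cdv f z l -> cdv g z l.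
Proof. by move=> fg z0; apply: cdv_near z0 _ => w /Im_near; exact: fg. Qed.

Lemma Im_add1 z : Im (z + 1) = Im z.
Proof. by rewrite ImD /= addr0. Qed.

Lemma BB_ext f g : (forall z, 0 < Im z -> f z = g z) -> BB f -> BB g.
Proof.
move=> fg [fh fp [y [K [y0 K0 fK]]]]; split; first exact: holH_ext fh.
  by move=> z z0; rewrite -!fg ?fp // Im_add1.
by exists y, K; split=> // z yz; rewrite -fg ?fK // (lt_le_trans y0).
Qed.

Lemma qlim_ext f g a : (forall z, 0 < Im z -> f z = g z) -> qlim f a -> qlim g a.
Proof.
move=> fg [y [K [y0 K0 fK]]]; exists y, K; split=> // z yz.
by rewrite -fg ?fK // (lt_le_trans y0).
Qed.

Lemma BB_cst a : BB (fun=> a).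
Proof.
split; [by move=> z _; eexists; exact: cdv_cst|by []|].
by exists 1, (cabs a); split; rewrite ?cabs_ge0.
Qed.

Lemma BBD f g : BB f -> BB g -> BB (fun z => f z + g z).
Proof.
move=> [fh fp [y [K [y0 K0 fK]]]] [gh gp [y' [K' [y0' K0' gK]]]]; split.
- by move=> z z0; have [l fl] := fh z z0; have [m gm] := gh z z0; eexists; exact: cdvD fl gm.
- by move=> z z0; rewrite fp // gp.
exists (Num.max y y'), (K + K'); split; first by rewrite lt_max y0.
  by rewrite addr_ge0.
by move=> z; rewrite ge_max => /andP[/fK h1 /gK h2]; apply: le_trans (cabsD _ _) (lerD h1 h2).
Qed.

Lemma BBM f g : BB f -> BB g -> BB (fun z => f z * g z).
Proof.
move=> [fh fp [y [K [y0 K0 fK]]]] [gh gp [y' [K' [y0' K0' gK]]]]; split.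
- exact: holHM.
- exact: per1M.
exists (Num.max y y'), (K * K'); split; first by rewrite lt_max y0.
  by rewrite mulr_ge0.
by move=> z; rewrite ge_max cabsM => /andP[/fK h1 /gK h2]; apply: ler_pM; rewrite ?cabs_ge0.
Qed.

Lemma BBZ a f : BB f -> BB (fun z => a * f z).
Proof. exact: (BBM (BB_cst a)). Qed.

Lemma BBB f g : BB f -> BB g -> BB (fun z => f z - g z).
Proof.
move=> fB gB; apply: BB_ext (BBD fB (BBZ (-1) gB)) => z _; by rewrite mulN1r.
Qed.

Lemma BBX f n : BB f -> BB (fun z => f z ^+ n).
Proof.
move=> fB; elim: n => [|n IH]; first exact: BB_cst.
by apply: BB_ext (BBM fB IH) => z _; rewrite exprS.
Qed.

Lemma BB_qq : BB (@qq R 1).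
Proof.
split; [exact: qq_holH|exact: (qq_per1 1)|].
exists 1, 1; split=> // z z1; rewrite cabs_qq -expR0 ler_expR oppr_le0.
by rewrite mulr_ge0 ?(le_trans ler01 z1) // mulr_ge0 // mulr_ge0 // pi_ge0.
Qed.

Lemma qq1_le1 z : 0 < Im z -> cabs (qq 1 z) <= 1.
Proof.
move=> z0; rewrite cabs_qq -expR0 ler_expR oppr_le0.
by rewrite mulr_ge0 ?(ltW z0) // mulr_ge0 // mulr_ge0 // pi_ge0.
Qed.

Lemma QS_qlim (u : nat -> C R) f : QS u f -> qlim f (u 0%N).
Proof.
move=> /QS_tail fq; have [K K0 gK] := QS_bounded fq ltr01.
exists 1, K; split=> // z z1; have := gK z z1.
by rewrite cabsM cabsV ler_pdivrMr // cabs_gt0 qq_neq0.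
Qed.

Lemma BB_qlim f : BB f -> exists a, qlim f a.
Proof. by move=> /BB_QS /QS_qlim; exists (coef f 0). Qed.

Lemma qlim_bounded f a : qlim f a -> exists y K : R, [/\ 0 < y, 0 <= K &
  forall z, y <= Im z -> cabs (f z) <= K].
Proof.
case=> y [K [y0 K0 fK]]; exists y, (K + cabs a); split; rewrite ?addr_ge0 ?cabs_ge0 // => z yz.
rewrite -[f z](subrK a); apply: le_trans (cabsD _ _) _; rewrite lerD2r.
by apply: le_trans (fK z yz) _; rewrite ler_piMr // qq1_le1 // (lt_le_trans y0).
Qed.

Lemma qlim_small f a (e : R) : qlim f a -> 0 < e -> exists2 Y : R, 0 < Y &
  forall z, Y <= Im z -> cabs (f z - a) < e.
Proof.
case=> y [K [y0 K0 fK]] e0; exists (Num.max y (K / e + 1)); first by rewrite lt_max y0.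
move=> z; rewrite ge_max => /andP[yz zK].
have z0 : 0 < Im z by rewrite (lt_le_trans y0).
apply: le_lt_trans (fK z yz) _; rewrite cabs_qq mulr1 expRN ltr_pdivrMr ?expR_gt0 //.
rewrite mulrC -ltr_pdivrMr //; apply: lt_le_trans (le_expR_2pi z0).
by apply: lt_le_trans zK; rewrite ltrDl.
Qed.

Lemma qlim_uniq f a b : qlim f a -> qlim f b -> a = b.
Proof.
move=> fa fb; apply/eqP; rewrite -subr_eq0 -cabs_eq0 eq_le cabs_ge0 andbT.
apply/ler_addgt0Pl => e e0; rewrite addr0.
have e2 : 0 < e / 2 by rewrite divr_gt0.
have [Y1 Y10 H1] := qlim_small fa e2; have [Y2 Y20 H2] := qlim_small fb e2.
pose z : C R := Complex 0 (Num.max Y1 Y2).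
have := H1 z; have := H2 z; rewrite /= !le_max !lexx orbT => /(_ isT) h2 /(_ isT) h1.
rewrite (_ : a - b = (f z - b) - (f z - a)); last by ring.
by apply: le_trans (cabsB _ _) _; rewrite (splitr e) lerD // ltW.
Qed.

Lemma qlim_cst a : qlim (fun=> a) a.
Proof. by exists 1, 0; split=> // z _; rewrite subrr cabs0 mul0r. Qed.

Lemma qlimD f g a b : qlim f a -> qlim g b -> qlim (fun z => f z + g z) (a + b).
Proof.
move=> [y [K [y0 K0 fK]]] [y' [K' [y0' K0' gK]]].
exists (Num.max y y'), (K + K'); split; first by rewrite lt_max y0.
  by rewrite addr_ge0.
move=> z; rewrite ge_max => /andP[/fK h1 /gK h2].
rewrite (_ : _ - _ = (f z - a) + (g z - b)); last by ring.
by rewrite mulrDl; apply: le_trans (cabsD _ _) (lerD h1 h2).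
Qed.

Lemma qlimM f g a b : qlim f a -> qlim g b -> qlim (fun z => f z * g z) (a * b).
Proof.
move=> [y [K [y0 K0 fK]]] gb; have [y2 [M [y20 M0 gM]]] := qlim_bounded gb.
case: gb => y' [K' [y0' K0' gK]].
exists (Num.max y (Num.max y' y2)), (K * M + cabs a * K'); split.
- by rewrite lt_max y0.
- by rewrite addr_ge0 // mulr_ge0 // cabs_ge0.
move=> z; rewrite !ge_max => /andP[/fK h1 /andP[/gK h2 /gM h3]].
rewrite (_ : _ - _ = (f z - a) * g z + a * (g z - b)); last by ring.
rewrite [X in _ <= X]mulrDl; apply: le_trans (cabsD _ _) _; rewrite !cabsM; apply: lerD.
  by rewrite mulrAC; apply: ler_pM; rewrite ?cabs_ge0.
by rewrite -mulrA ler_wpM2l ?cabs_ge0.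
Qed.

Lemma qlimZ c f a : qlim f a -> qlim (fun z => c * f z) (c * a).
Proof. exact: (qlimM (qlim_cst c)). Qed.

Lemma qlimX f a n : qlim f a -> qlim (fun z => f z ^+ n) (a ^+ n).
Proof.
move=> fa; elim: n => [|n IH]; first exact: qlim_cst.
by rewrite exprS; apply: qlim_ext (qlimM fa IH) => z _; rewrite exprS.
Qed.

Lemma qlim_qq : qlim (@qq R 1) 0.
Proof. by exists 1, 1; split=> // z _; rewrite subr0 mul1r. Qed.

Lemma BB_deriv f : BB f -> exists g, [/\ BB g, qlim g 0 &
  forall z, 0 < Im z -> cdv f z (g z)].
Proof.
move=> /BB_QS /QS_deriv [g gq fg]; exists g; split=> //; first exact: QS_BB gq.
by have := QS_qlim gq; rewrite /qderiv !mul0r.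
Qed.

Lemma QS_shift n (u : nat -> C R) f : QS u f -> (forall i, (i < n)%N -> u i = 0) ->
  exists2 h, QS (fun k => u (n + k)%N) h &
   forall z, 0 < Im z -> f z = qq n%:R z * h z.
Proof.
elim: n u f => [|n IH] u f uf u0.
  by exists f => // z _; rewrite qq0 mul1r.
have u00 : u 0%N = 0 by exact: u0.
have [|h hq fh] := IH _ _ (QS_tail uf); first by move=> i ni; exact: u0.
exists h => // z z0; rewrite -natr1 qqD mulrAC -fh // u00 subr0 divfK //.
exact: qq_neq0.
Qed.

Lemma BB_divq f : BB f -> qlim f 0 -> exists2 g, BB g &
  forall z, 0 < Im z -> f z = qq 1 z * g z.
Proof.
move=> fB f0; have fq := BB_QS fB.
have c0 : coef f 0 = 0 by apply: qlim_uniq (QS_qlim fq) f0.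
have [|h hq fh] := @QS_shift 1 _ _ fq; first by case.
by exists h => //; exact: QS_BB hq.
Qed.

(** The order of vanishing at the cusp is finite: if every coefficient were zero, the expansion
    would give [f z0 = 0]. *)
Lemma BB_order f z0 : BB f -> 0 < Im z0 -> f z0 <> 0 -> exists (n : nat) h b,
  [/\ BB h, qlim h b, b != 0 & forall z, 0 < Im z -> f z = qq n%:R z * h z].
Proof.
move=> fB z00 fz0; have fq := BB_QS fB.
have ex : exists n, coef f n != 0.
  apply/not_existsP => H; apply: fz0; apply: clim_uniq (fq.2 z0 z00) _.
  apply: clim_ext (clim_cst 0) => N; rewrite /qsum big1 // => i _.
  by have /negP := H i; rewrite negbK => /eqP ->; rewrite mul0r.
pose n := ex_minn ex.
have [n0 nmin] : coef f n != 0 /\ forall i, (i < n)%N -> coef f i = 0.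
  rewrite /n; case: ex_minnP => m m0 H; split=> // i im.
  by apply/eqP; apply: contraTT im => /H; rewrite -leqNgt.
have [h hq fh] := QS_shift fq nmin.
exists n, h, (coef f n); split=> //; first exact: QS_BB hq.
by have := QS_qlim hq; rewrite addn0.
Qed.

Lemma BB_prim f a : BB f -> qlim f a -> exists L, [/\ BB L, qlim L 0 &
  forall z, 0 < Im z -> cdv L z (f z - a)].
Proof.
move=> fB fa; have fq := BB_QS fB.
have <- : coef f 0 = a by apply: qlim_uniq (QS_qlim fq) fa.
have [b [L [bL b0 Lf]]] := QS_prim fq; exists L; split=> //; first exact: QS_BB bL.
by have := QS_qlim bL; rewrite b0.
Qed.

Lemma BB_inv f b : BB f -> (forall z, 0 < Im z -> f z != 0) -> qlim f b -> b != 0 ->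
  BB (fun z => (f z)^-1) /\ qlim (fun z => (f z)^-1) b^-1.
Proof.
move=> [fh fp _] f0 fb b0.
have b2 : 0 < cabs b / 2 by rewrite divr_gt0 // cabs_gt0.
have [Y Y0 HY] := qlim_small fb b2.
have low z : Y <= Im z -> cabs b / 2 <= cabs (f z).
  move=> /HY H; have := cabs_sub b (- (f z - b)); rewrite cabsN opprK [b + _]addrC subrK.
  by move: H; lra.
have inv_le z : Y <= Im z -> cabs (f z)^-1 <= (cabs b / 2)^-1.
  by move=> /low H; rewrite cabsV lef_pV2 // posrE // (lt_le_trans b2).
split.
  split.
  - move=> z z0; have [l fl] := fh z z0; eexists; exact: cdvV fl (f0 z z0).
  - by move=> z z0; rewrite fp.
  by exists Y, (cabs b / 2)^-1; split=> //; rewrite invr_ge0 ltW.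
case: fb => y [K [y0 K0 fK]].
exists (Num.max y Y), (K * ((cabs b / 2)^-1 * (cabs b)^-1)); split.
- by rewrite lt_max y0.
- by rewrite mulr_ge0 // mulr_ge0 // invr_ge0 ?cabs_ge0 // ltW.
move=> z; rewrite ge_max => /andP[yz Yz].
have fz : f z != 0 by apply: f0; rewrite (lt_le_trans y0).
rewrite (_ : _ - _ = - (f z - b) * ((f z)^-1 * b^-1)); last by field; rewrite b0 fz.
rewrite mulrAC !cabsM cabsN [cabs b^-1]cabsV; apply: ler_pM; rewrite ?mulr_ge0 ?cabs_ge0 //.
  by rewrite invr_ge0 cabs_ge0.
  exact: fK.
by rewrite ler_wpM2r ?invr_ge0 ?cabs_ge0 // inv_le.
Qed.

Lemma BB_cexp L : BB L -> qlim L 0 -> BB (fun z => cexp (L z)) /\ qlim (fun z => cexp (L z)) 1.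
Proof.
move=> LB L0; case: (LB) => Lh Lp [y [K [y0 K0 LK]]]; split.
  split.
  - by move=> z z0; have [l Ll] := Lh z z0; eexists; exact: cdv_comp Ll (cdv_cexp _).
  - by move=> z z0; rewrite Lp.
  exists y, (expR K); split; rewrite ?expR_ge0 // => z /LK H; rewrite cabs_cexp ler_expR.
  by apply: le_trans (ler_norm _) _; apply: le_trans (cabs_Re _) H.
case: L0 => y' [K' [y0' K0' LK']].
exists (Num.max y y'), (2 * expR K * K'); split; first by rewrite lt_max y0.
  by rewrite !mulr_ge0 ?expR_ge0.
move=> z; rewrite ge_max => /andP[/LK h1 /LK']; rewrite subr0 => h2.
apply: le_trans (cexp_sub1_bound _) _; rewrite -!mulrA ler_wpM2l //.
rewrite mulrC; apply: ler_pM; rewrite ?expR_ge0 ?cabs_ge0 //.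
by rewrite ler_expR.
Qed.

Lemma clim_addn (u : nat -> C R) l n : clim u l -> clim (fun N => u (n + N)%N) l.
Proof. by move=> ul e /ul [N0 H]; exists N0 => N NN; apply: H; apply: leq_trans NN (leq_addl _ _). Qed.

Lemma BB_coef_bound f (y K : R) n : BB f -> 0 < y ->
  (forall z, y <= Im z -> cabs (f z) <= K) ->
  cabs (coef f n) <= 2 * K * expR (2 * pi * n%:R * y).
Proof. by case=> fh fp _ y0 fK; apply: coef_bound => // x; apply: fK. Qed.

(** Cauchy's estimate on half-planes: coefficients are bounded at height [y / 4], and the gap up to
    [y] pays for the factor [n] brought by the derivative. *)
Lemma BB_deriv_bound f g z (y K : R) : BB f -> 0 < y -> 0 <= K ->
  (forall z, y / 4 <= Im z -> cabs (f z) <= K) -> y <= Im z ->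
  cdv f z (g z) -> cabs (g z) <= 2 * pi * (2 * K * bigK y).
Proof.
move=> fB y0 K0 fK yz fg.
have fq := BB_QS fB; have [g' gq fg'] := QS_deriv fq.
have z0 : 0 < Im z by exact: lt_le_trans yz.
rewrite (cdv_uniq fg (fg' z z0)).
apply: clim_le (gq.2 z z0) _ => N; apply: qderiv_sum_le => //.
- exact: mulr_ge0.
- by move=> n; apply: BB_coef_bound => //; exact: qs_level.
by apply: le_trans yz; rewrite ler_pdivrMr // ler_pMr // ler1n.
Qed.

Lemma BB_taylor f g z h (y K : R) : BB f -> 0 < y -> 0 <= K ->
  (forall z, y / 4 <= Im z -> cabs (f z) <= K) -> y <= Im z ->
  cdv f z (g z) -> cabs (h z) <= y / 2 ->
  cabs (f (z + h z) - f z - g z * h z) <= 4 * (2 * pi) ^+ 2 * (2 * K * bigK y) * cabs (h z) ^+ 2.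
Proof.
move=> fB y0 K0 fK yz fg hy.
have fq := BB_QS fB; have [g' gq fg'] := QS_deriv fq.
have z0 : 0 < Im z by exact: lt_le_trans yz.
rewrite (cdv_uniq fg (fg' z z0)).
apply: (QS_taylor fq gq) => //; first exact: mulr_ge0.
by move=> n; apply: BB_coef_bound => //; exact: qs_level.
Qed.

(** Weierstrass's theorem. The derivatives form a Cauchy sequence by [BB_deriv_bound], and the
    quadratic remainders of [BB_taylor] have a common constant, so they pass to the limit. *)
Lemma BB_uniform_limit (F : nat -> C R -> C R) f : (forall N, BB (F N)) ->
  (forall y e : R, 0 < y -> 0 < e -> exists N0 : nat, forall N, (N0 <= N)%N ->
     forall z, y <= Im z -> cabs (F N z - f z) <= e) -> BB f.
Proof.
move=> FB Ff.
have fbnd (y : R) : 0 < y -> exists2 K, 0 <= K & exists N0 : nat, forall N, (N0 <= N)%N ->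
    forall z, y <= Im z -> cabs (F N z) <= K /\ cabs (f z) <= K.
  move=> y0; have [N0 HN] := Ff y 1 y0 ltr01.
  have [K K0 FK] := BB_bounded (FB N0) y0.
  have fK z : y <= Im z -> cabs (f z) <= K + 1.
    move=> yz; rewrite -[f z](subrK (F N0 z)) addrC; apply: le_trans (cabsD _ _) _.
    by rewrite cabsC; apply: lerD; [exact: FK|exact: HN].
  exists (K + 2); first by rewrite addr_ge0.
  exists N0 => N NN z yz; split; last by apply: le_trans (fK z yz) _; rewrite lerD2l ler1n.
  rewrite -[F N z](subrK (f z)) addrC (_ : K + 2 = (K + 1) + 1); last by ring.
  by apply: le_trans (cabsD _ _) _; apply: lerD; [exact: fK|exact: HN].
have Fclim z : 0 < Im z -> clim (fun N => F N z) (f z).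
  move=> z0 e e0; have [N0 HN] := Ff _ _ z0 (divr_gt0 e0 (ltr0n _ 2)); exists N0 => N /HN H.
  by apply: le_lt_trans (H z (lexx _)) _; rewrite ltr_pdivrMr // ltr_pMr // ltr1n.
split.
- move=> z z0; set y := Im z in z0.
  have y4 := qs_level z0.
  have [g Fg] : exists g : nat -> C R, forall N, cdv (F N) z (g N).
    have H N : exists l, cdv (F N) z l by case: (FB N) => + _ _; exact.
    by have [g gP] := choice H; exists g.
  have [l gl] : exists l, clim g l.
    apply: cauchy_clim => e e0.
    (* A difference bounded by [2 e'] has a derivative bounded by [8 pi (bigK y) e']; adding 1 to
       [bigK y] keeps the divisor positive. *)
    have D0 : 0 < 8 * pi * (bigK y + 1) :> R.
      by rewrite mulr_gt0 ?ltr_wpDl ?bigK_ge0 // mulr_gt0 // pi_gt0.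
    have [N0 HN] := Ff _ _ y4 (divr_gt0 e0 D0).
    exists N0 => N M NN MM.
    have := @BB_deriv_bound (fun z => F N z - F M z) (fun=> g N - g M) z y
      (e / (8 * pi * (bigK y + 1)) * 2) (BBB (FB N) (FB M)) z0.
    move=> /(_ _ _ (lexx _) _) H; apply: le_trans (H _ _ _) _.
    + by rewrite mulr_ge0 // divr_ge0 // ltW.
    + move=> w yw; rewrite (_ : F N w - F M w = (F N w - f w) - (F M w - f w)); last by ring.
      by rewrite mulr_natr mulr2n; apply: le_trans (cabsB _ _) (lerD (HN N NN w yw) (HN M MM w yw)).
    + exact: cdvB.
    rewrite (_ : _ * _ = e * (bigK y / (bigK y + 1))).
      rewrite ler_piMr ?(ltW e0) // ler_pdivrMr ?ltr_wpDl ?bigK_ge0 // mul1r lerDl //.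
    have B0 : bigK y + 1 != 0 by rewrite gt_eqF // ltr_wpDl ?bigK_ge0.
    by apply: cancel_bound; rewrite ?B0 ?pnatr_eq0 // lt0r_neq0 // pi_gt0.
  exists l.
  have [K K0 [N0 HN]] := fbnd _ y4.
  apply: (@cdv_quadratic _ _ _ _ (y / 2) (4 * (2 * pi) ^+ 2 * (2 * K * bigK y))).
  + by rewrite divr_gt0.
  + by apply: mulr_ge0; [rewrite mulr_ge0 // exprn_even_ge0|apply: mulr_ge0; [rewrite mulr_ge0|exact: bigK_ge0]].
  move=> h hy.
  have zh : 0 < Im (z + h).
    apply: (@Im_near z); rewrite addrC addKr; apply: le_lt_trans hy _.
    by rewrite ltr_pdivrMr // ltr_pMr // ltr1n.
  apply: (@clim_le _ (fun N => F (N0 + N)%N (z + h) - F (N0 + N)%N z - g (N0 + N)%N * h)).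
    apply: climB; first by apply: climB; apply: (@clim_addn (fun N => F N _)); exact: Fclim.
    by rewrite mulrC; apply: clim_ext (clim_scale h (clim_addn N0 gl)) => N; rewrite mulrC.
  move=> N; apply: (@BB_taylor (F (N0 + N)%N) (fun=> g (N0 + N)%N) z (fun=> h) y K) => //.
  by move=> w yw; case: (HN (N0 + N)%N (leq_addr _ _) w yw).
- move=> z z0; have z1 : 0 < Im (z + 1) by rewrite Im_add1.
  apply: clim_uniq (Fclim _ z1) _; apply: clim_ext (Fclim _ z0) => N.
  by case: (FB N) => _ /(_ z z0) -> _.
have [K K0 [N0 HN]] := fbnd 1 ltr01.
by exists 1, K; split=> // z z1; case: (HN N0 (leqnn _) z z1).
Qed.

(* The first [k] coefficients of [f ^+ k] vanish and all are at most [2 * M ^ k], so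
   [|f z0| ^ k <= C * (M * r) ^ k] for every [k]; letting [k] grow removes the constant [C]. *)
Lemma BB_contract f (M : R) z0 : BB f -> qlim f 0 -> 0 < Im z0 -> 0 <= M ->
  (forall z, 0 < Im z -> cabs (f z) <= M) ->
  cabs (f z0) <= expR (- (pi * Im z0 / 4)) * M.
Proof.
move=> fB f0 z00 M0 fM.
move: M0; rewrite le_eqVlt => /predU1P[E|Mp].
  by have := fM z0 z00; rewrite -E mulr0.
pose y := Im z0.
pose s := pi * y / 2.
have s0 : 0 < s by rewrite divr_gt0 // mulr_gt0 // pi_gt0.
have d0 : 0 < 1 - expR (- s) by rewrite subr_gt0 -expR0 ltr_expR oppr_lt0.
have coef0 k n : (n < k)%N -> coef (fun z => f z ^+ k) n = 0.
  move=> nk; apply/eqP; rewrite -cabs_eq0 eq_le cabs_ge0 andbT.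
  case: f0 => y1 [K [y10 K0 fK]].
  apply/ler_addgt0Pl => e e0; rewrite addr0.
  pose Y := Num.max y1 (2 * K ^+ k / e + 1).
  have Y0 : 0 < Y by rewrite lt_max y10.
  apply: (@le_trans _ _ (2 * (K ^+ k * expR (- (2 * pi * k%:R * Y))) * expR (2 * pi * n%:R * Y))).
    case: (BBX k fB) => kh kp _; apply: coef_bound => // x.
    rewrite cabsX (_ : - _ = - (2 * pi * Y) * k%:R); last by ring.
    rewrite expRMn -exprMn lerXn2r ?nnegrE ?cabs_ge0 ?mulr_ge0 ?expR_ge0 //.
    by have := fK (Complex x Y); rewrite /= le_max lexx subr0 cabs_qq mulr1; exact.
  rewrite -!mulrA -expRD mulrA.
  apply: (@le_trans _ _ (2 * K ^+ k * expR (- (2 * pi * Y)))).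
    rewrite ler_wpM2l ?mulr_ge0 ?exprn_ge0 // ler_expR.
    rewrite (_ : - _ + _ = - (2 * pi * Y) * (k%:R - n%:R)); last by ring.
    rewrite !mulNr lerN2 ler_peMr ?mulr_ge0 ?(ltW Y0) ?pi_ge0 //.
    by rewrite lerBrDr addrC natr1 ler_nat.
  rewrite expRN ler_pdivrMr ?expR_gt0 // -ler_pdivrMl // mulrC.
  apply: le_trans (le_expR_2pi Y0); rewrite /Y le_max; apply/orP; right.
  by rewrite mulrC lerDl.
have s2 : 0 < s / 2 by rewrite divr_gt0.
have [N0 /(_ N0 (leqnn _))] := expRN_small (2 / (1 - expR (- s))) s2 ltr01.
set k := N0 => kP.
rewrite leNgt; apply/negP => big.
have low : expR (- (s / 2 * k%:R)) * M ^+ k <= cabs (f z0) ^+ k.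
  rewrite -mulNr expRMn -exprMn lerXn2r ?nnegrE ?cabs_ge0 ?mulr_ge0 ?expR_ge0 ?(ltW Mp) //.
  by apply: le_trans (ltW big); rewrite le_eqVlt; apply/orP; left; apply/eqP; congr (expR _ * _); rewrite /s /y; field.
have : cabs (f z0) ^+ k <= 2 * M ^+ k * expR (- (s * k%:R)) * (1 - expR (- s))^-1.
  rewrite -[X in X <= _]cabsX; have fkq := BB_QS (BBX k fB).
  apply: clim_le (fkq.2 z0 z00) _ => N.
  apply: le_trans (ler_wpM2l _ (geo_sum_le N s0)); last first.
    by rewrite mulr_ge0 ?expR_ge0 // mulr_ge0 // exprn_ge0 // ltW.
  rewrite mulr_sumr; apply: csum_le => n.
  have [nk|kn] := ltnP n k.
    rewrite coef0 // mul0r cabs0.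
    by do 3! [apply: mulr_ge0; rewrite ?expR_ge0 //]; rewrite exprn_ge0 // ltW.
  have y2 : 0 < y / 2 by rewrite divr_gt0.
  rewrite cabsM cabs_qq.
  apply: (@le_trans _ _ (2 * M ^+ k * expR (2 * pi * n%:R * (y / 2)) * expR (- (2 * pi * n%:R * y)))).
    rewrite ler_wpM2r ?expR_ge0 //.
    case: (BBX k fB) => kh kp _; apply: coef_bound => // x.
    by rewrite cabsX lerXn2r ?nnegrE ?cabs_ge0 ?(ltW Mp) // fM.
  rewrite -!mulrA ler_wpM2l // ler_wpM2l ?exprn_ge0 ?(ltW Mp) // -!expRD ler_expR.
  rewrite (_ : _ + - _ = - (s * n%:R) - s * n%:R); last by rewrite /s; field.
  rewrite [X in _ <= X](_ : _ = - (s * k%:R) - s * n%:R); last by rewrite /s; field.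
  by rewrite lerD2r lerN2 ler_wpM2l ?(ltW s0) // ler_nat.
apply/negP; rewrite -ltNge; apply: lt_le_trans low.
rewrite (_ : _ * _ = expR (- (s / 2 * k%:R)) * M ^+ k *
    (2 / (1 - expR (- s)) * expR (- (s / 2 * k%:R)))).
  by rewrite -[X in _ < X]mulr1 ltr_pM2l // mulr_gt0 ?expR_gt0 ?exprn_gt0.
have -> : expR (- (s * k%:R)) = expR (- (s / 2 * k%:R)) * expR (- (s / 2 * k%:R)).
  by rewrite -expRD; congr expR; field.
by field; rewrite gt_eqF.
Qed.

End BoundedPeriodic.

(** * The eta product *)

Section EtaProduct.
Variable R : realType.
Implicit Types (z : C R).

Definition phiN (N : nat) z : C R := \prod_(1 <= m < N.+1) (1 - qq 1 z ^+ m).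

Lemma phiN0 z : phiN 0 z = 1. Proof. by rewrite /phiN big_geq. Qed.
Lemma phiNS N z : phiN N.+1 z = phiN N z * (1 - qq 1 z ^+ N.+1).
Proof. by rewrite /phiN big_nat_recr. Qed.

Lemma phiN_BB N : BB (phiN N).
Proof.
elim: N => [|N IH]; first by apply: BB_ext (BB_cst 1) => z _; rewrite phiN0.
apply: BB_ext (BBM IH (BBB (BB_cst 1) (BBX N.+1 (@BB_qq R)))) => z _.
by rewrite phiNS.
Qed.

Section AtHeight.
Variable y : R.
Hypothesis y0 : 0 < y.
Let s := 2 * pi * y.
Let s0 : 0 < s. Proof. by rewrite !mulr_gt0 // pi_gt0. Qed.
(** The sum of the geometric series of [|q|^n] at height [y]. It controls the product from above
    through [1 + x <= e^x] and from below through [one_sub_ge]. *)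
Let D := (1 - expR (- s))^-1.
Let r1 : expR (- s) < 1. Proof. by rewrite -expR0 ltr_expR oppr_lt0. Qed.
Let D1 : 1 <= D. Proof. by rewrite /D invf_ge1 ?subr_gt0 // gerBl expR_ge0. Qed.
Let D0 : 0 <= D. Proof. exact: le_trans D1. Qed.

Lemma qX_le z m : y <= Im z -> cabs (qq 1 z ^+ m) <= expR (- (s * m%:R)).
Proof.
move=> yz; rewrite -mulNr expRMn cabsX lerXn2r ?nnegrE ?cabs_ge0 ?expR_ge0 //.
by rewrite cabs_qq mulr1 ler_expR lerN2 ler_wpM2l // mulr_ge0 // pi_ge0.
Qed.

Lemma phiN_le z N : y <= Im z ->
  cabs (phiN N z) <= expR (\sum_(m < N) expR (- (s * m%:R))).
Proof.
move=> yz; elim: N => [|N IH]; first by rewrite phiN0 big_ord0 expR0 cabs1.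
rewrite phiNS cabsM big_ord_recr /= expRD; apply: ler_pM; rewrite ?cabs_ge0 //.
apply: le_trans (expR_ge1Dx _); apply: le_trans (cabsB _ _) _; rewrite cabs1 lerD2l.
apply: le_trans (qX_le _ yz) _; rewrite ler_expR lerN2 ler_wpM2l ?(ltW s0) // ler_nat.
exact: leqnSn.
Qed.

(** Invert [1 / (1 - x) = 1 + x / (1 - x) <= exp (x / (1 - x))]. This keeps the partial products
    away from zero, uniformly in their length, so that the limit has no zero. *)
Lemma one_sub_ge (x : R) : 0 <= x -> x <= expR (- s) -> expR (- (D * x)) <= 1 - x.
Proof.
move=> x0 xr; have x1 : 0 < 1 - x by rewrite subr_gt0 (le_lt_trans xr).
rewrite expRN -[X in _ <= X]invrK lef_pV2 ?posrE ?expR_gt0 ?invr_gt0 //.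
apply: (@le_trans _ _ (1 + x / (1 - x))).
  by rewrite le_eqVlt; apply/orP; left; apply/eqP; field; rewrite gt_eqF.
apply: le_trans (expR_ge1Dx _) _; rewrite ler_expR mulrC ler_wpM2r //.
have H : 1 - expR (- s) <= 1 - x by rewrite lerD2l lerN2.
by rewrite /D lef_pV2 // posrE ?subr_gt0 // (le_lt_trans xr).
Qed.

Lemma phiN_ge z N : y <= Im z ->
  expR (- (D * \sum_(m < N) expR (- (s * m%:R)))) <= cabs (phiN N z).
Proof.
move=> yz; elim: N => [|N IH]; first by rewrite phiN0 big_ord0 mulr0 oppr0 expR0 cabs1.
rewrite phiNS cabsM big_ord_recr /= mulrDr opprD expRD.
apply: ler_pM; rewrite ?expR_ge0 //.
apply: (@le_trans _ _ (1 - cabs (qq 1 z ^+ N.+1))); last first.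
  by have := cabs_sub 1 (qq 1 z ^+ N.+1); rewrite cabs1.
have qN : cabs (qq 1 z ^+ N.+1) <= expR (- (s * N.+1%:R)) by exact: qX_le.
apply: le_trans (one_sub_ge (cabs_ge0 _) _).
  rewrite ler_expR lerN2 ler_wpM2l //; apply: le_trans qN _.
  by rewrite ler_expR lerN2 ler_wpM2l ?(ltW s0) // ler_nat.
by apply: le_trans qN _; rewrite ler_expR lerN2 ler_peMr ?(ltW s0) // ler1n.
Qed.

Lemma phiN_bound z N : y <= Im z -> cabs (phiN N z) <= expR D.
Proof.
move=> yz; apply: le_trans (phiN_le N yz) _; rewrite ler_expR; exact: geo_sum_le.
Qed.

Lemma phiN_lower z N : y <= Im z -> expR (- (D * D)) <= cabs (phiN N z).
Proof.
move=> yz; apply: le_trans (phiN_ge N yz); rewrite ler_expR lerN2 ler_wpM2l //.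
exact: geo_sum_le.
Qed.

(** The factor [|q|] stays separate from the geometric decay in [N]; it provides the rate [O(|q|)]
    in [phi_qlim]. *)
Lemma phiN_step z N : y <= Im z ->
  cabs (phiN N.+1 z - phiN N z) <= expR D * cabs (qq 1 z) * expR (- (s * N%:R)).
Proof.
move=> yz; rewrite phiNS (_ : _ - _ = - (phiN N z * (qq 1 z * qq 1 z ^+ N))); last first.
  by rewrite exprS; ring.
rewrite cabsN 2!cabsM mulrA; apply: ler_pM; rewrite ?mulr_ge0 ?cabs_ge0 ?qX_le //.
by rewrite ler_wpM2r ?cabs_ge0 // phiN_bound.
Qed.

Lemma phiN_telescope z N M : \sum_(k < M) (phiN (N + k).+1 z - phiN (N + k) z) = phiN (N + M) z - phiN N z.
Proof.
elim: M => [|M IH]; first by rewrite big_ord0 addn0 subrr.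
by rewrite big_ord_recr IH /= addnS; ring.
Qed.

Lemma phiN_diff z N M : y <= Im z ->
  cabs (phiN (N + M) z - phiN N z) <= expR D * cabs (qq 1 z) * expR (- (s * N%:R)) * D.
Proof.
move=> yz; rewrite -phiN_telescope.
apply: le_trans (ler_wpM2l _ (geo_sum_le M s0)); last first.
  by rewrite !mulr_ge0 ?expR_ge0 ?cabs_ge0.
rewrite mulr_sumr; apply: csum_le => k; apply: le_trans (phiN_step _ yz) _.
by rewrite -[X in _ <= X]mulrA -expRD natrD mulrDr opprD.
Qed.

End AtHeight.

Lemma phiN_cvg z : exists l, 0 < Im z -> clim (fun N => phiN N z) l.
Proof.
have [z0|_] := boolP (0 < Im z); last by exists 0.
have s0 : 0 < 2 * pi * Im z by rewrite !mulr_gt0 // pi_gt0.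
have [l Hl] := series_clim s0 (fun N => phiN_step z0 N (lexx (Im z))).
exists (l + 1) => _; apply: clim_ext (climD Hl (clim_cst 1)) => N.
by have := phiN_telescope z 0 N; rewrite /= phiN0 => ->; rewrite subrK.
Qed.

Definition phi : C R -> C R := projT1 (choice phiN_cvg).

Lemma phiP z : 0 < Im z -> clim (fun N => phiN N z) (phi z).
Proof. exact: (projT2 (choice phiN_cvg) z). Qed.

Lemma phi_diff (y : R) z N : 0 < y -> y <= Im z ->
  cabs (phi z - phiN N z) <= expR (1 - expR (- (2 * pi * y)))^-1 * cabs (qq 1 z)
    * expR (- (2 * pi * y * N%:R)) * (1 - expR (- (2 * pi * y)))^-1.
Proof.
move=> y0 yz; have z0 : 0 < Im z by exact: lt_le_trans yz.
apply: clim_le (climB (clim_addn N (phiP z0)) (clim_cst (phiN N z))) _ => M.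
exact: phiN_diff.
Qed.

Lemma phi_BB : BB phi.
Proof.
apply: BB_uniform_limit phiN_BB _ => y e y0 e0.
have s0 : 0 < 2 * pi * y by rewrite !mulr_gt0 // pi_gt0.
set D := (1 - expR (- (2 * pi * y)))^-1.
have D0 : 0 <= D by rewrite invr_ge0 subr_ge0 -[X in _ <= X]expR0 ler_expR oppr_le0 ltW.
have [N0 HN] := expRN_small (expR D * D) s0 e0; exists N0 => N NN z yz.
rewrite cabsC; apply: le_trans (phi_diff N y0 yz) _; rewrite -/D.
apply: le_trans (ltW (HN N NN)); rewrite mulrAC ler_wpM2r ?expR_ge0 //.
rewrite mulrAC ler_piMr ?mulr_ge0 ?expR_ge0 // qq1_le1 //.
exact: lt_le_trans yz.
Qed.

Lemma phi_qlim : qlim phi 1.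
Proof.
have s0 : 0 < 2 * pi * 1 :> R by rewrite !mulr_gt0 // pi_gt0.
set D := (1 - expR (- (2 * pi * 1)))^-1 : R.
have D0 : 0 <= D by rewrite invr_ge0 subr_ge0 -[X in _ <= X]expR0 ler_expR oppr_le0 ltW.
exists 1, (expR D * D); split; rewrite ?mulr_ge0 ?expR_ge0 // => z z1.
have := phi_diff 0 ltr01 z1; rewrite phiN0 mulr0 oppr0 expR0 mulr1.
by rewrite mulrAC.
Qed.

Lemma phi_neq0 z : 0 < Im z -> phi z != 0.
Proof.
move=> z0; apply/eqP => E.
have [N0 /(_ N0 (leqnn _))] := phiP z0 (expR_gt0 (- ((1 - expR (- (2 * pi * Im z)))^-1 *
  (1 - expR (- (2 * pi * Im z)))^-1))).
by rewrite E subr0 ltNge phiN_lower.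
Qed.

Lemma clim_limn (u : nat -> C R) l : clim u l -> limn (u : nat -> (C R)^o) = l.
Proof.
move=> ul; apply: (@cvg_lim (C R)^o); first exact: norm_hausdorff.
apply/cvgrPdistC_lt => /= e e0.
have [er ei] : 0 < Re e /\ e = Cr (Re e).
  by move: e0; case: e => a b; rewrite ltcE /= => /andP[/eqP-> ].
have [N0 HN] := ul _ er; exists N0 => // N /= /HN H.
by rewrite cabs_norm ei ltcE /= eqxx.
Qed.

Lemma etaE z : 0 < Im z -> Defs.eta z = qq 24^-1 z * phi z.
Proof.
move=> z0; rewrite /Defs.eta; apply: clim_limn.
apply: clim_ext (clim_scale (qq 24^-1 z) (phiP z0)) => N.
congr (_ * _); last by apply: eq_bigr => m _; rewrite qexp_qq.
by rewrite /qq CrM CrV Cr_nat; congr cexp; ring.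
Qed.

Lemma Pfun_BB : BB (@Defs.Pfun R) /\ qlim (@Defs.Pfun R) (- 12^-1).
Proof.
have [g [gB g0 phig]] := BB_deriv phi_BB.
have [iB ilim] := BB_inv phi_BB phi_neq0 phi_qlim (oner_neq0 _).
pose c := iC R / Cr pi.
have PE z : 0 < Im z -> - 12^-1 + c * (g z * (phi z)^-1) = Defs.Pfun z.
  move=> z0; rewrite /Defs.Pfun z0.
  have dE := cdv_extH (fun w w0 => esym (etaE w0)) z0 (cdvM (cdv_qq 24^-1 z) (phig z z0)).
  rewrite (cdv_cderiv dE) etaE // -/c.
  (* The contribution of the factor [q^(1/24)] of [eta]: [(i / pi) (2 pi i / 24) = -1/12]. *)
  have -> : (- 12^-1 : C R) = c * (Cr 24^-1 * twopii R).
    rewrite /c /twopii CrV Cr_nat CrM Cr_nat.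
    have p0 : Cr pi != 0 :> C R by rewrite Cr_eq0 gt_eqF // pi_gt0.
    have -> : iC R / Cr pi * (24^-1 * (2 * Cr pi * iC R)) = (iC R * iC R) / 12.
      by field; rewrite p0.
    by rewrite iC_sqr mulN1r.
  by field; rewrite phi_neq0 // qq_neq0.
split; first by apply: BB_ext PE (BBD (BB_cst _) (BBZ c (BBM gB iB))).
have := qlimD (qlim_cst (- 12^-1 : C R)) (qlimZ c (qlimM g0 ilim)).
by rewrite mul0r mulr0 addr0; apply: qlim_ext.
Qed.

End EtaProduct.

(** * The modular group and principal powers *)

Section ModularGroup.

Definition mk22 (a b c d : int) : 'M[int]_2 :=
  \matrix_(i < 2, j < 2) (if i == i0 then if j == i0 then a else b else if j == i0 then c else d).

Lemma ord2P (P : 'I_2 -> Prop) : P i0 -> P i1 -> forall i, P i.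
Proof.
move=> h0 h1 i; case: i => [[|[|//]] lt].
  by rewrite (_ : Ordinal lt = i0) //; exact: val_inj.
by rewrite (_ : Ordinal lt = i1) //; exact: val_inj.
Qed.

Lemma sum2 (V : nmodType) (F : 'I_2 -> V) : \sum_i F i = F i0 + F i1.
Proof. by rewrite big_ord_recr big_ord_recr big_ord0 /= add0r; congr (F _ + F _); exact: val_inj. Qed.

Lemma mk22_eta (g : 'M[int]_2) : g = mk22 (g i0 i0) (g i0 i1) (g i1 i0) (g i1 i1).
Proof. by apply/matrixP; apply: ord2P; apply: ord2P; rewrite !mxE. Qed.

Lemma mk22_mul (a b c d a' b' c' d' : int) : mk22 a b c d *m mk22 a' b' c' d' =
  mk22 (a * a' + b * c') (a * b' + b * d') (c * a' + d * c') (c * b' + d * d').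
Proof. by apply/matrixP; apply: ord2P; apply: ord2P; rewrite !mxE sum2 !mxE. Qed.

Lemma det2 (F : comNzRingType) (g : 'M[F]_2) : \det g = g i0 i0 * g i1 i1 - g i0 i1 * g i1 i0.
Proof.
rewrite (expand_det_row _ i0) sum2 /cofactor !det_mx11 !mxE /= expr0 expr1 mul1r mulN1r mulrN.
by congr (_ * g _ _ - _ * g _ _); exact: val_inj.
Qed.

Lemma isSL2_mk (a b c d : int) : isSL2 (mk22 a b c d) <-> a * d - b * c = 1.
Proof. by rewrite /isSL2 det2 !mxE. Qed.

Lemma isSL2M g s : isSL2 g -> isSL2 s -> isSL2 (g *m s).
Proof. by rewrite /isSL2 det_mulmx => -> ->. Qed.

Lemma isSL2_1 : isSL2 1%:M. Proof. exact: det1. Qed.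

Definition Sm := mk22 0 (-1) 1 0.
Definition Tn (n : int) := mk22 1 n 0 1.

Lemma SL2_S : isSL2 Sm. Proof. by apply/isSL2_mk. Qed.
Lemma SL2_Tn n : isSL2 (Tn n). Proof. by apply/isSL2_mk; ring. Qed.
Lemma TmE : Tm = Tn 1.
Proof. by apply/matrixP; apply: ord2P; apply: ord2P; rewrite !mxE. Qed.
Lemma SL2_T : isSL2 Tm. Proof. by rewrite TmE; exact: SL2_Tn. Qed.

Section Generation.
Variable Q : 'M[int]_2 -> Prop.
Hypothesis Q1 : Q 1%:M.
Hypothesis QT : forall g, isSL2 g -> Q g -> Q (Tm *m g).
Hypothesis QS : forall g, isSL2 g -> Q g -> Q (Sm *m g).

(** Closure is assumed only for left multiplication by [S] and [T]; the relation
    [(S T)^3 = S^2 = -1] writes the inverse of [T] as a word in them without inverses. *)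
Lemma gen_Ti g : isSL2 g -> Q g -> Q (Tn (-1) *m g).
Proof.
move=> gs Qg.
have -> : Tn (-1) *m g = Sm *m (Sm *m (Sm *m (Tm *m (Sm *m (Tm *m (Sm *m g)))))).
  by rewrite TmE (mk22_eta g) /Sm /Tn !mk22_mul; congr mk22; ring.
have [hS hT] := (SL2_S, SL2_T).
by do ! [apply: QS || apply: QT || apply: isSL2M => //].
Qed.

Lemma gen_Tn n g : isSL2 g -> Q g -> Q (Tn n *m g).
Proof.
move=> gs Qg.
have TnD p q (h : 'M[int]_2) : Tn (p + q) *m h = Tn p *m (Tn q *m h).
  by rewrite (mk22_eta h) /Tn !mk22_mul; congr mk22; ring.
have T0 (h : 'M[int]_2) : Tn 0 *m h = h by rewrite (mk22_eta h) /Tn !mk22_mul; congr mk22; ring.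
have pos (k : nat) : Q (Tn k%:Z *m g).
  elim: k => [|k IH]; first by rewrite T0.
  have -> : Tn k.+1%:Z *m g = Tm *m (Tn k%:Z *m g).
    by rewrite TmE -TnD; congr (Tn _ *m _); lia.
  by apply: QT => //; apply: isSL2M => //; exact: SL2_Tn.
have neg (k : nat) : Q (Tn (- k%:Z) *m g).
  elim: k => [|k IH]; first by rewrite oppr0 T0.
  have -> : Tn (- k.+1%:Z) *m g = Tn (-1) *m (Tn (- k%:Z) *m g).
    by rewrite -TnD; congr (Tn _ *m _); lia.
  by apply: gen_Ti => //; apply: isSL2M => //; exact: SL2_Tn.
by case: n => k; [exact: pos|rewrite NegzE; exact: neg].
Qed.

Lemma gen_cancel (h : 'M[int]_2) : Sm *m (Sm *m (Sm *m (Sm *m h))) = h.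
Proof. by rewrite (mk22_eta h) /Sm !mk22_mul; congr mk22; ring. Qed.

(** Euclid's algorithm on the first column: [S T^(-q)] replaces the lower left entry [c] by the
    remainder of [a] modulo [c]. When [c = 0] the diagonal is [1, 1] or [-1, -1], and [-1 = S^2]. *)
Lemma SL2_gen g : isSL2 g -> Q g.
Proof.
have [n] := ubnP `|g i1 i0|%N; elim: n g => // n IH g; rewrite ltnS => gn gs.
have dg : g i0 i0 * g i1 i1 - g i0 i1 * g i1 i0 = 1 by rewrite -det2.
set a := g i0 i0 in dg *; set b := g i0 i1 in dg *.
set c := g i1 i0 in dg gn *; set d := g i1 i1 in dg *.
have [c0|c0] := eqVneq c 0.
  have ad : a * d = 1 by move: dg; rewrite c0 mulr0 subr0.
  have QI : Q (Sm *m (Sm *m 1%:M)).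
    by do 2! [apply: QS; first by [exact: isSL2_1|apply: isSL2M; [exact: SL2_S|exact: isSL2_1]]].
  have [a1|a1] : a = 1 \/ a = -1.
    have : a \is a GRing.unit by apply/unitrPr; exists d.
    by move=> /orP[/eqP|/eqP]; auto.
  - have d1 : d = 1 by move: ad; rewrite a1 mul1r.
    have -> : g = Tn b *m 1%:M.
      by rewrite mulmx1 (mk22_eta g) -/a -/b -/c -/d a1 d1 c0.
    by apply: gen_Tn => //; exact: isSL2_1.
  have d1 : d = -1 by move: ad; rewrite a1 mulN1r => /(congr1 (@GRing.opp _)); rewrite opprK.
  have -> : g = Tn (- b) *m (Sm *m (Sm *m 1%:M)).
    by rewrite mulmx1 (mk22_eta g) -/a -/b -/c -/d a1 d1 c0 /Sm /Tn !mk22_mul; congr mk22; ring.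
  have [hS h1] := (SL2_S, isSL2_1).
  by apply: gen_Tn => //; do 2! [apply: isSL2M => //].
pose q := (a %/ c)%Z.
pose h := Sm *m (Tn (- q) *m g).
have hs : isSL2 h by exact: isSL2M SL2_S (isSL2M (SL2_Tn _) gs).
have hE : h i1 i0 = (a %% c)%Z.
  rewrite /h (mk22_eta g) /Sm /Tn !mk22_mul !mxE /= -/a -/c.
  by rewrite [in RHS]/modz -/q; ring.
have Qh : Q h.
  apply: IH => //; rewrite hE; apply: leq_trans gn.
  have := ltz_pmod a (_ : 0 < `|c|%:Z); rewrite modz_abs => H.
  have := modz_ge0 a c0; have {}H : (a %% c)%Z < `|c|%:Z by apply: H; rewrite ltz_nat absz_gt0.
  by move: H; clear; lia.
have -> : g = Tn q *m (Sm *m (Sm *m (Sm *m h))).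
  by rewrite /h gen_cancel (mk22_eta g) /Tn !mk22_mul; congr mk22; ring.
have hS := SL2_S.
have s1 := isSL2M hS hs; have s2 := isSL2M hS s1; have s3 := isSL2M hS s2.
by apply: gen_Tn => //; apply: QS => //; apply: QS => //; apply: QS.
Qed.

End Generation.
End ModularGroup.

(** * Moebius transformations and reduction to bounded height *)

Section Moebius.
Variable R : realType.
Implicit Types (z w : C R) (g s : 'M[int]_2).

Lemma intC_Cr n : intC R n = Cr n%:~R. Proof. by rewrite Cr_int. Qed.
Lemma intCD n m : intC R (n + m) = intC R n + intC R m. Proof. exact: intrD. Qed.
Lemma intCM n m : intC R (n * m) = intC R n * intC R m. Proof. exact: intrM. Qed.

Lemma Im_jfac g z : Im (jfac g z) = (g i1 i0)%:~R * Im z.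
Proof. by rewrite /jfac !intC_Cr ImD ImCrM /= addr0. Qed.
Lemma Re_jfac g z : Re (jfac g z) = (g i1 i0)%:~R * Re z + (g i1 i1)%:~R.
Proof. by rewrite /jfac !intC_Cr ReD ReCrM /=. Qed.

Lemma jfac_neq0 g z : isSL2 g -> 0 < Im z -> jfac g z != 0.
Proof.
move=> gs z0; rewrite eq_complex Im_jfac Re_jfac /=.
have [c0|c0] := eqVneq (g i1 i0) 0; last first.
  by rewrite negb_and mulf_eq0 intr_eq0 (negbTE c0) (gt_eqF z0) orbT.
rewrite c0 mul0r add0r mul0r eqxx andbT intr_eq0.
by apply/eqP => d0; move: gs; rewrite /isSL2 det2 c0 d0 !mulr0 subrr.
Qed.

Lemma det_intC g : isSL2 g ->
  intC R (g i0 i0) * intC R (g i1 i1) - intC R (g i0 i1) * intC R (g i1 i0) = 1.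
Proof.
by rewrite /isSL2 det2 => /(congr1 (fun n => intC R n)); rewrite /intC intrB !intrM => ->.
Qed.

Lemma Im_mob g z : isSL2 g -> 0 < Im z ->
  Im (mob g z) = Im z / cabs (jfac g z) ^+ 2.
Proof.
move=> gs z0; have j0 := jfac_neq0 gs z0.
have ca : cabs (jfac g z) ^+ 2 != 0 by rewrite expf_eq0 /= cabs_eq0.
have E : mob g z * jfac g z = intC R (g i0 i0) * z + intC R (g i0 i1) by rewrite /mob divfK.
have := congr1 (@Re R) E; have := congr1 (@Im R) E.
rewrite ReM ImM !Im_jfac !Re_jfac !intC_Cr ReD ImD ReCrM ImCrM /= addr0.
have : (g i0 i0)%:~R * (g i1 i1)%:~R - (g i0 i1)%:~R * (g i1 i0)%:~R = 1 :> R.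
  by move: gs; rewrite /isSL2 det2 => /(congr1 (fun n : int => n%:~R : R)); rewrite intrB !intrM => ->.
move: ca; rewrite cabs_sqr Im_jfac Re_jfac => ca.
move: ca; set a := (g i0 i0)%:~R; set b := (g i0 i1)%:~R; set c := (g i1 i0)%:~R; set d := (g i1 i1)%:~R.
set x := Re z; set y := Im z; set p := Re _; set q := Im _.
move=> ca dt e1 e2; apply: (mulIf ca); rewrite divfK //.
have -> : q * ((c * x + d) ^+ 2 + (c * y) ^+ 2) =
  (p * (c * y) + q * (c * x + d)) * (c * x + d) - (p * (c * x + d) - q * (c * y)) * (c * y) by ring.
by rewrite e1 e2 -[RHS]mul1r -dt; ring.
Qed.

Lemma mob_H g z : isSL2 g -> 0 < Im z -> 0 < Im (mob g z).
Proof.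
by move=> gs z0; rewrite Im_mob // divr_gt0 // exprn_gt0 // cabs_gt0 jfac_neq0.
Qed.

Lemma jfacM g s z : isSL2 s -> 0 < Im z ->
  jfac (g *m s) z = jfac g (mob s z) * jfac s z.
Proof.
move=> ss z0; have j0 := jfac_neq0 ss z0.
rewrite mulrDl /mob {1}/jfac !mxE !sum2 !intCD !intCM -mulrA divfK //.
by rewrite /jfac; ring.
Qed.

Lemma mobM g s z : isSL2 g -> isSL2 s -> 0 < Im z ->
  mob (g *m s) z = mob g (mob s z).
Proof.
move=> gs ss z0; have j0 := jfac_neq0 ss z0.
have jj := jfac_neq0 gs (mob_H ss z0).
set w := mob s z in jj *.
have wE : w * jfac s z = intC R (s i0 i0) * z + intC R (s i0 i1) by rewrite /w /mob divfK.
have numE : intC R ((g *m s) i0 i0) * z + intC R ((g *m s) i0 i1) =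
    (intC R (g i0 i0) * w + intC R (g i0 i1)) * jfac s z.
  have -> : (intC R (g i0 i0) * w + intC R (g i0 i1)) * jfac s z =
     intC R (g i0 i0) * (w * jfac s z) + intC R (g i0 i1) * jfac s z by ring.
  by rewrite !mxE !sum2 !intCD !intCM wE /jfac; ring.
by rewrite [LHS]/mob numE jfacM // -/w [RHS]/mob -mulf_div divff // mulr1.
Qed.

Lemma mob1 z : mob 1%:M z = z.
Proof. by rewrite /mob /jfac !mxE /= /intC /= !mulr0z !mulr1z !mul0r !add0r addr0 mul1r divr1. Qed.

Lemma mob_T z : mob Tm z = z + 1.
Proof. by rewrite TmE /mob /jfac /Tn !mxE /= /intC /= mulr0z !mulr1z mul0r add0r mul1r divr1. Qed.
Lemma jfac_T z : jfac Tm z = 1.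
Proof. by rewrite TmE /jfac /Tn !mxE /= /intC /= mulr0z !mulr1z mul0r add0r. Qed.
Lemma mob_Tn n z : mob (Tn n) z = z + n%:~R.
Proof. by rewrite /mob /jfac /Tn !mxE /= /intC /= mulr0z !mulr1z mul0r add0r mul1r divr1. Qed.
Lemma mob_S z : mob Sm z = - z^-1.
Proof. by rewrite /mob /jfac /Sm !mxE /= /intC /= mulr0z !mulr1z mul0r addr0 add0r mul1r mulNr mul1r. Qed.
Lemma jfac_S z : jfac Sm z = z.
Proof. by rewrite /jfac /Sm !mxE /= /intC /= mulr0z !mulr1z addr0 mul1r. Qed.

Lemma cdv_jfac g z : cdv (jfac g) z (intC R (g i1 i0)).
Proof.
by apply: cdv_eq (cdvD (cdv_cstM _ (cdv_id z)) (cdv_cst _ z)) _; rewrite mulr1 addr0.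
Qed.

Lemma cdv_mob g z : isSL2 g -> 0 < Im z -> cdv (mob g) z ((jfac g z) ^- 2).
Proof.
move=> gs z0; have j0 := jfac_neq0 gs z0.
have N := cdvD (cdv_cstM (intC R (g i0 i0)) (cdv_id z)) (cdv_cst (intC R (g i0 i1)) z).
apply: cdv_eq (cdv_div N (cdv_jfac g z) j0) _.
rewrite [X in X / _](_ : _ = intC R (g i0 i0) * intC R (g i1 i1)
  - intC R (g i0 i1) * intC R (g i1 i0)); last by rewrite /jfac; ring.
by rewrite det_intC // mul1r.
Qed.

(** Below height 1/2, a translation brings the point to [|Re| <= 1/2], hence to modulus squared at
    most 1/2, and then [S] at least doubles the imaginary part. Finitely many doublings suffice, and
    no fundamental domain is needed. *)
Lemma reduction z : 0 < Im z -> exists g, isSL2 g /\ 2^-1 <= Im (mob g z).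
Proof.
move=> z0; have [n] : exists n, 2^-1 / 2 ^+ n < Im z by exact: pow2_large.
elim: n z z0 => [|n IH] z z0 nz.
  by exists 1%:M; split; [exact: isSL2_1|rewrite mob1 ltW // -[2^-1]divr1 -(expr0 (2 : R))].
have [z2|z2] := leP 2^-1 (Im z).
  by exists 1%:M; split; [exact: isSL2_1|rewrite mob1].
have [k /andP[k0 k1]] := frac_part (Re z + 2^-1).
pose w := mob (Tn (- k)) z.
have w0 : 0 < Im w by apply: mob_H => //; exact: SL2_Tn.
have wI : Im w = Im z by rewrite /w mob_Tn Im_add_int.
have wR : Re w = Re z - k%:~R by rewrite /w mob_Tn intrN -Cr_int ReD ReN.
have wabs : cabs w ^+ 2 <= 2^-1.
  rewrite cabs_sqr wI wR; have x1 : `|Re z - k%:~R| <= 2^-1.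
    by rewrite ler_norml; move: k0 k1; lra.
  have y1 : `|Im z| <= 2^-1 by rewrite ger0_norm ltW.
  have sq (t : R) : `|t| <= 2^-1 -> t ^+ 2 <= 2^-1 ^+ 2.
    by move=> t2; rewrite -(real_normK (num_real t)) lerXn2r ?nnegrE // invr_ge0.
  by apply: le_trans (lerD (sq _ x1) (sq _ y1)) _; lra.
have w1 : 2 * Im z <= Im (mob Sm w).
  rewrite (Im_mob SL2_S w0) jfac_S wI mulrC ler_wpM2l ?(ltW z0) //.
  rewrite -[2]invrK lef_pV2 // posrE ?invr_gt0 // exprn_gt0 // cabs_gt0.
  by apply: contraTneq w0 => ->; rewrite ltxx.
have [|g [gs gz]] := IH (mob Sm w) (mob_H SL2_S w0).
  apply: lt_le_trans w1; have -> : 2^-1 / 2 ^+ n = 2 * (2^-1 / 2 ^+ n.+1) :> R.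
    by rewrite exprS; field; rewrite expf_neq0.
  by rewrite ltr_pM2l.
exists (g *m (Sm *m Tn (- k))); split.
  by do 2! [apply: isSL2M => //]; [exact: SL2_S|exact: SL2_Tn].
rewrite !mobM // ?mob_H //; do ? [exact: SL2_S|exact: SL2_Tn].
by apply: isSL2M; [exact: SL2_S|exact: SL2_Tn].
Qed.

End Moebius.

(** * Principal logarithm and powers *)

Section PrincipalPower.
Variable R : realType.
Implicit Types (z w : C R) (k l : R).

Definition clog w : C R := Complex (ln (cabs w)) (Arg w).

Lemma cpow_clog w k : w != 0 -> cpow w k = cexp (Cr k * clog w).
Proof.
move=> w0; rewrite /cpow (negbTE w0) /cexp ReCrM ImCrM /=.
by rewrite /powR (gt_eqF (_ : 0 < cabs w)) // cabs_gt0.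
Qed.

Lemma cpowD w k l : w != 0 -> cpow w (k + l) = cpow w k * cpow w l.
Proof. by move=> w0; rewrite !cpow_clog // CrD mulrDl cexpD. Qed.

Lemma cpow_neq0 w k : w != 0 -> cpow w k != 0.
Proof. by move=> w0; rewrite cpow_clog // cexp_neq0. Qed.

Lemma cpow0 w : w != 0 -> cpow w 0 = 1.
Proof. by move=> w0; rewrite cpow_clog // Cr0 mul0r cexp0. Qed.

Lemma Re_quot_itv w : -1 <= Re w / cabs w <= 1.
Proof.
have [->|w0] := eqVneq w 0; first by rewrite mul0r lerN10 ler01.
by rewrite -ler_norml normrM normfV (ger0_norm (cabs_ge0 w)) ler_pdivrMr ?cabs_gt0 // mul1r cabs_Re.
Qed.

Lemma cexp_clog w : w != 0 -> cexp (clog w) = w.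
Proof.
move=> w0; have cw : 0 < cabs w by rewrite cabs_gt0.
rewrite /cexp /= lnK ?posrE //.
have itv := Re_quot_itv w.
have s2 : sin (acos (Re w / cabs w)) = `|Im w| / cabs w.
  rewrite sin_acos // -[RHS](ger0_norm (divr_ge0 (normr_ge0 _) (ltW cw))) -sqrtr_sqr.
  congr Num.sqrt; rewrite !exprMn real_normK ?num_real // exprVn.
  apply: (mulIf (lt0r_neq0 (exprn_gt0 2 cw))); rewrite mulrBl mul1r !divfK ?lt0r_neq0 ?exprn_gt0 //.
  by rewrite cabs_sqr addrC addKr.
apply/eqP; rewrite eq_complex /= /Arg; case: ifPn => [i0'|].
  by rewrite acosK // s2 ger0_norm // !mulrA ![cabs w * _]mulrC !mulfK ?lt0r_neq0 // !eqxx.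
rewrite -ltNge => i0'; rewrite cosN sinN acosK // s2 ltr0_norm // mulNr opprK.
by rewrite !mulrA ![cabs w * _]mulrC !mulfK ?lt0r_neq0 // !eqxx.
Qed.

Lemma cpow1 w : w != 0 -> cpow w 1 = w.
Proof. by move=> w0; rewrite cpow_clog // Cr1 mul1r cexp_clog. Qed.

Lemma cpow_int w (n : int) : w != 0 -> cpow w n%:~R = w ^ n.
Proof.
move=> w0.
have pos (m : nat) : cpow w m%:R = w ^+ m.
  elim: m => [|m IH]; first by rewrite cpow0 // expr0.
  by rewrite -natr1 cpowD // IH cpow1 // exprSr.
case: n => m; first by rewrite -pmulrn pos.
rewrite -[w ^ _]/((w ^+ m.+1)^-1) -pos NegzE mulrNz -pmulrn.
apply: (mulIf (cpow_neq0 m.+1%:R w0)); rewrite -cpowD // addrC subrr cpow0 //.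
by rewrite mulVf // cpow_neq0.
Qed.

(* [L] inverts [cexp] and is continuous, so [t := L (w + h) - L w] is small and [exp t - 1 = h / w]. *)
Lemma cdv_log_of_cont (L : C R -> C R) w (d0 : R) : 0 < d0 -> w != 0 -> ccont L w ->
  (forall h, cabs h < d0 -> cexp (L (w + h)) = w + h) -> cdv L w w^-1.
Proof.
move=> d00 w0 Lc Le e e0.
have cw : 0 < cabs w by rewrite cabs_gt0.
pose e1 := Num.min (Num.min 1 (1 / (8 * expR 1))) (e * cabs w / (8 * expR 1)).
have K0 : 0 < 8 * expR 1 :> R by rewrite mulr_gt0 // expR_gt0.
have e10 : 0 < e1 by rewrite !lt_min ltr01 !divr_gt0 // mulr_gt0.
have [d dd Hd] := Lc _ e10.
exists (Num.min d d0); first by rewrite lt_min dd.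
move=> h; rewrite lt_min => /andP[/Hd ht /Le hL].
set t := L (w + h) - L w in ht *.
have Ew : cexp (L w) = w by have := Le 0; rewrite cabs0 addr0; exact.
have Et : cexp t - 1 = h / w.
  by rewrite /t cexpD cexpN hL Ew; field.
move: ht; rewrite !lt_min => /andP[/andP[t1 t2] t3].
have T : cabs (cexp t - 1 - t) <= 4 * (cabs t ^+ 2 * expR 1).
  apply: le_trans (cexp_taylor_bound t) _; rewrite ler_wpM2l // ler_wpM2l ?exprn_even_ge0 //.
  by rewrite ler_expR ltW.
have tk (x : R) : cabs t < x / (8 * expR 1) -> 4 * (cabs t ^+ 2 * expR 1) <= x / 2 * cabs t.
  rewrite ltr_pdivlMr // => H; rewrite (_ : 4 * _ = cabs t * (8 * expR 1) / 2 * cabs t); last by field.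
  by rewrite ler_wpM2r ?cabs_ge0 // ler_wpM2r // ltW.
have tb : cabs t <= 2 * (cabs h / cabs w).
  have := le_trans T (tk _ t2); rewrite Et; have := cabs_sub t (t - h / w).
  rewrite (_ : t - (t - h / w) = h / w); last by ring.
  by rewrite [cabs (h / w - t)]cabsC cabsM cabsV; lra.
rewrite (_ : t - w^-1 * h = - (cexp t - 1 - t)); last by rewrite Et; ring.
rewrite cabsN; apply: le_trans T _; apply: le_trans (tk _ t3) _.
apply: le_trans (ler_wpM2l _ tb) _; first by rewrite divr_ge0 // mulr_ge0 // ltW.
by rewrite le_eqVlt; apply/orP; left; apply/eqP; field; rewrite lt0r_neq0.
Qed.

Definition rc (F : C R -> R) w := forall e : R, 0 < e -> exists2 d : R, 0 < d &
  forall h : C R, cabs h < d -> `|F (w + h) - F w| < e.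

Lemma rc_continuous F w : rc F w <-> {for w, continuous (F : (C R)^o -> R)}.
Proof.
split=> [H|/cvgrPdist_lt H].
  have FF : Filter (nbhs (w : (C R)^o)) by exact: nbhs_filter.
  apply/(@cvgrPdist_lt _ _ _ _ FF) => e /H [d d0 Hd]; near=> v.
  have : `|(w : (C R)^o) - v| < Cr d.
    by near: v; apply: cvgr_dist_lt => //; rewrite ltcE /= eqxx d0.
  rewrite distrC cabs_norm ltcE /= => /andP[_ /Hd].
  by rewrite [w + _]addrC subrK distrC.
move=> e /H /nbhs_ballP [d /= d0 Hd].
have [dr di] : 0 < Re d /\ d = Cr (Re d).
  by move: d0; case: (d) => a b; rewrite ltcE /= => /andP[/eqP-> ].
exists (Re d) => // h hd; rewrite distrC; apply: Hd.
by rewrite /ball /= opprD addrA subrr sub0r normrN cabs_norm di ltcE /= eqxx.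
Unshelve. all: by end_near. Qed.

Lemma rc_Re w : rc (@Re R) w.
Proof.
move=> e e0; exists e => // h; apply: le_lt_trans.
by rewrite ReD addrC addKr cabs_Re.
Qed.

Lemma rc_cabs w : rc (@cabs R) w.
Proof.
move=> e e0; exists e => // h; apply: le_lt_trans.
have := cabs_sub (w + h) w; have := cabs_sub w (w + h).
rewrite [cabs (w - _)]cabsC [w + h - w]addrC addKr ler_norml; lra.
Qed.

Lemma rc_near F G w (d : R) : 0 < d -> (forall h, cabs h < d -> F (w + h) = G (w + h)) ->
  rc F w -> rc G w.
Proof.
move=> d0 FG Fc e /Fc [d1 d10 H]; exists (Num.min d d1); first by rewrite lt_min d0.
move=> h; rewrite lt_min => /andP[h1 h2]; rewrite -FG // -[w in G w]addr0 -FG ?cabs0 // addr0.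
exact: H.
Qed.

(** Off the real axis the argument of [acos] lies strictly between -1 and 1 and the sign test in
    [Arg] is locally constant. This covers all automorphy factors: on the upper half-plane [jfac g]
    takes a real value only when [c = 0], and then it is constant. *)
Lemma ccont_clog w : Im w != 0 -> ccont clog w.
Proof.
move=> y0; have w0 : w != 0 by apply: contraNneq y0 => ->.
have cw : 0 < cabs w by rewrite cabs_gt0.
have rln : rc (fun v => ln (cabs v)) w.
  apply/rc_continuous; apply: (@continuous_comp (C R)^o R R (@cabs R) (@ln R)).
    exact/rc_continuous/rc_cabs.
  exact: continuous_ln.
have racos : rc (fun v => acos (Re v / cabs v)) w.
  apply/rc_continuous.
  apply: (@continuous_comp (C R)^o R R (fun v => Re v / cabs v) (@acos R)).
    apply: continuousM; first exact/rc_continuous/rc_Re.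
    by apply: continuousV; [rewrite gt_eqF|exact/rc_continuous/rc_cabs].
  apply: continuous_acos; rewrite -ltr_norml normrM normfV (ger0_norm (cabs_ge0 w)).
  rewrite ltr_pdivrMr // mul1r -(ltr_pXn2r (ltn0Sn 1)) ?nnegrE ?cabs_ge0 //.
  by rewrite cabs_sqr real_normK ?num_real // ltrDl exprn_even_gt0.
have rArg : rc (@Arg R) w.
  have sgn h : cabs h < `|Im w| -> (0 <= Im (w + h)) = (0 <= Im w).
    move=> hw; have := cabs_Im h; rewrite ImD ler_norml => /andP[h1 h2].
    move: y0 hw; rewrite neq_lt => /orP[yn|yp].
      by rewrite ltr0_norm // => hw; rewrite !leNgt yn; apply/negP/negP; lra.
    by rewrite gtr0_norm // => hw; rewrite (ltW yp); lra.
  have [yp|yn] := boolP (0 <= Im w).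
    apply: (rc_near _ _ racos (d := `|Im w|)); first by rewrite normr_gt0.
    by move=> h /sgn E; rewrite /Arg E yp.
  have rN : rc (fun v => - acos (Re v / cabs v)) w.
    by move=> e /racos [d d0 H]; exists d => // h /H; rewrite -opprD normrN.
  apply: (rc_near _ _ rN (d := `|Im w|)); first by rewrite normr_gt0.
  by move=> h /sgn E; rewrite /Arg E (negbTE yn).
move=> e e0; have e2 : 0 < e / 2 by rewrite divr_gt0.
have [d1 d10 H1] := rln _ e2; have [d2 d20 H2] := rArg _ e2.
exists (Num.min d1 d2); first by rewrite lt_min d10.
move=> h; rewrite lt_min => /andP[/H1 h1 /H2 h2].
by apply: le_lt_trans (cabs_le _) _; rewrite ReD ReN ImD ImN /= (splitr e) ltrD.
Qed.

Lemma cdv_cpow w k : Im w != 0 -> cdv (fun v => cpow v k) w (Cr k / w * cpow w k).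
Proof.
move=> y0; have w0 : w != 0 by apply: contraNneq y0 => ->.
have cw : 0 < cabs w by rewrite cabs_gt0.
have near h : cabs h < cabs w -> w + h != 0.
  by move=> hw; apply: contraTneq hw => E; rewrite -leNgt -[h](addKr w) E addr0 cabsN.
have L : cdv clog w w^-1.
  by apply: (cdv_log_of_cont cw w0 (ccont_clog y0)) => h /near; exact: cexp_clog.
have H := cdv_comp (cdv_cstM (Cr k) L) (cdv_cexp _).
apply: (cdv_near cw _ (cdv_eq H _)); last by rewrite cpow_clog // mulrC.
by move=> v vw; rewrite cpow_clog // -[v](subrK w) addrC near.
Qed.

Lemma cdv_cpow_jfac (g : 'M[int]_2) z k : isSL2 g -> 0 < Im z ->
  cdv (fun v => cpow (jfac g v) k) z (Cr k * intC R (g i1 i0) / jfac g z * cpow (jfac g z) k).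
Proof.
move=> gs z0; have j0 := jfac_neq0 gs z0.
have [c0|c0] := eqVneq (g i1 i0) 0.
  apply: cdv_near ltr01 _ (cdv_eq (cdv_cst (cpow (jfac g z) k) z) _).
    by move=> w _; rewrite /jfac c0 /intC mulr0z !mul0r.
  by rewrite c0 /intC mulr0z mulr0 !mul0r.
have Ij : Im (jfac g z) != 0.
  by rewrite Im_jfac mulf_eq0 intr_eq0 (negbTE c0) (gt_eqF z0).
apply: cdv_eq (cdv_comp (cdv_jfac g z) (cdv_cpow k Ij)) _.
by rewrite mulrAC [Cr k / _ * _]mulrAC.
Qed.

End PrincipalPower.

(** * The operator D, its transformation under the modular group, and powers of eta *)

Section Operators.
Variable R : realType.
Implicit Types (f h N F G : C R -> C R) (z w a b c : C R) (g : 'M[int]_2) (k l s : R).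
Local Notation P := (@Defs.Pfun R).

Lemma holoHP f : holoH f <-> holH f.
Proof.
split=> fh z z0; first by exists (cderiv f z); exact: derivable_cdv (fh z z0).
by have [l fl] := fh z z0; case: (cdv_derivable fl).
Qed.

Lemma cderivP f z : holH f -> 0 < Im z -> cdv f z (cderiv f z).
Proof. by move=> /holoHP fh z0; exact: derivable_cdv (fh z z0). Qed.

(** Restores the convention that functions vanish off the upper half-plane, so that equality there
    is equality of functions. *)
Definition cut f z : C R := if 0 < Im z then f z else 0.

Lemma cutE f z : 0 < Im z -> cut f z = f z.
Proof. by rewrite /cut => ->. Qed.
Lemma cut_offH0 f : offH0 (cut f).
Proof. by move=> z; rewrite leNgt /cut => /negbTE ->. Qed.
Lemma offH0_ext (T : zmodType) (F1 F2 : C R -> T) : offH0 F1 -> offH0 F2 ->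
  (forall z, 0 < Im z -> F1 z = F2 z) -> F1 = F2.
Proof.
move=> o1 o2 E; apply/funext => z; have [z0|z0] := ltP 0 (Im z); first exact: E.
by rewrite o1 ?o2.
Qed.

Lemma powR_le_expR (N : R) (c e : R) : 0 < N -> 0 < c -> 0 < e -> exists2 Y : R, 0 < Y &
  forall y, Y < y -> y `^ N <= e * expR (c * y).
Proof.
move=> N0 c0 e0; have := archi_boundP (ltW N0); set n := Num.bound N => Nn.
have n0 : 0 < n%:R :> R by exact: lt_trans Nn.
pose t := c / 2 / n%:R.
have t0 : 0 < t by rewrite !divr_gt0.
pose K := (t^-1) ^+ n.
have K0 : 0 < K by rewrite exprn_gt0 // invr_gt0.
exists (Num.max 1 (K / e / (c / 2))); first by rewrite lt_max ltr01.
move=> y; rewrite gt_max => /andP[y1 yK].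
have y0 : 0 < y by exact: lt_trans y1.
apply: (@le_trans _ _ (y ^+ n)).
  by rewrite -powR_mulrn ?(ltW y0) // ler_powR // ltW.
apply: (@le_trans _ _ (K * expR (c / 2 * y))).
  have -> : expR (c / 2 * y) = expR (t * y) ^+ n.
    by rewrite -expRMn; congr expR; rewrite /t; field; rewrite gt_eqF.
  rewrite /K -exprMn lerXn2r ?nnegrE ?(ltW y0) ?mulr_ge0 ?invr_ge0 ?expR_ge0 ?(ltW t0) //.
  by rewrite ler_pdivlMl //; apply: le_trans (expR_ge1Dx _); rewrite lerDr.
have -> : c * y = c / 2 * y + c / 2 * y by field.
rewrite expRD mulrA ler_wpM2r ?expR_ge0 //.
rewrite -ler_pdivrMl // mulrC; apply: le_trans (_ : c / 2 * y <= _).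
  by rewrite [c / 2 * y]mulrC -ler_pdivrMr ?divr_gt0 // ltW.
by apply: le_trans (expR_ge1Dx _); rewrite lerDr.
Qed.

(** Here [l < 1] matters: [q^(-l)] contributes [exp (2 pi l y)], and the remaining
    [exp (2 pi (1 - l) y)] dominates every power of [y]. *)
Lemma moderate_growth1 f l : moderate f -> l < 1 -> growth1 (fun z => f z * qq (- l) z).
Proof.
move=> [N [c [N0 [c0 fN]]]] l1 e e0.
have d0 : 0 < 2 * pi * (1 - l) by rewrite !mulr_gt0 ?pi_gt0 // subr_gt0.
have [Y Y0 HY] := powR_le_expR N0 d0 e0.
exists (Num.max c Y) => z; rewrite gt_max => /andP[cz /HY zY].
rewrite cabsM cabs_qq; apply: le_trans (ler_wpM2r (expR_ge0 _) (le_trans (fN z cz) zY)) _.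
set E1 := expR _; set E2 := expR _; rewrite (_ : expR (2 * pi * Im z) = E1 * E2) ?mulrA //.
by rewrite /E1 /E2 -expRD; congr expR; ring.
Qed.

Lemma moderate_of_bounded f (y K : R) : 0 < y ->
  (forall z, y <= Im z -> cabs (f z) <= K) -> moderate f.
Proof.
move=> y0 fK; exists 1, (Num.max y (Num.max K 1)); split=> //; split; first by rewrite lt_max y0.
move=> z; rewrite !gt_max => /andP[yz /andP[Kz z1]].
rewrite powRr1; last by rewrite ltW // (lt_trans ltr01).
by apply: le_trans (fK z (ltW yz)) (ltW Kz).
Qed.

Lemma BB_moderate f : BB f -> moderate f.
Proof. by case=> _ _ [y [K [y0 _ fK]]]; exact: moderate_of_bounded fK. Qed.

(** [D_k] with an arbitrary function in place of [P]: pulling an equation back by [g] changes only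
    this parameter. *)
Definition DopQ k (Q : C R -> C R) f z := (twopii R)^-1 * cderiv f z + Cr k * Q z * f z.

Lemma Dop_DopQ k f z : 0 < Im z -> Dop k f z = DopQ k P f z.
Proof. by rewrite /Dop => ->. Qed.

Lemma Dop_offH0 k f : offH0 (Dop k f).
Proof. by move=> z; rewrite leNgt /Dop => /negbTE ->. Qed.

(** The function that must replace [P] for [D] to commute with the action of [g], whatever the
    transformation law of [P] is. The second summand compensates the derivative of the automorphy
    factor. *)
Definition Pslash g z := (jfac g z) ^- 2 * P (mob g z) + intC R (g i1 i0) / (twopii R * jfac g z).

(** Records an automorphy factor of weight [k] only by its logarithmic derivative, so that neither
    the branch of the power nor the multiplier enters the computation of derivatives. *)
Definition is_factor k g N := forall z, 0 < Im z ->
  cdv N z (Cr k * intC R (g i1 i0) / jfac g z * N z).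

Lemma factor_cpow k g c : isSL2 g -> is_factor k g (fun z => c * cpow (jfac g z) k).
Proof.
move=> gs z z0; apply: cdv_eq (cdv_cstM c (cdv_cpow_jfac k gs z0)) _.
by rewrite mulrCA.
Qed.

Lemma factor_step k g N : isSL2 g -> is_factor k g N ->
  is_factor (k + 2) g (fun z => N z * jfac g z ^+ 2).
Proof.
move=> gs Nf z z0; have j0 := jfac_neq0 gs z0.
apply: cdv_eq (cdvM (Nf z z0) (cdvX 2 (cdv_jfac g z))) _.
by rewrite CrD Cr_nat /= expr1; field.
Qed.

Lemma Dop_transform k g N f h : isSL2 g -> is_factor k g N -> holH f -> holH h ->
  (forall z, 0 < Im z -> f (mob g z) = N z * h z) ->
  forall z, 0 < Im z ->
    Dop k f (mob g z) = N z * jfac g z ^+ 2 * DopQ k (Pslash g) h z.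
Proof.
move=> gs Nf fh hh E z z0; have j0 := jfac_neq0 gs z0; have m0 := mob_H gs z0.
have d1 := cdv_comp (cdv_mob gs z0) (cderivP fh m0).
have d2 := cdvM (Nf z z0) (cderivP hh z0).
have := cdv_uniq (cdv_extH E z0 d1) d2 => Ed.
rewrite Dop_DopQ // /DopQ E //.
have -> : cderiv f (mob g z) = jfac g z ^+ 2 *
   (Cr k * intC R (g i1 i0) / jfac g z * N z * h z + N z * cderiv h z).
  by rewrite -Ed; field.
by rewrite /Pslash; field; rewrite twopii_neq0 j0.
Qed.

Lemma Mform_per1 (j : int) f : Mform j f -> per1 f.
Proof.
case=> _ [_ [_ H]] z z0; have := H _ SL2_T z z0.
by rewrite mob_T jfac_T exp1rz mul1r.
Qed.

Lemma Mform_BB (j : int) f : Mform j f -> BB f.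
Proof.
move=> fM; have fp := Mform_per1 fM; case: fM => /holoHP fh [fm _].
apply: BB_of_growth1 => //.
have := moderate_growth1 fm ltr01.
by rewrite (_ : (fun z => _) = f) //; apply/funext => z; rewrite oppr0 qq0 mulr1.
Qed.

Lemma BB_holH f : BB f -> holH f. Proof. by case. Qed.

Lemma BB_cderiv f : BB f -> BB (cderiv f) /\ qlim (cderiv f) 0.
Proof.
move=> fB; have [g [gB g0 fg]] := BB_deriv fB.
have E z : 0 < Im z -> g z = cderiv f z by move=> z0; rewrite (cdv_cderiv (fg z z0)).
by split; [exact: BB_ext E gB|exact: qlim_ext E g0].
Qed.

Lemma BB_Dop k f a : BB f -> qlim f a -> BB (Dop k f) /\ qlim (Dop k f) (- (Cr k * a / 12)).
Proof.
move=> fB fa; have [dB d0] := BB_cderiv fB; have [PB Pl] := Pfun_BB R.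
have E z : 0 < Im z -> (twopii R)^-1 * cderiv f z + Cr k * (P z * f z) = Dop k f z.
  by move=> z0; rewrite Dop_DopQ // /DopQ mulrA.
split; first by apply: BB_ext E (BBD (BBZ _ dB) (BBZ _ (BBM PB fB))).
have := qlimD (qlimZ (twopii R)^-1 d0) (qlimZ (Cr k) (qlimM Pl fa)).
rewrite mulr0 add0r (_ : Cr k * (- 12^-1 * a) = - (Cr k * a / 12)); last by field.
exact: qlim_ext.
Qed.

Lemma Mform_cpow (j : int) f : Mform j f <-> [/\ holH f, moderate f, offH0 f &
  forall g, isSL2 g -> forall z, 0 < Im z -> f (mob g z) = 1 * cpow (jfac g z) j%:~R * f z].
Proof.
split=> [[/holoHP fh [fm [fo H]]]|[/holoHP fh fm fo H]]; do ! split=> //.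
  by move=> g gs z z0; rewrite H // mul1r cpow_int ?jfac_neq0.
by move=> g gs z z0; rewrite H // mul1r cpow_int ?jfac_neq0.
Qed.

(* The discriminant and its real powers: [Efun L s] plays the role of [eta ^ (24 s)], with the
   branch fixed by a primitive [L] of [P + 1/12]. *)
Definition Efun (L : C R -> C R) s z := qq s z * cexp (Cr (- (12 * s)) * twopii R * L z).

Lemma P_primitive : exists L, [/\ BB L, qlim L 0 &
  forall z, 0 < Im z -> cdv L z (P z + 12^-1)].
Proof.
have [PB Pl] := Pfun_BB R; have [L [LB L0 LP]] := BB_prim PB Pl; exists L; split=> //.
by move=> z z0; have := LP z z0; rewrite opprK.
Qed.

Section Efun.
Variable L : C R -> C R.
Hypotheses (LB : BB L) (L0 : qlim L 0) (LP : forall z, 0 < Im z -> cdv L z (P z + 12^-1)).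

Lemma Efun_neq0 s z : Efun L s z != 0.
Proof. by apply: mulf_neq0; [exact: qq_neq0|exact: cexp_neq0]. Qed.

(** The [1/12] in the derivative of [L] cancels the derivative of [q^s], which leaves the equation
    satisfied by [eta^(24 s)]. *)
Lemma cdv_Efun s z : 0 < Im z ->
  cdv (Efun L s) z (- (12 * Cr s) * twopii R * P z * Efun L s z).
Proof.
move=> z0.
apply: cdv_eq (cdvM (cdv_qq s z) (cdv_comp (cdv_cstM _ (LP z0)) (cdv_cexp _))) _.
by rewrite /Efun CrN CrM Cr_nat; field.
Qed.

Lemma Efun_factor s : exists E, [/\ BB E, qlim E 1, forall z, E z != 0,
  forall z, Efun L s z = qq s z * E z & BB (fun z => (E z)^-1)].
Proof.
pose M z := Cr (- (12 * s)) * twopii R * L z.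
have MB : BB M by exact: BBZ.
have M0 : qlim M 0 by have := qlimZ (Cr (- (12 * s)) * twopii R) L0; rewrite mulr0.
have [EB E1] := BB_cexp MB M0.
exists (fun z => cexp (M z)); split=> //; first by move=> z; exact: cexp_neq0.
by have [] := BB_inv EB (fun z _ => cexp_neq0 (M z)) E1 (oner_neq0 _).
Qed.

Lemma Efun_unique s W : (forall z, 0 < Im z ->
    cdv W z (- (12 * Cr s) * twopii R * P z * W z)) ->
  exists c, forall z, 0 < Im z -> W z = c * Efun L s z.
Proof.
move=> Wd; pose V z := W z / Efun L s z.
have Vd z : 0 < Im z -> cdv V z 0.
  move=> z0; apply: cdv_eq (cdv_div (Wd z z0) (cdv_Efun s z0) (Efun_neq0 s z)) _.
  by rewrite (_ : _ - _ = 0) ?mul0r //; ring.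
have i0' : 0 < Im (iC R) by rewrite /= ltr01.
exists (V (iC R)) => z z0; rewrite -(deriv0_const Vd i0' z0) /V divfK //.
exact: Efun_neq0.
Qed.

End Efun.

(** Integrating factor: a primitive of [u] is [a * w], from the constant term, plus a periodic
    function. *)
Lemma linear_ode_zero u f z0 : BB u -> (forall z, 0 < Im z -> cdv f z (u z * f z)) ->
  0 < Im z0 -> f z0 = 0 -> forall z, 0 < Im z -> f z = 0.
Proof.
move=> uB fd z00 f0 z zp.
have [a ua] := BB_qlim uB; have [L [_ _ LP]] := BB_prim uB ua.
pose E w := cexp (- (a * w + L w)).
have Ed w : 0 < Im w -> cdv E w (E w * (- (a * 1 + (u w - a)))).
  by move=> w0; exact: cdv_comp (cdvN (cdvD (cdv_cstM a (cdv_id w)) (LP w w0))) (cdv_cexp _).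
have V w : 0 < Im w -> cdv (fun v => f v * E v) w 0.
  by move=> w0; apply: cdv_eq (cdvM (fd w w0) (Ed w w0)) _; ring.
have := deriv0_const V z00 zp; rewrite f0 mul0r => /eqP.
by rewrite mulf_eq0 (negbTE (cexp_neq0 _)) orbF => /eqP.
Qed.

End Operators.

(** * Modular forms of level one *)

Lemma weight_combination (x y : nat) : (4 : int) *+ x + (4 + 2) *+ y = (2 * (2 * x + 3 * y))%N%:Z.
Proof.
rewrite -[4 *+ x]mulr_natr -[(4 + 2) *+ y]mulr_natr -[RHS]natz !(natrM, natrD); ring.
Qed.

Section ModularForms.
Variable R : realType.
Implicit Types (f h e : C R -> C R) (z w a b c : C R) (g : 'M[int]_2) (j l : int).
Local Notation P := (@Defs.Pfun R).

Lemma Mform_mul j l f h : Mform j f -> Mform l h -> Mform (j + l) (fun z => f z * h z).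
Proof.
move=> fM hM; have B := BBM (Mform_BB fM) (Mform_BB hM).
case: fM => _ [_ [fo fT]]; case: hM => _ [_ [_ hT]].
split; first by apply/holoHP; case: B.
split; first exact: BB_moderate.
split; first by move=> z z0; rewrite fo // mul0r.
move=> g gs z z0; rewrite fT // hT // expfzDr ?jfac_neq0 //; ring.
Qed.

Lemma Mform_lin j a b f h : Mform j f -> Mform j h -> Mform j (fun z => a * f z + b * h z).
Proof.
move=> fM hM; have B := BBD (BBZ a (Mform_BB fM)) (BBZ b (Mform_BB hM)).
case: fM => _ [_ [fo fT]]; case: hM => _ [_ [ho hT]].
split; first by apply/holoHP; case: B.
split; first exact: BB_moderate.
split; first by move=> z z0; rewrite fo // ho // !mulr0 addr0.
by move=> g gs z z0; rewrite fT // hT //; ring.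
Qed.

Lemma Mform_cst c : Mform 0 (cut (fun=> c)).
Proof.
have B : BB (cut (fun=> c)) by apply: BB_ext (BB_cst c) => z z0; rewrite cutE.
split; first by apply/holoHP; case: B.
split; first exact: BB_moderate.
split; first exact: cut_offH0.
by move=> g gs z z0; rewrite !cutE ?mob_H // expr0z mul1r.
Qed.

Lemma Mform_0 j : Mform j (fun=> 0 : C R).
Proof.
split; first by apply/holoHP => z _; eexists; exact: cdv_cst.
split; first by exact: BB_moderate (BB_cst 0).
by split=> // g gs z z0; rewrite mulr0.
Qed.

Lemma Mform_expr j f n : Mform j f -> Mform (j *+ n) (cut (fun z => f z ^+ n)).
Proof.
move=> fM; elim: n => [|n IH].
  rewrite mulr0n (_ : cut _ = cut (fun=> 1)); first exact: Mform_cst.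
  by apply/funext => z; rewrite /cut expr0.
rewrite mulrS (_ : cut _ = fun z => f z * cut (fun z => f z ^+ n) z); first exact: Mform_mul.
by apply/funext => z; rewrite /cut; case: ifP; rewrite ?mulr0 // exprS.
Qed.

Lemma Mform_ext_off j f z : Mform j f -> Im z <= 0 -> f z = 0.
Proof. by case=> _ [_ [H _]]; exact: H. Qed.

(** Assumed throughout the level one theory; [Pfun_quasimodular] later derives it from [F0]. *)
Definition quasimodular := forall g, isSL2 g -> forall z, 0 < Im z ->
  Pslash g z = P z.

Lemma quasimodularE g z : quasimodular -> isSL2 g -> 0 < Im z ->
  P (mob g z) = jfac g z ^+ 2 * P z - intC R (g i1 i0) / twopii R * jfac g z.
Proof.
move=> QM gs z0; have j0 := jfac_neq0 gs z0.
by rewrite -(QM g gs z z0) /Pslash; field; rewrite twopii_neq0.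
Qed.

Section Quasimodular.
Hypothesis QM : quasimodular.

Lemma Mform_Dop j f : Mform j f -> Mform (j + 2) (Dop j%:~R f).
Proof.
move=> fM; have fB := Mform_BB fM; have [a fa] := BB_qlim fB.
have [DB _] := BB_Dop j%:~R fB fa.
apply/Mform_cpow; case/Mform_cpow: (fM) => fh fm fo fT; split.
- by case: DB.
- exact: BB_moderate.
- exact: Dop_offH0.
move=> g gs z z0; have j0 := jfac_neq0 gs z0.
rewrite (Dop_transform gs (factor_cpow (j%:~R) 1 gs) fh fh (fT g gs)) //.
rewrite intrD cpowD // cpow_int // (cpow_int 2) // !mul1r; congr (_ * _).
by rewrite Dop_DopQ // /DopQ QM.
Qed.

(* [X] is [E4 / 144]. *)
Definition X := cut (fun z => (twopii R)^-1 * cderiv P z + P z ^+ 2).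

Lemma X_BB : BB X /\ qlim X (144^-1).
Proof.
have [PB Pl] := Pfun_BB R; have [dB d0] := BB_cderiv PB.
have E z : 0 < Im z -> (twopii R)^-1 * cderiv P z + P z ^+ 2 = X z by move=> z0; rewrite /X cutE.
split; first exact: BB_ext E (BBD (BBZ _ dB) (BBX 2 PB)).
have := qlimD (qlimZ (twopii R)^-1 d0) (qlimX 2 Pl).
rewrite mulr0 add0r (_ : (- 12^-1) ^+ 2 = 144^-1); last by field.
exact: qlim_ext.
Qed.

(** Differentiating the law of [P] and squaring it produce opposite inhomogeneous terms, which
    cancel in [X]. *)
Lemma Mform_X : Mform 4 X.
Proof.
have [PB _] := Pfun_BB R; have Ph := BB_holH PB; have [XB _] := X_BB.
split; first by apply/holoHP; case: XB.
split; first exact: BB_moderate.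
split; first exact: cut_offH0.
move=> g gs z z0; have j0 := jfac_neq0 gs z0; have m0 := mob_H gs z0.
have d1 := cdv_comp (cdv_mob gs z0) (cderivP Ph m0).
have d2 := cdvB (cdvM (cdvX 2 (cdv_jfac g z)) (cderivP Ph z0))
  (cdv_cstM (intC R (g i1 i0) / twopii R) (cdv_jfac g z)).
have E w : 0 < Im w -> P (mob g w) =
    jfac g w ^+ 2 * P w - intC R (g i1 i0) / twopii R * jfac g w.
  by move=> w0; exact: quasimodularE.
have Ed := cdv_uniq (cdv_extH E z0 d1) d2.
rewrite /X !cutE //.
have -> : cderiv P (mob g z) = jfac g z ^+ 2 * (cderiv P (mob g z) * jfac g z ^- 2) by field.
rewrite Ed E // -[_ ^ 4]/(jfac g z ^+ 4) /= expr1; field; exact: twopii_neq0.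
Qed.

(** * The discriminant and the dimensions of spaces of modular forms *)

Section Discriminant.
Variable L : C R -> C R.
Hypotheses (LB : BB L) (L0 : qlim L 0) (LP : forall z, 0 < Im z -> cdv L z (P z + 12^-1)).

Definition Delta := cut (Efun L 1).

Lemma Delta_neq0 z : 0 < Im z -> Delta z != 0.
Proof. by move=> z0; rewrite /Delta cutE // Efun_neq0. Qed.

Lemma Delta_BB : BB Delta /\ qlim Delta 0.
Proof.
have [E [EB E1 _ EE _]] := Efun_factor LB L0 1.
have H z : 0 < Im z -> qq 1 z * E z = Delta z by move=> z0; rewrite /Delta cutE.
split; first exact: BB_ext H (BBM (@BB_qq R) EB).
have := qlimM (qlim_qq R) E1; rewrite mul0r; exact: qlim_ext.
Qed.

(** By the law of [P] both sides satisfy the same first order equation, so their quotient is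
    constant; it is 1 at the fixed point [i] of [S] because [i^12 = 1]. *)
Lemma Efun_S z : 0 < Im z -> Efun L 1 (mob Sm z) = z ^+ 12 * Efun L 1 z.
Proof.
pose V w := Efun L 1 (mob Sm w) / (w ^+ 12 * Efun L 1 w).
have wn0 w : 0 < Im w -> w != 0 by move=> w0; rewrite -(jfac_S w) jfac_neq0 //; exact: SL2_S.
have den w : 0 < Im w -> w ^+ 12 * Efun L 1 w != 0.
  by move=> w0; apply: mulf_neq0; [exact: expf_neq0 (wn0 w w0)|exact: Efun_neq0].
have Vd w : 0 < Im w -> cdv V w 0.
  move=> w0; have m0 := mob_H SL2_S w0; have wn := wn0 w w0.
  have d1 := cdv_comp (cdv_mob SL2_S w0) (cdv_Efun LP 1 m0).
  have d2 := cdvM (cdvX 12 (cdv_id w)) (cdv_Efun LP 1 w0).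
  apply: cdv_eq (cdv_div d1 d2 (den w w0)) _.
  rewrite (quasimodularE QM SL2_S w0) jfac_S.
  have -> : Sm i1 i0 = 1 by rewrite mxE.
  rewrite [X in X / _](_ : _ = 0) ?mul0r // /intC mulr1z Cr1 /=; field.
  by rewrite wn twopii_neq0.
move=> z0; have i0' : 0 < Im (iC R) by rewrite /= ltr01.
have Si : mob Sm (iC R) = iC R.
  rewrite mob_S; apply: (mulIf (iC_neq0 R)); rewrite mulNr mulVf ?iC_neq0 //.
  by rewrite iC_sqr.
have Vi : V (iC R) = 1.
  rewrite /V Si (_ : iC R ^+ 12 = 1) ?mul1r ?divff ?Efun_neq0 //.
  by rewrite (exprM _ 2 6) expr2 iC_sqr -signr_odd.
have := deriv0_const Vd i0' z0; rewrite Vi /V => /(congr1 (fun x => x * (z ^+ 12 * Efun L 1 z))).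
by rewrite divfK ?den // mul1r.
Qed.

Lemma Mform_Delta : Mform 12 Delta.
Proof.
have [DB _] := Delta_BB; have [E [EB _ _ EE _]] := Efun_factor LB L0 1.
split; first by apply/holoHP; case: DB.
split; first exact: BB_moderate.
split; first exact: cut_offH0.
move=> g gs; suff H z : 0 < Im z -> Efun L 1 (mob g z) = jfac g z ^+ 12 * Efun L 1 z.
  by move=> z z0; rewrite /Delta !cutE ?mob_H // H.
move: z; apply: (@SL2_gen (fun g => forall z, 0 < Im z ->
    Efun L 1 (mob g z) = jfac g z ^+ 12 * Efun L 1 z)) gs.
- by move=> z z0; rewrite mob1 /jfac !mxE /intC /= mulr0z mulr1z mul0r add0r expr1n mul1r.
- move=> s ss Hs z z0; rewrite mobM ?jfacM //; last exact: SL2_T.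
  rewrite mob_T jfac_T mul1r -Hs // !EE; case: EB => _ Ep _.
  by rewrite Ep ?mob_H // (qq_per1 1) ?mob_H.
move=> s ss Hs z z0; rewrite mobM ?jfacM //; last exact: SL2_S.
rewrite jfac_S Efun_S; last exact: mob_H.
by rewrite Hs // [(mob s z * _) ^+ _]exprMn mulrA.
Qed.

(** Takes the place of the maximum principle on the compactified quotient. Each point moves to
    height at least 1/2, where [BB_contract] multiplies any global bound by at most
    [exp (- pi / 8)]; by invariance the improved bound is again global, and iteration forces
    zero. *)
Lemma invariant_const f a : BB f -> qlim f a ->
  (forall g z, isSL2 g -> 0 < Im z -> f (mob g z) = f z) ->
  forall z, 0 < Im z -> f z = a.
Proof.
move=> fB fa fT z z0.
pose h z := f z - a.
have hB : BB h by exact: BBB fB (BB_cst a).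
have h0 : qlim h 0.
  have := qlimD fa (qlim_cst (- a)); rewrite subrr; exact.
have hT g w : isSL2 g -> 0 < Im w -> h (mob g w) = h w by move=> gs w0; rewrite /h fT.
have half0 : 0 < 2^-1 :> R by rewrite invr_gt0.
have [K K0 hK] := BB_bounded hB half0.
have bnd n : forall w, 0 < Im w -> cabs (h w) <= K * expR (- (pi / 8 * n%:R)).
  elim: n => [|n IH] w w0; have [g [gs gw]] := reduction w0; rewrite -(hT g w gs w0).
    by rewrite mulr0 oppr0 expR0 mulr1 hK.
  have m0 := mob_H gs w0.
  apply: le_trans (BB_contract hB h0 m0 _ IH) _; first by rewrite mulr_ge0 ?expR_ge0.
  have -> : pi / 8 * n.+1%:R = pi / 8 * n%:R + pi / 8 :> R.
    by rewrite -[n.+1]addn1 natrD mulrDr mulr1.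
  rewrite mulrCA ler_wpM2l // -expRD ler_expR opprD addrC lerD2l lerN2.
  rewrite (_ : pi * Im (mob g w) / 4 = pi / 8 * (2 * Im (mob g w))); last by field.
  by rewrite ler_peMr ?divr_ge0 ?pi_ge0 //; move: gw; lra.
apply/eqP; rewrite -subr_eq0 -cabs_eq0 eq_le cabs_ge0 andbT.
apply/ler_addgt0Pl => e e0; rewrite addr0.
have p8 : 0 < pi / 8 :> R by rewrite divr_gt0 // pi_gt0.
have [N0 HN] := expRN_small K p8 e0.
by apply: le_trans (bnd N0 z z0) (ltW (HN _ (leqnn _))).
Qed.

Lemma Mform0_const f : Mform 0 f -> exists a, f = cut (fun=> a).
Proof.
move=> fM; have fB := Mform_BB fM; have [a fa] := BB_qlim fB; exists a.
case: fM => _ [_ [fo fT]]; apply: offH0_ext fo (@cut_offH0 _ _) _ => z z0; rewrite cutE //.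
apply: invariant_const fB fa _ z z0 => g w gs w0.
by rewrite fT // expr0z mul1r.
Qed.

(** [f^12 Delta^(n+1)] has weight 0, hence is constant, and it vanishes at the cusp; [Delta] has no
    zero, so [f] does vanish. *)
Lemma Mform_neg (n : nat) f : Mform (- n.+1%:Z) f -> f = fun=> 0.
Proof.
move=> fM; have [DB D0] := Delta_BB; have fB := Mform_BB fM.
have [a fa] := BB_qlim fB.
have hM := Mform_mul (Mform_expr 12 fM) (Mform_expr n.+1 Mform_Delta).
have w0 : (- n.+1%:Z) *+ 12 + 12 *+ n.+1 = 0 by rewrite -[12]/(1 *+ 12) -mulrnA mulnC mulrnA -mulrnDl natz addNr mul0rn.
rewrite w0 in hM; have [b hb] := Mform0_const hM.
have hlim : qlim (fun z => cut (fun z => f z ^+ 12) z * cut (fun z => Delta z ^+ n.+1) z) 0.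
  have := qlimM (qlimX 12 fa) (qlimX n.+1 D0); rewrite [0 ^+ _]exprS mul0r mulr0.
  by apply: qlim_ext => z z0; rewrite !cutE.
have b0 : b = 0.
  apply: qlim_uniq hlim; rewrite hb; apply: qlim_ext (qlim_cst b) => z z0; by rewrite cutE.
case: (fM) => _ [_ [fo _]]; apply: offH0_ext fo _ _ => // z z0.
have /eqP := congr1 (fun F => F z) hb; rewrite b0 !cutE //.
rewrite mulf_eq0 !expf_eq0 (negbTE (Delta_neq0 z0)) andbF orbF /=.
by move/eqP.
Qed.

Lemma Mform_cusp j f : Mform j f -> qlim f 0 ->
  exists2 h, Mform (j - 12) h & f = fun z => h z * Delta z.
Proof.
move=> fM f0; have fB := Mform_BB fM.
have [g0 g0B fg] := BB_divq fB f0.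
have [E [EB E1 En EE EV]] := Efun_factor LB L0 1.
pose h := cut (fun z => f z / Delta z).
have hE z : 0 < Im z -> g0 z * (E z)^-1 = h z.
  move=> z0; rewrite /h cutE // fg // /Delta cutE // EE invfM mulrACA divff ?qq_neq0 //.
  by rewrite mul1r.
have hB := BB_ext hE (BBM g0B EV).
have [_ [_ [fo fT]]] := fM; have [_ [_ [_ DT]]] := Mform_Delta.
exists h; last first.
  apply: offH0_ext fo _ _; first by move=> z z0; rewrite /h cut_offH0 // mul0r.
  by move=> z z0; rewrite /h cutE // divfK // Delta_neq0.
split; first by apply/holoHP; case: hB.
split; first exact: BB_moderate.
split; first exact: cut_offH0.
move=> g gs z z0; have j0 := jfac_neq0 gs z0.
rewrite /h !cutE ?mob_H // fT // DT // invfM mulrACA; congr (_ * _).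
by apply: (mulIf (expfz_neq0 12 j0)); rewrite divfK ?expfz_neq0 // -expfzDr // subrK.
Qed.

Lemma Mform_small_cusp (n : nat) f : (n < 12)%N -> Mform n%:Z f -> qlim f 0 -> f = fun=> 0.
Proof.
move=> n12 fM /(Mform_cusp fM) [h hM ->].
have E : n%:Z - 12 = - (11 - n).+1%:Z by lia.
rewrite E in hM; rewrite (Mform_neg hM).
by apply/funext => z; rewrite mul0r.
Qed.

(** If the constant term [a] is nonzero, [D f - (d / a^2) f^2] has weight 4 and no constant term,
    hence vanishes. This Riccati equation reads [f' = u f] with [u] in [BB]. Weight 2 at the fixed
    point of [S] gives [f i = i^2 * f i = - f i], so [f i = 0] and therefore [f] is zero. *)
Lemma Mform2_0 f : Mform 2 f -> f = fun=> 0.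
Proof.
move=> fM; have fB := Mform_BB fM; have [a fa] := BB_qlim fB.
have [a0|a0] := eqVneq a 0; first by apply: (@Mform_small_cusp 2) => //; rewrite -a0.
have [DB Dl] := BB_Dop (2%:~R) fB fa.
set d := - _ in Dl.
have DM := Mform_Dop fM; have f2M := Mform_mul fM fM.
have E : (fun z => 1 * Dop 2%:~R f z + - (d / a ^+ 2) * (f z * f z)) = fun=> 0.
  apply: (@Mform_small_cusp 4) => //; first exact: Mform_lin DM f2M.
  have := qlimD (qlimZ 1 Dl) (qlimZ (- (d / a ^+ 2)) (qlimM fa fa)).
  by rewrite (_ : 1 * d + - (d / a ^+ 2) * (a * a) = 0) //; field.
have [PB Pl] := Pfun_BB R.
pose u z := twopii R * (d / a ^+ 2 * f z - Cr 2%:~R * P z).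
have uB : BB u by apply: BBZ; apply: BBB; apply: BBZ.
have fd z : 0 < Im z -> cdv f z (u z * f z).
  move=> z0; apply: cdv_eq (cderivP (BB_holH fB) z0) _.
  have := congr1 (fun F => F z) E; rewrite Dop_DopQ // /DopQ mul1r => /eqP.
  rewrite mulNr subr_eq0 => /eqP H.
  have -> : cderiv f z = twopii R * ((twopii R)^-1 * cderiv f z + Cr 2%:~R * P z * f z - Cr 2%:~R * P z * f z).
    by field; exact: twopii_neq0.
  by rewrite H /u; ring.
have i0' : 0 < Im (iC R) by rewrite /= ltr01.
have fi : f (iC R) = 0.
  case: (fM) => _ [_ [_ fT]]; have := fT _ SL2_S _ i0'.
  have -> : mob Sm (iC R) = iC R.
    rewrite mob_S; apply: (mulIf (iC_neq0 R)); rewrite mulNr mulVf ?iC_neq0 //.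
    by rewrite iC_sqr.
  rewrite jfac_S -[_ ^ 2]/(iC R ^+ 2) expr2 iC_sqr mulN1r => H.
  have : f (iC R) *+ 2 == 0 by rewrite mulr2n {1}H addNr.
  by rewrite -mulr_natr mulf_eq0 pnatr_eq0 orbF => /eqP.
case: (fM) => _ [_ [fo _]]; apply: offH0_ext fo _ _ => // z z0.
exact: linear_ode_zero uB fd i0' fi z z0.
Qed.

Definition fdim (S : (C R -> C R) -> Prop) (d : nat) := exists b : 'I_d -> C R -> C R,
  [/\ forall i, S (b i),
      forall c : 'I_d -> C R, (fun z => \sum_i c i * b i z) = (fun=> 0) -> forall i, c i = 0
    & forall F, S F -> exists c : 'I_d -> C R, F = fun z => \sum_i c i * b i z].

Lemma fdim0 j : (forall f, Mform j f -> f = fun=> 0) -> fdim (@Mform R j) 0.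
Proof.
move=> H; exists (fun=> fun=> 0); split; [by case|by move=> c _; case|].
by move=> F /H ->; exists (fun=> 0); apply/funext => z; rewrite big_ord0.
Qed.

Lemma qlim_sum0 d (b : 'I_d -> C R -> C R) (c : 'I_d -> C R) : (forall i, qlim (b i) 0) ->
  qlim (fun z => \sum_i c i * b i z) 0.
Proof.
elim: d b c => [|d IH] b c b0.
  by apply: qlim_ext (qlim_cst 0) => z _; rewrite big_ord0.
have := qlimD (qlimZ (c ord0) (b0 ord0)) (IH _ (fun i => c (lift ord0 i)) (fun i => b0 (lift ord0 i))).
by rewrite mulr0 addr0; apply: qlim_ext => z _; rewrite big_ord_recl.
Qed.

(** The forms of weight [j] are the multiples of [e] plus [Delta] times the forms of weight
    [j - 12]: subtracting a multiple of [e] makes any form vanish at the cusp. *)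
Lemma fdim_step j d e a : Mform j e -> qlim e a -> a != 0 -> fdim (@Mform R (j - 12)) d ->
  fdim (@Mform R j) d.+1.
Proof.
move=> eM ea a0 [b [bM bi bs]]; have [DB D0] := Delta_BB.
pose b' (i : 'I_d.+1) := if unlift ord0 i is Some k then fun z => b k z * Delta z else e.
have b'0 : b' ord0 = e by rewrite /b' unlift_none.
have b'S k : b' (lift ord0 k) = fun z => b k z * Delta z by rewrite /b' liftK.
have bDlim k : qlim (fun z => b k z * Delta z) 0.
  by have [l bl] := BB_qlim (Mform_BB (bM k)); have := qlimM bl D0; rewrite mulr0.
have sumE (c : 'I_d.+1 -> C R) z : \sum_i c i * b' i z =
    c ord0 * e z + \sum_k c (lift ord0 k) * (b k z * Delta z).
  by rewrite big_ord_recl b'0; congr (_ + _); apply: eq_bigr => k _; rewrite b'S.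
exists b'; split.
- move=> i; case: (unliftP ord0 i) => [k ->|->]; last by rewrite b'0.
  by rewrite b'S; have := Mform_mul (bM k) Mform_Delta; rewrite subrK.
- move=> c E.
  have c0 : c ord0 = 0.
    have H := qlimD (qlimZ (c ord0) ea) (qlim_sum0 (fun k => c (lift ord0 k)) bDlim).
    have : c ord0 * a + 0 = 0.
      apply: qlim_uniq H _; apply: qlim_ext (qlim_cst 0) => z _.
      by rewrite -sumE; have := congr1 (fun F => F z) E.
    by rewrite addr0 => /eqP; rewrite mulf_eq0 (negbTE a0) orbF => /eqP.
  have ck : forall k, c (lift ord0 k) = 0.
    apply: bi; apply: offH0_ext => // [z z0|z z0].
      by rewrite big1 // => k _; rewrite (Mform_ext_off (bM k) z0) mulr0.
    have := congr1 (fun F => F z) E; rewrite /= sumE c0 mul0r add0r.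
    have -> : \sum_k c (lift ord0 k) * (b k z * Delta z) = (\sum_k c (lift ord0 k) * b k z) * Delta z.
      by rewrite mulr_suml; apply: eq_bigr => k _; rewrite mulrA.
    by move/eqP; rewrite mulf_eq0 (negbTE (Delta_neq0 z0)) orbF => /eqP.
  by move=> i; case: (unliftP ord0 i) => [k ->|->].
move=> F FM; have [l Fl] := BB_qlim (Mform_BB FM).
have [|h hM hE] := @Mform_cusp j (fun z => 1 * F z + - (l / a) * e z) (Mform_lin _ _ FM eM).
  have := qlimD (qlimZ 1 Fl) (qlimZ (- (l / a)) ea).
  by rewrite (_ : 1 * l + - (l / a) * a = 0) //; field.
have [c hc] := bs h hM.
exists (fun i => if unlift ord0 i is Some k then c k else l / a).
apply/funext => z; rewrite sumE unlift_none.
have -> : \sum_k (if unlift ord0 (lift ord0 k) is Some k then c k else l / a) * (b k z * Delta z)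
   = h z * Delta z.
  by rewrite hc mulr_suml; apply: eq_bigr => k _; rewrite liftK mulrA.
by have := congr1 (fun F => F z) hE; rewrite /= => <-; ring.
Qed.

(** A monomial in [X] and [Dop 4 X], of weights 4 and 6, both nonzero at the cusp. Taking [b] as the
    parity of [k] solves [k = 2 a + 3 b] for every [k] other than 1. *)
Lemma Eisenstein_exists (k : nat) : k != 1%N -> exists e a, [/\ Mform (2 * k)%N%:Z e, qlim e a & a != 0].
Proof.
move=> k1.
have [XB Xl] := X_BB.
have [YB Yl] := BB_Dop (4%:~R) XB Xl; have YM := Mform_Dop Mform_X.
set y := - _ in Yl.
have x0 : (144^-1 : C R) != 0 by rewrite invr_eq0 pnatr_eq0.
have y0 : y != 0.
  rewrite /y oppr_eq0 mulf_neq0 ?invr_eq0 ?pnatr_eq0 // mulf_neq0 // Cr_eq0.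
  by rewrite intr_eq0.
pose b := odd k; pose a := (k - 3 * b)./2.
have kE : k = (2 * a + 3 * b)%N.
  by rewrite /a /b; move: k1; clear; lia.
exists (fun z => cut (fun z => X z ^+ a) z * cut (fun z => Dop 4%:~R X z ^+ b) z), (144^-1 ^+ a * y ^+ b); split.
- have := Mform_mul (Mform_expr a Mform_X) (Mform_expr b YM).
  by rewrite weight_combination -kE.
- by apply: qlim_ext (qlimM (qlimX a Xl) (qlimX b Yl)) => z z0; rewrite !cutE.
by rewrite mulf_neq0 // expf_neq0.
Qed.

Definition dimM (k : nat) := if (k %% 6 == 1)%N then (k %/ 6)%N else (k %/ 6).+1.

Lemma Mform_dim (k : nat) : fdim (@Mform R (2 * k)%N%:Z) (dimM k).
Proof.
have [n] := ubnP k; elim: n k => // n IH k; rewrite ltnS => kn.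
have [->|k1] := eqVneq k 1%N; first by apply: fdim0 => f; exact: Mform2_0.
have [e [a [eM ea a0]]] := Eisenstein_exists k1.
have [k6|k6] := ltnP k 6.
  have -> : dimM k = 1%N by rewrite /dimM modn_small // divn_small // (negbTE k1).
  apply: fdim_step eM ea a0 _; apply: fdim0 => f.
  have -> : (2 * k)%N%:Z - 12 = - (11 - 2 * k).+1%:Z by lia.
  exact: Mform_neg.
have -> : dimM k = (dimM (k - 6)).+1.
  rewrite /dimM -{1 2 3}(subnK k6) modnDr divnDr // divnn /= addn1.
  by case: ifP.
apply: fdim_step eM ea a0 _.
have -> : (2 * k)%N%:Z - 12 = (2 * (k - 6))%N%:Z by lia.
by apply: IH; lia.
Qed.

End Discriminant.
End Quasimodular.
End ModularForms.

(** * Vector-valued modular forms *)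

Section Representations.
Variable R : realType.
Implicit Types (rho : 'M[int]_2 -> 'M[C R]_2) (a b c : C R) (g : 'M[int]_2).

Lemma cpow_1 (k : R) : cpow (1 : C R) k = 1.
Proof.
rewrite /cpow oner_eq0.
have -> : cabs (1 : C R) = 1 by rewrite /cabs /= expr1n expr0n addr0 sqrtr1.
rewrite /Arg lexx.
have -> : cabs (1 : C R) = 1 by rewrite /cabs /= expr1n expr0n addr0 sqrtr1.
by rewrite /= divr1 acos1 mulr0 cos0 sin0 powR1 mulr1 mulr0.
Qed.

(** If [rho T] were scalar, an eigenvector of [rho S] would span a line stable under both
    generators, hence under the whole group. Eigenvectors are taken for transposes to match the row
    space convention for subspaces. *)
Lemma rep_scalar_reducible rho a : is_rep rho -> rep_irreducible rho -> rho Tm != a%:M.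
Proof.
move=> [r1 rM] [_ irr]; apply/eqP => rT.
have [b /eigenvalueP[v vb v0]] := eigenvalue_closed (rho Sm)^T isT.
have vst g : isSL2 g -> (v *m (rho g)^T <= v)%MS.
  move: g; apply: SL2_gen => [|g gs IH|g gs IH]; first by rewrite r1 trmx1 mulmx1.
    by rewrite (rM _ _ (SL2_T) gs) rT mul_scalar_mx linearZ -scalemxAr scalemx_sub.
  rewrite (rM _ _ SL2_S gs) trmx_mul mulmxA (submx_trans (submxMr _ IH)) // vb.
  exact: scalemx_sub.
have inv : rep_invariant rho <<v>>%MS.
  move=> g gs; have E : (<<v>> *m (rho g)^T <= v *m (rho g)^T)%MS by rewrite submxMr // genmxE.
  apply: submx_trans E _.
  by rewrite genmxE vst.
case: (irr _ inv) => [/andP[]|].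
  by rewrite genmxE submx0 (negbTE v0).
by rewrite -col_leq_rank mxrank_gen; have := rank_leq_row v; case: (\rank v) => [|[|]].
Qed.

Lemma unitary_row (U : 'M[C R]_2) i : unitary_mx U -> cabs (U i i0) ^+ 2 + cabs (U i i1) ^+ 2 = 1.
Proof.
move=> /matrixP /(_ i i); rewrite !mxE eqxx sum2 !mxE => E.
have := congr1 (@Re R) E; rewrite ReD !ReM /= !cabs_sqr => <-; ring.
Qed.

(** In the Frobenius norm, [|U - a|^2] is [|U|^2] minus twice the real part of [conj a * tr U] plus
    [2 |a|^2], that is [2 - 4 + 2 = 0]. No diagonalization of unitary matrices is involved. *)
Lemma unitary_double_eigenvalue (U : 'M[C R]_2) a : unitary_mx U -> cabs a = 1 ->
  \tr U = a *+ 2 -> U = a%:M.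
Proof.
move=> Uu a1 tr.
have r0 := unitary_row i0 Uu; have r1 := unitary_row i1 Uu.
have s : U i0 i0 + U i1 i1 = a *+ 2 by rewrite -tr /mxtrace sum2.
have a2 : cabs a ^+ 2 = 1 by rewrite a1 expr1n.
have [re im] : Re (U i0 i0) + Re (U i1 i1) = Re a *+ 2 /\
    Im (U i0 i0) + Im (U i1 i1) = Im a *+ 2.
  by rewrite -ReD -ImD s !mulr2n ReD ImD.
have sq (w : C R) : 0 <= cabs w ^+ 2 by exact: sqr_ge0.
have S : cabs (U i0 i0 - a) ^+ 2 + cabs (U i1 i1 - a) ^+ 2 +
    (cabs (U i0 i1) ^+ 2 + cabs (U i1 i0) ^+ 2) = 0.
  move: r0 r1 a2 re im; rewrite !cabs_sqr !ReD !ImD !ReN !ImN.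
  move: (Re (U i0 i0)) (Im (U i0 i0)) (Re (U i1 i1)) (Im (U i1 i1)).
  move: (Re a) (Im a).
  move=> x y p1 p2 s1 s2 r0 r1 a2 re im.
  have e1 : s1 = x *+ 2 - p1 by rewrite -re addrC addKr.
  have e2 : s2 = y *+ 2 - p2 by rewrite -im addrC addKr.
  by rewrite e1 e2 in r1 *; lra.
have z (w : C R) : cabs w ^+ 2 <= 0 -> w = 0.
  move=> h; apply/eqP; rewrite -cabs_eq0 -sqrf_eq0; apply/eqP/le_anti; by rewrite h sq.
have := sq (U i0 i0 - a); have := sq (U i1 i1 - a); have := sq (U i0 i1); have := sq (U i1 i0).
move=> h1 h2 h3 h4.
have e1 : U i0 i0 = a by apply/subr0_eq/z; lra.
have e2 : U i1 i1 = a by apply/subr0_eq/z; lra.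
have e3 : U i0 i1 = 0 by apply/z; lra.
have e4 : U i1 i0 = 0 by apply/z; lra.
by apply/matrixP; apply: ord2P; apply: ord2P; rewrite mxE ?e1 ?e2 ?e3 ?e4 ?mulr1n.
Qed.

Lemma eigenvalues_distinct rho a b : is_rep rho -> rep_irreducible rho -> T_unitarizable rho ->
  cabs a = 1 -> char_poly (rho Tm) = ('X - a%:P) * ('X - b%:P) -> a != b.
Proof.
move=> rep irr [P [Pu PU]] a1 ch; apply/eqP => ab; rewrite -ab in ch.
have tr : \tr (rho Tm) = a *+ 2.
  apply: oppr_inj; rewrite -char_poly_trace // ch mulrBl !mulrBr !coefB !coefCM !coefMC coefC.
  by rewrite !coefX coefXM coefX /= mul1r mulr1 mulr0 subr0 sub0r mulr2n opprD.
have E := unitary_double_eigenvalue PU a1.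
have := E _; rewrite mxtrace_mulC mulmxA mulVmx // mul1mx => /(_ tr) EP.
have : rho Tm = a%:M.
  have -> : rho Tm = invmx P *m (P *m rho Tm *m invmx P) *m P by rewrite -mulmxA mulmxKV // mulKmx.
  by rewrite EP scalar_mxC mulmxKV.
by apply/eqP; exact: rep_scalar_reducible.
Qed.

(** Left eigenvectors, because the scalar function [v F] is then multiplied by a constant under
    [T]. *)
Lemma eigen_basis (A : 'M[C R]_2) a b : char_poly A = ('X - a%:P) * ('X - b%:P) -> a != b ->
  exists v w : 'rV[C R]_2, [/\ v *m A = a *: v, w *m A = b *: w &
    v 0 i0 * w 0 i1 - v 0 i1 * w 0 i0 != 0].
Proof.
move=> ch ab.
have /eigenvalueP[v vA v0] : eigenvalue A a by rewrite eigenvalue_root_char ch rootM !root_XsubC eqxx.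
have /eigenvalueP[w wA w0] : eigenvalue A b by rewrite eigenvalue_root_char ch rootM !root_XsubC eqxx orbT.
exists v, w; split=> //; apply: contra_neq w0 => d0.
have par i : w 0 i *: v = v 0 i *: w.
  apply/matrixP => k j; rewrite !mxE (ord1 k); move: i j; apply: ord2P; apply: ord2P => //.
  - by rewrite mulrC.
  - by apply/eqP; rewrite eq_sym -subr_eq0 mulrC (mulrC (w _ _)) -d0; apply/eqP; ring.
  - by apply/eqP; rewrite -subr_eq0 -d0; apply/eqP; ring.
  - by rewrite mulrC.
apply/matrixP => k i; rewrite (ord1 k) mxE; apply/eqP.
have : (a - b) *: (w 0 i *: v) = 0.
  rewrite scalerBl {2}par !scalerA (mulrC a) (mulrC b) -!scalerA -vA -wA !scalemxAl par subrr //.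
by move/eqP; rewrite !scaler_eq0 subr_eq0 (negbTE ab) (negbTE v0) orbF.
Qed.

Lemma SL2_inv g : isSL2 g -> exists2 h, isSL2 h & g *m h = 1%:M.
Proof.
move=> gs; exists (mk22 (g i1 i1) (- g i0 i1) (- g i1 i0) (g i0 i0)).
  by apply/isSL2_mk; move: gs; rewrite /isSL2 det2 => <-; ring.
rewrite {1}(mk22_eta g) mk22_mul; move: gs; rewrite /isSL2 det2 => gs.
apply/matrixP; apply: ord2P; apply: ord2P; rewrite !mxE //=; try ring.
  by rewrite -gs; ring.
by rewrite -gs; ring.
Qed.

Lemma rep_det_neq0 rho g : is_rep rho -> isSL2 g -> \det (rho g) != 0.
Proof.
move=> [r1 rM] gs; have [h hs gh] := SL2_inv gs.
have := congr1 determinant (rM g h gs hs); rewrite gh r1 det1 det_mulmx => E.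
by apply: contra_eq_neq E => ->; rewrite mul0r oner_neq0.
Qed.

End Representations.

(** * Expansions of vector components and Wronskians *)

Section VectorValued.
Variable R : realType.
Implicit Types (f h : C R -> C R) (F G : C R -> 'cV[C R]_2) (v : 'rV[C R]_2) (z : C R) (g : 'M[int]_2).
Implicit Types (k l s : R).
Local Notation P := (@Defs.Pfun R).

Section Slash.
Variables (rho : 'M[int]_2 -> 'M[C R]_2) (u : 'M[int]_2 -> C R).
Hypothesis u1 : forall g, isSL2 g -> cabs (u g) = 1.

Lemma HspaceE k F : Hspace rho u k F <-> [/\ forall i, holH (fun z => F z i 0),
  forall i, moderate (fun z => F z i 0), offH0 F &
  forall g, isSL2 g -> forall z, 0 < Im z -> forall i,
    F (mob g z) i 0 = u g * cpow (jfac g z) k * (rho g i i0 * F z i0 0 + rho g i i1 * F z i1 0)].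
Proof.
have nz g z : isSL2 g -> 0 < Im z -> u g * cpow (jfac g z) k != 0.
  move=> gs z0; apply: mulf_neq0; last exact/cpow_neq0/jfac_neq0.
  by rewrite -cabs_eq0 u1 // oner_neq0.
have E g z i : (rho g *m F z) i 0 = rho g i i0 * F z i0 0 + rho g i i1 * F z i1 0.
  by rewrite mxE sum2.
split=> [[hF [mF [oF T]]]|[hF mF oF T]].
  split=> //; first by move=> i; apply/holoHP/hF.
  move=> g gs z z0 i; have := congr1 (fun M : 'cV_2 => M i 0) (T g gs z z0).
  rewrite E mxE -invfM => <-; rewrite mulrA mulfV ?mul1r //; exact: nz.
split; first by move=> i; apply/holoHP/hF.
do 2![split=> //] => g gs z z0; apply/matrixP => i j; rewrite (ord1 j) E mxE -invfM T // mulrA.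
by rewrite mulVf ?mul1r //; exact: nz.
Qed.

Lemma Hspace_0 k : Hspace rho u k (fun=> 0).
Proof.
have E i : (fun z : C R => (0 : 'cV[C R]_2) i 0) = fun=> 0 by apply/funext => z; rewrite mxE.
apply/HspaceE; split=> // [i|i|g gs z z0 i]; rewrite ?E ?mxE.
- by move=> z _; eexists; exact: cdv_cst.
- exact: BB_moderate (BB_cst 0).
- by rewrite !mulr0 addr0 mulr0.
Qed.

End Slash.

Section Expansions.
Variables (v w : 'rV[C R]_2) (l1 l2 : R).
Hypothesis vw : v 0 i0 * w 0 i1 - v 0 i1 * w 0 i0 != 0.
Hypotheses (l1p : 0 <= l1) (l2p : 0 <= l2).

Definition vdot v F z := v 0 i0 * F z i0 0 + v 0 i1 * F z i1 0.

(** The analytic half of membership in [Hspace], free of weight and group: it yields holomorphy and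
    moderate growth of the entries and is preserved by [D] in any weight. *)
Definition expandable F := exists h1 h2, [/\ BB h1, BB h2,
  forall z, 0 < Im z -> vdot v F z = qq l1 z * h1 z &
  forall z, 0 < Im z -> vdot w F z = qq l2 z * h2 z].

Lemma expandable_entry F : expandable F -> forall i, exists a b h1 h2, [/\ BB h1, BB h2 &
  forall z, 0 < Im z -> F z i 0 = a * (qq l1 z * h1 z) + b * (qq l2 z * h2 z)].
Proof.
move=> [h1 [h2 [B1 B2 E1 E2]]]; have d0 := vw; set d := _ - _ in d0; apply: ord2P.
  exists (w 0 i1 / d), (- v 0 i1 / d), h1, h2; split=> // z z0.
  by rewrite -E1 // -E2 // /vdot /d; field.
exists (- w 0 i0 / d), (v 0 i0 / d), h1, h2; split=> // z z0.
by rewrite -E1 // -E2 // /vdot /d; field.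
Qed.

Lemma expandable_holH F i : expandable F -> holH (fun z => F z i 0).
Proof.
move=> /expandable_entry /(_ i) [a [b [h1 [h2 [/BB_holH H1 /BB_holH H2 E]]]]].
have H : holH (fun z => a * (qq l1 z * h1 z) + b * (qq l2 z * h2 z)).
  move=> z z0; have [d1 c1] := H1 z z0; have [d2 c2] := H2 z z0; eexists.
  exact: cdvD (cdv_cstM a (cdvM (cdv_qq l1 z) c1)) (cdv_cstM b (cdvM (cdv_qq l2 z) c2)).
by apply: holH_ext H => z z0; rewrite E.
Qed.

Lemma qq_bounded s z : 0 <= s -> 0 <= Im z -> cabs (qq s z) <= 1.
Proof.
move=> s0 z0; rewrite cabs_qq -[leRHS]expR0 ler_expR oppr_le0.
by rewrite !mulr_ge0 // ltW // pi_gt0.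
Qed.

Lemma expandable_moderate F i : expandable F -> moderate (fun z => F z i 0).
Proof.
move=> /expandable_entry /(_ i) [a [b [h1 [h2 [[_ _ [y1 [K1 [y10 K10 H1]]]] [_ _ [y2 [K2 [y20 K20 H2]]]] E]]]]].
apply: (@moderate_of_bounded _ _ (Num.max y1 y2) (cabs a * K1 + cabs b * K2)).
  by rewrite lt_max y10.
move=> z; rewrite ge_max => /andP[z1 z2].
have z0 : 0 < Im z by exact: lt_le_trans z1.
rewrite E //; apply: le_trans (cabsD _ _) _; rewrite (cabsM a) (cabsM b) (cabsM (qq l1 z)) (cabsM (qq l2 z)).
apply: lerD; apply: ler_wpM2l; rewrite ?cabs_ge0 //.
  rewrite -[leRHS]mul1r; apply: ler_pM; rewrite ?cabs_ge0 ?H1 //; exact/qq_bounded/ltW.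
rewrite -[leRHS]mul1r; apply: ler_pM; rewrite ?cabs_ge0 ?H2 //; exact/qq_bounded/ltW.
Qed.

Lemma cderiv_vdot v' F z : (forall i, holH (fun z => F z i 0)) -> 0 < Im z ->
  cdv (vdot v' F) z (v' 0 i0 * cderiv (fun z => F z i0 0) z + v' 0 i1 * cderiv (fun z => F z i1 0) z).
Proof. by move=> hF z0; apply: cdvD; apply: cdv_cstM; exact: cderivP. Qed.

Lemma vdot_DV v' k F z : (forall i, holH (fun z => F z i 0)) -> 0 < Im z ->
  vdot v' (DV k F) z = DopQ k P (vdot v' F) z.
Proof.
move=> hF z0; rewrite /vdot !mxE !Dop_DopQ // /DopQ -/(vdot v' F).
have -> := cdv_cderiv (cderiv_vdot v' hF z0).
rewrite /vdot; move: (cderiv (fun z => F z i0 0) z) (cderiv (fun z => F z i1 0) z) (_^-1) (P z) => *; ring.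
Qed.

Lemma DopQ_qqM k l f h0 z : BB h0 -> (forall z, 0 < Im z -> f z = qq l z * h0 z) ->
  0 < Im z -> DopQ k P f z = qq l z * (Cr l * h0 z + Dop k h0 z).
Proof.
move=> B E z0; have h := BB_holH B.
have d := cdv_extH (fun w w0 => esym (E w w0)) z0 (cdvM (cdv_qq l z) (cderivP h z0)).
rewrite Dop_DopQ // /DopQ (cdv_cderiv d) E //; field; exact: twopii_neq0.
Qed.

Lemma expandable_DV k F : expandable F -> expandable (DV k F).
Proof.
move=> eF; have hF i : holH (fun z => F z i 0) by exact: expandable_holH.
have [h1 [h2 [B1 B2 E1 E2]]] := eF.
have [a1 q1] := BB_qlim B1; have [a2 q2] := BB_qlim B2.
have [D1 _] := BB_Dop k B1 q1; have [D2 _] := BB_Dop k B2 q2.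
exists (fun z => Cr l1 * h1 z + Dop k h1 z), (fun z => Cr l2 * h2 z + Dop k h2 z).
split; [exact: BBD (BBZ _ B1) D1|exact: BBD (BBZ _ B2) D2| |] => z z0; rewrite vdot_DV //.
  exact: DopQ_qqM.
exact: DopQ_qqM.
Qed.

End Expansions.

Definition wr (F G : C R -> 'cV[C R]_2) z := F z i0 0 * G z i1 0 - F z i1 0 * G z i0 0.

Lemma Pslash_holH g : isSL2 g -> holH (@Pslash R g).
Proof.
move=> gs z z0; have j0 := jfac_neq0 gs z0; have Ph := BB_holH (Pfun_BB R).1.
eexists; apply: cdvD.
  apply: cdvM; first by apply: cdvV; [exact: cdvX 2 (cdv_jfac g z)|rewrite expf_neq0].
  exact: cdv_comp (cdv_mob gs z0) (cderivP Ph (mob_H gs z0)).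
apply: cdv_cstM; apply: cdvV; last by rewrite mulf_neq0 // twopii_neq0.
exact: cdv_cstM (cdv_jfac g z).
Qed.

Lemma Dop_Dop_DopQ k l f z : holH (DopQ k P f) -> 0 < Im z ->
  Dop l (Dop k f) z = DopQ l P (DopQ k P f) z.
Proof.
move=> fh z0; rewrite Dop_DopQ //.
have E y : 0 < Im y -> DopQ k P f y = Dop k f y by move=> y0; rewrite Dop_DopQ.
have -> : DopQ l P (Dop k f) z = (twopii R)^-1 * cderiv (Dop k f) z + Cr l * P z * Dop k f z by [].
by rewrite (cdv_cderiv (cdv_extH E z0 (cderivP fh z0))) -E.
Qed.

Lemma DopQ_cderiv k (Q f : C R -> C R) z :
  cderiv f z = twopii R * (DopQ k Q f z - Cr k * Q z * f z).
Proof. by rewrite /DopQ addrK mulrA mulfV ?mul1r // twopii_neq0. Qed.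

(** The terms in [M] cancel by antisymmetry. [Q] is arbitrary so that the formula serves both [P]
    and [Pslash g]. *)
Lemma wronskian_derivative k (Q M a b : C R -> C R) z :
  holH a -> holH b -> holH (DopQ k Q a) -> holH (DopQ k Q b) ->
  DopQ (k + 2) Q (DopQ k Q a) z + M z * a z = 0 ->
  DopQ (k + 2) Q (DopQ k Q b) z + M z * b z = 0 -> 0 < Im z ->
  cdv (fun z => a z * DopQ k Q b z - b z * DopQ k Q a z) z
    (- (Cr (2 * k + 2) * twopii R * Q z * (a z * DopQ k Q b z - b z * DopQ k Q a z))).
Proof.
move=> ha hb hA hB Ea Eb z0.
have dA := DopQ_cderiv (k + 2) Q (DopQ k Q a) z; have dB := DopQ_cderiv (k + 2) Q (DopQ k Q b) z.
have da := DopQ_cderiv k Q a z; have db := DopQ_cderiv k Q b z.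
have {}Ea : DopQ (k + 2) Q (DopQ k Q a) z = - (M z * a z) by apply/eqP; rewrite -addr_eq0 Ea.
have {}Eb : DopQ (k + 2) Q (DopQ k Q b) z = - (M z * b z) by apply/eqP; rewrite -addr_eq0 Eb.
rewrite Ea in dA; rewrite Eb in dB.
apply: cdv_eq (cdvB (cdvM (cderivP ha z0) (cderivP hB z0)) (cdvM (cderivP hb z0) (cderivP hA z0))) _.
rewrite dA dB da db !CrD CrM Cr_nat; move: (DopQ k Q a z) (DopQ k Q b z) (twopii R) => A B t; ring.
Qed.

End VectorValued.

Section Modules.
Variable R : realType.
Implicit Types (f h : C R -> C R) (F G : C R -> 'cV[C R]_2) (z : C R) (g : 'M[int]_2) (k l : R).
Local Notation P := (@Defs.Pfun R).

Lemma moderate_lin (a b : C R) f h : moderate f -> moderate h -> moderate (fun z => a * f z + b * h z).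
Proof.
move=> [N1 [c1 [N10 [c10 H1]]]] [N2 [c2 [N20 [c20 H2]]]].
pose K := cabs a + cabs b; have K0 : 0 <= K by rewrite addr_ge0 ?cabs_ge0.
exists (Num.max N1 N2 + 1), (Num.max (Num.max c1 c2) (Num.max 1 K)); split.
  by rewrite addr_gt0 // lt_max N10.
split; first by rewrite !lt_max c10.
move=> z; rewrite !gt_max => /andP[/andP[z1 z2] /andP[y1 yK]].
set y := Im z in z1 z2 y1 yK *.
have b1 : y `^ N1 <= y `^ Num.max N1 N2 by apply: ler_powR; rewrite ?(ltW y1) // le_max lexx.
have b2 : y `^ N2 <= y `^ Num.max N1 N2 by apply: ler_powR; rewrite ?(ltW y1) // le_max lexx orbT.
rewrite powRD; last by apply/implyP => _; rewrite gt_eqF // (lt_trans ltr01).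
rewrite powRr1; last by rewrite ltW // (lt_trans ltr01).
apply: le_trans (cabsD _ _) _; rewrite (cabsM a) (cabsM b) [leRHS]mulrC.
apply: (@le_trans _ _ (K * y `^ Num.max N1 N2)).
  rewrite [leRHS]mulrDl; apply: lerD; apply: ler_wpM2l; rewrite ?cabs_ge0 //.
    exact: le_trans (H1 z z1) b1.
  exact: le_trans (H2 z z2) b2.
by rewrite ler_wpM2r ?powR_ge0 // ltW.
Qed.

Lemma quasi_periodic_expansion f l : holH f -> moderate f -> l < 1 ->
  (forall z, 0 < Im z -> f (z + 1) = ee l * f z) ->
  exists2 h, BB h & forall z, 0 < Im z -> f z = qq l z * h z.
Proof.
move=> fh fm l1 ft; exists (fun z => f z * qq (- l) z); last first.
  by move=> z z0; rewrite mulrCA qqN mulfV ?mulr1 // qq_neq0.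
apply: BB_of_growth1; last exact: moderate_growth1.
  by move=> z z0; have [d fd] := fh z z0; eexists; exact: cdvM fd (cdv_qq _ z).
move=> z z0; rewrite ft // qq_shift mulrACA.
by rewrite (_ : ee l * ee (- l) = 1) ?mul1r // eeN mulfV // ee_neq0.
Qed.

Section Main.
Variables (rho : 'M[int]_2 -> 'M[C R]_2) (u : 'M[int]_2 -> C R).
Variables (v w : 'rV[C R]_2) (a b : C R) (l1 l2 : R).
Hypothesis rep : is_rep rho.
Hypothesis u1 : forall g, isSL2 g -> cabs (u g) = 1.
Hypotheses (vT : v *m rho Tm = a *: v) (wT : w *m rho Tm = b *: w).
Hypotheses (ua : u Tm * a = ee l1) (ub : u Tm * b = ee l2).
Hypothesis vw : v 0 i0 * w 0 i1 - v 0 i1 * w 0 i0 != 0.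
Hypotheses (l1I : 0 <= l1 < 1) (l2I : 0 <= l2 < 1) (l12 : l1 != l2).

Let l1p : 0 <= l1. Proof. by case/andP: l1I. Qed.
Let l2p : 0 <= l2. Proof. by case/andP: l2I. Qed.
Local Notation expd := (expandable v w l1 l2).

Lemma Hspace_expansion k F v' c l : Hspace rho u k F -> v' *m rho Tm = c *: v' -> u Tm * c = ee l ->
  l < 1 -> exists2 h, BB h & forall z, 0 < Im z -> vdot v' F z = qq l z * h z.
Proof.
move=> /(HspaceE rho u1)[hF mF oF T] vc uc l_1; apply: quasi_periodic_expansion => //.
- by move=> z z0; eexists; exact: cderiv_vdot.
- exact: moderate_lin.
move=> z z0; have E' := T _ SL2_T z z0; rewrite mob_T jfac_T cpow_1 mulr1 in E'.
rewrite /vdot !E' -uc.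
have E j : v' 0 i0 * rho Tm i0 j + v' 0 i1 * rho Tm i1 j = c * v' 0 j.
  by have := congr1 (fun M : 'rV_2 => M 0 j) vc; rewrite !mxE sum2.
transitivity (u Tm * ((v' 0 i0 * rho Tm i0 i0 + v' 0 i1 * rho Tm i1 i0) * F z i0 0 +
  (v' 0 i0 * rho Tm i0 i1 + v' 0 i1 * rho Tm i1 i1) * F z i1 0)); first by ring.
by rewrite !E; ring.
Qed.

Lemma Hspace_expandable k F : Hspace rho u k F -> expd F.
Proof.
move=> HF; have [_ q1] := andP l1I; have [_ q2] := andP l2I.
have [h1 B1 E1] := Hspace_expansion HF vT ua q1.
have [h2 B2 E2] := Hspace_expansion HF wT ub q2.
by exists h1, h2.
Qed.

Lemma wr_vdot F G z : vdot v F z * vdot w G z - vdot w F z * vdot v G z =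
  (v 0 i0 * w 0 i1 - v 0 i1 * w 0 i0) * wr F G z.
Proof. by rewrite /vdot /wr; ring. Qed.

Lemma wr_expansion F G : expd F -> expd G -> exists2 h, BB h &
  forall z, 0 < Im z -> wr F G z = qq (l1 + l2) z * h z.
Proof.
move=> [f1 [f2 [B1 B2 E1 E2]]] [h1 [h2 [D1 D2 H1 H2]]].
pose d := v 0 i0 * w 0 i1 - v 0 i1 * w 0 i0.
exists (fun z => d^-1 * (f1 z * h2 z + -1 * (f2 z * h1 z))).
  exact: BBZ (BBD (BBM B1 D2) (BBZ _ (BBM B2 D1))).
move=> z z0; apply: (mulfI vw); rewrite -wr_vdot E1 // E2 // H1 // H2 // qqD.
by rewrite -/d; field.
Qed.

(** * The Wronskian of F0 and its consequences *)

Section Wronskian.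
Variables (k0 : R) (F0 : C R -> 'cV[C R]_2) (M : C R -> C R).
Hypothesis k0E : k0 = 6 * (l1 + l2) - 1.
Hypothesis HF0 : Hspace rho u k0 F0.
Hypothesis MM : Mform 4 M.
Hypothesis ode : forall i z, 0 < Im z ->
  Dop (k0 + 2) (Dop k0 (fun z => F0 z i 0)) z + M z * F0 z i 0 = 0.
Hypothesis indep : forall c : 'I_2 -> C R,
  (fun z => \sum_i c i * F0 z i 0) = (fun=> 0) -> forall i, c i = 0.

Lemma vdot_neq0 (v' : 'rV[C R]_2) : v' != 0 -> exists2 z, 0 < Im z & vdot v' F0 z != 0.
Proof.
move=> v0; apply: contrapT => H; move/negP: v0; apply; apply/eqP/matrixP => i j.
rewrite (ord1 i) mxE; apply: (indep (c := fun i => v' 0 i)) => {i j}; apply/funext => z; rewrite sum2.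
have [z0|z0] := ltP 0 (Im z); last first.
  by case/(HspaceE rho u1): HF0 => _ _ -> //; rewrite !mxE !mulr0 addr0.
by apply: contrapT => /eqP h; apply: H; exists z.
Qed.

Lemma leading_expansion (v' : 'rV[C R]_2) l h : v' != 0 -> BB h ->
  (forall z, 0 < Im z -> vdot v' F0 z = qq l z * h z) ->
  exists n p c, [/\ BB p, qlim p c, c != 0 &
    forall z, 0 < Im z -> vdot v' F0 z = qq (l + n%:R) z * p z].
Proof.
move=> v0 hB E; have [z z0] := vdot_neq0 v0; rewrite E // mulf_eq0 negb_or => /andP[_ /eqP hz].
have [n [p [c [pB pc c0 hE]]]] := BB_order hB z0 hz; exists n, p, c; split=> // y y0.
by rewrite E // hE // qqD mulrA.
Qed.

Local Notation W := (wr F0 (DV k0 F0)).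

(** If the two eigencomponents start with [c1 q^s1] and [c2 q^s2], the leading coefficient of the
    Wronskian is a nonzero multiple of [(s2 - s1) c1 c2], since the contributions of [P] cancel.
    Equal exponents would make [l1] and [l2] congruent modulo 1, hence equal. *)
Lemma wronskian_neq0 : exists2 z, 0 < Im z & W z != 0.
Proof.
apply: contrapT => H.
have W0 z : 0 < Im z -> W z = 0.
  by move=> z0; apply: contrapT => /eqP h; apply: H; exists z.
have eF := Hspace_expandable HF0; have hF i : holH (fun z => F0 z i 0) by exact: expandable_holH vw _ _ eF.
have [h1 [h2 [B1 B2 E1 E2]]] := eF.
have v0 : v != 0 by apply: contraNneq vw => ->; rewrite !mxE !mul0r subr0.
have w0 : w != 0 by apply: contraNneq vw => ->; rewrite !mxE !mulr0 subr0.
have [n1 [p1 [c1 [P1 L1 c10 {}E1]]]] := leading_expansion v0 B1 E1.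
have [n2 [p2 [c2 [P2 L2 c20 {}E2]]]] := leading_expansion w0 B2 E2.
have [_ D1] := BB_Dop k0 P1 L1; have [_ D2] := BB_Dop k0 P2 L2.
pose s1 := l1 + n1%:R; pose s2 := l2 + n2%:R.
have Z z : 0 < Im z -> 0 = p1 z * (Cr s2 * p2 z + Dop k0 p2 z) + -1 * (p2 z * (Cr s1 * p1 z + Dop k0 p1 z)).
  move=> z0; have := wr_vdot F0 (DV k0 F0) z; rewrite W0 // mulr0 !vdot_DV //.
  rewrite (DopQ_qqM _ P1 E1) // (DopQ_qqM _ P2 E2) // E1 // E2 //.
  have q1 := qq_neq0 s1 z; have q2 := qq_neq0 s2 z; rewrite -/s1 -/s2.
  set A := Cr s2 * _ + _; set B := Cr s1 * _ + _ => E.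
  apply: (mulfI (mulf_neq0 q1 q2)); rewrite mulr0 -E; ring.
have := qlimD (qlimM L1 (qlimD (qlimZ (Cr s2) L2) D2))
  (qlimZ (-1) (qlimM L2 (qlimD (qlimZ (Cr s1) L1) D1))).
move=> /(qlim_uniq (qlim_ext Z (qlim_cst 0))) E.
have {E} : (Cr s2 - Cr s1) * (c1 * c2) = 0 by rewrite [RHS]E; ring.
move/eqP; rewrite !mulf_eq0 (negbTE c10) (negbTE c20) !orbF subr_eq0 => /eqP /(congr1 (@Re R)) /= sE.
have : ee l1 = ee l2.
  have : ee s2 = ee s1 by rewrite sE.
  by rewrite /s1 /s2 !eeD !ee_nat !mulr1.
by move/ee_inj01 => /(_ l1I l2I) /eqP; rewrite (negbTE l12).
Qed.

Lemma comp_holH i : holH (fun z => F0 z i 0).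
Proof. apply: (expandable_holH vw); exact: Hspace_expandable HF0. Qed.

Lemma vdotD_holH v' : holH (vdot v' (DV k0 F0)).
Proof.
move=> z z0; eexists; apply: cderiv_vdot => // i.
have eD := expandable_DV vw k0 (Hspace_expandable HF0); exact: expandable_holH vw _ _ eD.
Qed.

Lemma DopQ_comp_holH i : holH (DopQ k0 P (fun z => F0 z i 0)).
Proof.
have eD := expandable_DV vw k0 (Hspace_expandable HF0).
have h : holH (fun z => DV k0 F0 z i 0) by exact: expandable_holH vw _ _ eD.
by apply: holH_ext h => z z0; rewrite mxE Dop_DopQ.
Qed.

Lemma ode_DopQ i z : 0 < Im z ->
  DopQ (k0 + 2) P (DopQ k0 P (fun z => F0 z i 0)) z + M z * F0 z i 0 = 0.
Proof. by move=> z0; have := ode i z0; rewrite Dop_Dop_DopQ //; exact: DopQ_comp_holH. Qed.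

(** The reason for the value of [k0]: the weight [2 k0 + 2] of the Wronskian is then that of
    [eta^(24 (l1 + l2))]. *)
Lemma weight_exponent : Cr (2 * k0 + 2) = 12 * Cr (l1 + l2).
Proof. by rewrite k0E -[12 in RHS]Cr_nat -CrM; congr Cr; ring. Qed.

Lemma wronskian_cdv z : 0 < Im z ->
  cdv W z (- (12 * Cr (l1 + l2)) * twopii R * P z * W z).
Proof.
move=> z0.
have E y : 0 < Im y -> F0 y i0 0 * DopQ k0 P (fun z => F0 z i1 0) y -
    F0 y i1 0 * DopQ k0 P (fun z => F0 z i0 0) y = W y.
  by move=> y0; rewrite /wr !mxE !Dop_DopQ.
have := wronskian_derivative (comp_holH i0) (comp_holH i1) (@DopQ_comp_holH i0) (@DopQ_comp_holH i1)
  (ode_DopQ i0 z0) (ode_DopQ i1 z0) z0.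
move=> /(cdv_extH (fun y y0 => E y y0) z0); rewrite (E z z0) weight_exponent.
by move/cdv_eq; apply; ring.
Qed.

Lemma wronskian_Efun : exists L c, [/\ BB L, qlim L 0,
  forall z, 0 < Im z -> cdv L z (P z + 12^-1), c != 0 &
  forall z, 0 < Im z -> W z = c * Efun L (l1 + l2) z].
Proof.
have [L [LB L0 LP]] := P_primitive R.
have [c E] := Efun_unique LP wronskian_cdv; exists L, c; split=> //.
by have [z z0] := wronskian_neq0; rewrite E //; apply: contraNneq => ->; rewrite mul0r.
Qed.

Lemma wronskian_nonzero z : 0 < Im z -> W z != 0.
Proof.
move=> z0; have [L [c [_ _ _ c0 E]]] := wronskian_Efun.
by rewrite E // mulf_neq0 // Efun_neq0.
Qed.

Lemma Pfun_quasimodular : quasimodular R.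
Proof.
move=> g gs z z0.
pose hh i := vdot (row i (rho g)) F0.
have hE i y : rho g i i0 * F0 y i0 0 + rho g i i1 * F0 y i1 0 = hh i y by rewrite /hh /vdot !mxE.
have hhol i : holH (hh i) by move=> y y0; eexists; exact: cderiv_vdot (comp_holH) y0.
have [_ _ _ T] := (HspaceE rho u1 _ _).1 HF0.
have Dh i y : 0 < Im y -> DopQ k0 P (hh i) y = vdot (row i (rho g)) (DV k0 F0) y.
  by move=> y0; rewrite vdot_DV //; exact: comp_holH.
(* The two operators differ by a multiple of the function itself, which drops out of the Wronskian
   in [WE]. *)
have DE i y : 0 < Im y -> DopQ k0 P (hh i) y + Cr k0 * ((Pslash g y - P y) * hh i y) = DopQ k0 (Pslash g) (hh i) y.
  by move=> y0; rewrite /DopQ; ring.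
have Ph : holH (@Pslash R g) by exact: Pslash_holH.
have P0 : holH P by apply: BB_holH; case: (Pfun_BB R).
have Dhol i : holH (DopQ k0 (Pslash g) (hh i)).
  apply: holH_ext (DE i) _ => y y0; have [d1 e1] := vdotD_holH (row i (rho g)) y0.
  have [d2 e2] := Ph y y0.
  have [d3 e3] := P0 y y0.
  have [d4 e4] := hhol i y y0.
  eexists; apply: cdvD (cdv_cstM _ (cdvM (cdvB e2 e3) e4)).
  exact: cdv_extH (fun w w0 => esym (Dh i w w0)) y0 e1.
pose N y := u g * cpow (jfac g y) k0.
have NF : is_factor k0 g N by exact: factor_cpow.
have st i y : 0 < Im y -> Dop k0 (fun z => F0 z i 0) (mob g y) =
    N y * jfac g y ^+ 2 * DopQ k0 (Pslash g) (hh i) y.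
  apply: Dop_transform => // [|x x0]; first exact: comp_holH.
  by rewrite T // hE.
(* The equation at [mob g z], pulled back to [z]: since [M] is modular of weight 4, a common factor
   [N z * jfac g z ^+ 4] can be removed. *)
have ode' i : DopQ (k0 + 2) (Pslash g) (DopQ k0 (Pslash g) (hh i)) z + M z * hh i z = 0.
  have D2 := Dop_transform gs (factor_step gs NF) _ (Dhol i) (st i) z0.
  have := ode i (mob_H gs z0); rewrite D2; last first.
    apply: holH_ext (@DopQ_comp_holH i) => y y0; by rewrite Dop_DopQ.
  case: MM => _ [_ [_ MT]]; rewrite MT // T // hE -/(N z) => E.
  have Nn : N z * jfac g z ^+ 4 != 0.
    rewrite mulf_neq0 // ?expf_neq0 ?jfac_neq0 // /N mulf_neq0 ?cpow_neq0 ?jfac_neq0 //.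
    by rewrite -cabs_eq0 u1 // oner_neq0.
  apply: (mulfI Nn); rewrite mulr0 -E -[_ ^ 4]/(jfac g z ^+ 4); ring.
pose D := \det (rho g).
have WE y : 0 < Im y -> D * W y =
    hh i0 y * DopQ k0 (Pslash g) (hh i1) y - hh i1 y * DopQ k0 (Pslash g) (hh i0) y.
  move=> y0; rewrite -!DE // !Dh // /D det2 /wr /hh /vdot; move: (DV k0 F0 y) => G.
  by rewrite ![row _ _ _ _]mxE; ring.
have d1 := wronskian_derivative (hhol i0) (hhol i1) (Dhol i0) (Dhol i1) (ode' i0) (ode' i1) z0.
have d2 := cdv_extH WE z0 (cdv_cstM D (wronskian_cdv z0)).
have := cdv_uniq d1 d2; rewrite -WE // weight_exponent => /eqP; rewrite -subr_eq0 => /eqP E.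
have {}E : (12 * Cr (l1 + l2) * twopii R * D * W z) * (P z - Pslash g z) = 0 by rewrite -[RHS]E; ring.
(* Distinct nonnegative exponents cannot sum to zero; without this the two Wronskian equations would
   not determine [Pslash g]. *)
have s0 : Cr (l1 + l2) != 0.
  rewrite Cr_eq0 paddr_eq0 //; apply: contra_neqN l12 => /andP[/eqP -> /eqP ->] //.
have n0 : 12 * Cr (l1 + l2) * twopii R * D * W z != 0.
  apply: mulf_neq0 (wronskian_nonzero z0); apply: mulf_neq0 (rep_det_neq0 rep gs).
  by apply: mulf_neq0 (twopii_neq0 R); rewrite mulf_neq0 // pnatr_eq0.
by move/eqP: E; rewrite mulf_eq0 (negbTE n0) subr_eq0 => /eqP ->.
Qed.

Lemma Hspace_intro k F : expd F -> offH0 F ->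
  (forall g, isSL2 g -> forall z, 0 < Im z -> forall i,
    F (mob g z) i 0 = u g * cpow (jfac g z) k * vdot (row i (rho g)) F z) -> Hspace rho u k F.
Proof.
move=> eF oF T; apply/(HspaceE rho u1); split=> // [i|i|g gs z z0 i].
- exact: expandable_holH vw _ _ eF.
- exact: expandable_moderate vw l1p l2p _ _ eF.
- by rewrite T // /vdot !mxE.
Qed.

Lemma Hspace_mob k F g z i : Hspace rho u k F -> isSL2 g -> 0 < Im z ->
  F (mob g z) i 0 = u g * cpow (jfac g z) k * vdot (row i (rho g)) F z.
Proof. by move=> /(HspaceE rho u1)[_ _ _ T] gs z0; rewrite T // /vdot !mxE. Qed.

Lemma Hspace_offH0 k F : Hspace rho u k F -> offH0 F.
Proof. by case=> _ [_ []]. Qed.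

Lemma Hspace_DV k F : Hspace rho u k F -> Hspace rho u (k + 2) (DV k F).
Proof.
move=> HF; have eF := Hspace_expandable HF; have eD := expandable_DV vw k eF.
have hF i : holH (fun z => F z i 0) by exact: expandable_holH vw _ _ eF.
apply: Hspace_intro => // [z z0|g gs z z0 i].
  by apply/matrixP => i j; rewrite !mxE Dop_offH0.
have j0 := jfac_neq0 gs z0.
have hv : holH (vdot (row i (rho g)) F) by move=> y y0; eexists; exact: cderiv_vdot hF y0.
rewrite vdot_DV // mxE (Dop_transform gs (factor_cpow k (u g) gs) (hF i) hv) // => [|y y0].
  by rewrite /DopQ Pfun_quasimodular // cpowD // (cpow_int 2) // mulrA.
exact: Hspace_mob.
Qed.

Lemma Hspace_DVn j : Hspace rho u (k0 + 2 * j%:R) (DVn k0 j F0).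
Proof.
elim: j => [|j IH]; first by rewrite mulr0 addr0.
have -> : k0 + 2 * j.+1%:R = k0 + 2 * j%:R + 2 by rewrite -addn1 natrD; ring.
exact: Hspace_DV.
Qed.

Lemma Hspace_add k F G : Hspace rho u k F -> Hspace rho u k G ->
  Hspace rho u k (fun z => F z + G z).
Proof.
move=> HF HG; have [f1 [f2 [B1 B2 E1 E2]]] := Hspace_expandable HF.
have [h1 [h2 [D1 D2 H1 H2]]] := Hspace_expandable HG.
have vD v' z : vdot v' (fun z => F z + G z) z = vdot v' F z + vdot v' G z.
  by rewrite /vdot !mxE; ring.
apply: Hspace_intro => [|z z0|g gs z z0 i].
- exists (fun z => f1 z + h1 z), (fun z => f2 z + h2 z).
  by split; [exact: BBD|exact: BBD|move=> z z0; rewrite vD E1 ?H1 ?mulrDr..|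
    move=> z z0; rewrite vD E2 ?H2 ?mulrDr].
- by rewrite (Hspace_offH0 HF z0) (Hspace_offH0 HG z0) addr0.
- by rewrite vD mulrDr -!Hspace_mob // mxE.
Qed.

Lemma Hspace_scale (i : int) k A F : Mform i A -> Hspace rho u k F ->
  Hspace rho u (k + i%:~R) (fun z => A z *: F z).
Proof.
move=> AM HF; have AB := Mform_BB AM; have [f1 [f2 [B1 B2 E1 E2]]] := Hspace_expandable HF.
have vZ v' z : vdot v' (fun z => A z *: F z) z = A z * vdot v' F z.
  by rewrite /vdot !mxE; ring.
apply: Hspace_intro => [|z z0|g gs z z0 j].
- exists (fun z => A z * f1 z), (fun z => A z * f2 z).
  by split; [exact: BBM|exact: BBM|move=> z z0; rewrite vZ E1 // mulrCA|
    move=> z z0; rewrite vZ E2 // mulrCA].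
- by rewrite (Hspace_offH0 HF z0) scaler0.
- have j0 := jfac_neq0 gs z0.
  case: AM => _ [_ [_ AT]]; rewrite vZ mxE AT // (Hspace_mob _ HF) // cpowD // cpow_int //; ring.
Qed.

Lemma wr_mob k1 k2 F G g z : Hspace rho u k1 F -> Hspace rho u k2 G -> isSL2 g -> 0 < Im z ->
  wr F G (mob g z) = u g ^+ 2 * \det (rho g) * cpow (jfac g z) (k1 + k2) * wr F G z.
Proof.
move=> HF HG gs z0; rewrite /wr !(Hspace_mob _ HF) // !(Hspace_mob _ HG) // cpowD ?jfac_neq0 //.
by rewrite det2 /vdot !mxE; ring.
Qed.

(** Numerator and denominator share the character [u^2 det rho], which cancels. At the cusp both are
    [q^(l1 + l2)] times a function in [BB], and for the Wronskian that function is invertible, so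
    the quotient stays bounded. *)
Lemma Mform_wr (i : int) k1 k2 F G : Hspace rho u k1 F -> Hspace rho u k2 G ->
  k1 + k2 = 2 * k0 + 2 + i%:~R -> Mform i (cut (fun z => wr F G z / W z)).
Proof.
move=> HF HG kk.
have B : BB (cut (fun z => wr F G z / W z)).
  have [h hB hE] := wr_expansion (Hspace_expandable HF) (Hspace_expandable HG).
  have [L [c [LB L0 LP c0 E]]] := wronskian_Efun.
  have [e [eB e1 en eE eV]] := Efun_factor LB L0 (l1 + l2).
  apply: BB_ext (BBZ c^-1 (BBM hB eV)) => z z0; rewrite cutE // hE // E // eE.
  have q0 := qq_neq0 (l1 + l2) z; have := en z; move: (qq _ z) (e z) q0 => x y x0 y0.
  by field; rewrite c0 x0 y0.
split; first by apply/holoHP; exact: BB_holH.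
split; first exact: BB_moderate.
split; first exact: cut_offH0.
move=> g gs z z0; have j0 := jfac_neq0 gs z0; rewrite !cutE ?mob_H //.
rewrite (wr_mob HF HG) // (wr_mob HF0 (Hspace_DV HF0)) // kk.
have -> : k0 + (k0 + 2) = 2 * k0 + 2 by ring.
rewrite (cpowD _ i%:~R) // cpow_int //.
have un : u g != 0 by rewrite -cabs_eq0 u1 // oner_neq0.
have dn := rep_det_neq0 rep gs; have cn := cpow_neq0 (2 * k0 + 2) j0; have Wn := wronskian_nonzero z0.
have jn : jfac g z ^ i != 0 by rewrite expfz_neq0.
move: (\det _) (cpow _ _) (W z) (jfac g z ^ i) dn cn Wn jn => d c x y dn cn xn yn.
by field; rewrite un dn cn xn.
Qed.

Lemma cramer G z i : wr G (DV k0 F0) z * F0 z i 0 + wr F0 G z * DV k0 F0 z i 0 = W z * G z i 0.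
Proof. by rewrite /wr; move: (DV k0 F0) i => D; apply: ord2P; ring. Qed.

Lemma Hspace_decompose (i : int) k F : Hspace rho u k F -> k = k0 + i%:~R ->
  exists A B, [/\ Mform i A, Mform (i - 2) B & F = fun z => A z *: F0 z + B z *: DV k0 F0 z].
Proof.
move=> HF ki; exists (cut (fun z => wr F (DV k0 F0) z / W z)), (cut (fun z => wr F0 F z / W z)).
split; first by apply: Mform_wr HF (Hspace_DV HF0) _; rewrite ki; ring.
  by apply: Mform_wr HF0 HF _; rewrite ki intrB; ring.
apply: offH0_ext (Hspace_offH0 HF) _ _ => z z0.
  by rewrite !cut_offH0 // !scale0r addr0.
have Wn := wronskian_nonzero z0; rewrite !cutE //; apply/matrixP => j l; rewrite (ord1 l) ![RHS]mxE.
apply: (mulfI Wn); rewrite -cramer; move: (DV k0 F0) Wn => D Wn; rewrite !mxE.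
by move: (wr F0 D z) Wn => x xn; field.
Qed.

Lemma decompose_zero A B z : 0 < Im z -> A *: F0 z + B *: DV k0 F0 z = 0 -> A = 0 /\ B = 0.
Proof.
move=> z0 E; have Wn := wronskian_nonzero z0.
have e i : A * F0 z i 0 + B * DV k0 F0 z i 0 = 0.
  move: (F0 z) (DV k0 F0 z) E => V V' E.
  by have := congr1 (fun M : 'cV_2 => M i 0) E; rewrite !mxE.
split; apply: (mulIf Wn); rewrite mul0r.
  transitivity ((A * F0 z i0 0 + B * DV k0 F0 z i0 0) * DV k0 F0 z i1 0 -
    (A * F0 z i1 0 + B * DV k0 F0 z i1 0) * DV k0 F0 z i0 0); last by rewrite !e !mul0r subr0.
  by rewrite /wr; ring.
transitivity ((A * F0 z i1 0 + B * DV k0 F0 z i1 0) * F0 z i0 0 -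
  (A * F0 z i0 0 + B * DV k0 F0 z i0 0) * F0 z i1 0); last by rewrite !e !mul0r subr0.
by rewrite /wr; ring.
Qed.

(** * The graded module generated by F0 *)

Section Graded.
Variables (kw : R) (n0 : int).
Hypothesis k0n : k0 = kw + n0%:~R.

Lemma Hgraded_add Y1 Y2 : Hgraded rho u kw Y1 -> Hgraded rho u kw Y2 ->
  Hgraded rho u kw (fun j z => Y1 j z + Y2 j z).
Proof.
move=> [H1 [N1 S1]] [H2 [N2 S2]]; split; first by move=> j; exact: Hspace_add.
exists (maxn N1 N2) => j; rewrite gtn_max => /andP[/S1 -> /S2 ->].
by apply/funext => z; rewrite addr0.
Qed.

Lemma Hgraded_actM A (d : int) V : Mgraded A -> Hspace rho u (kw + d%:~R) V ->
  Hgraded rho u kw (actM A d V).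
Proof.
move=> [AM [N AS]] HV; split.
  move=> j; have := Hspace_scale (AM (j - d)) HV.
  by rewrite -addrA -intrD [d + _]addrC subrK.
exists (N + `|d|)%N => j jN; rewrite /actM AS; last by lia.
by apply/funext => z; rewrite scale0r.
Qed.

Lemma Hgraded_Rcomb J Ms : (forall i, Mgraded (Ms i)) -> Hgraded rho u kw (Rcomb J Ms n0 k0 F0).
Proof.
move=> MsM; elim: J => [|J IH].
  rewrite (_ : Rcomb _ _ _ _ _ = fun=> fun=> 0); last first.
    by apply/funext => j; apply/funext => z; rewrite /Rcomb big_ord0.
  by split; [move=> j; exact: Hspace_0|exists 0%N].
have HJ : Hspace rho u (kw + (n0 + 2 * J%:Z)%:~R) (DVn k0 J F0).
  by have := Hspace_DVn J; rewrite k0n intrD intrM addrA.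
have -> : Rcomb J.+1 Ms n0 k0 F0 = fun j z =>
    Rcomb J Ms n0 k0 F0 j z + actM (Ms J) (n0 + 2 * J%:Z) (DVn k0 J F0) j z.
  by apply/funext => j; apply/funext => z; rewrite /Rcomb big_ord_recr.
exact: Hgraded_add IH (Hgraded_actM (MsM J) HJ).
Qed.

Lemma Hgraded_decompose Y : Hgraded rho u kw Y ->
  exists A B, [/\ Mgraded A, Mgraded B &
    Y = fun j z => actM A n0 F0 j z + actM B (n0 + 2) (DV k0 F0) j z].
Proof.
move=> [YH [N YS]].
(* [F0] sits in degree [n0] and [D F0] in degree [n0 + 2], so the coefficients of degree [i] are
   read off from [Y] in degrees [i + n0] and [i + (n0 + 2)]. *)
exists (fun i => cut (fun z => wr (Y (i + n0)) (DV k0 F0) z / W z)),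
  (fun i => cut (fun z => wr F0 (Y (i + (n0 + 2))) z / W z)).
have wr0l F z : wr (fun=> 0) F z = 0 by rewrite /wr !mxE !mul0r subr0.
have wr0r F z : wr F (fun=> 0) z = 0 by rewrite /wr !mxE !mulr0 subr0.
split.
- split; first by move=> j; apply: Mform_wr (YH _) (Hspace_DV HF0) _; rewrite k0n intrD; ring.
  exists (N + `|n0|)%N => j jN; rewrite YS; last by lia.
  by apply/funext => z; rewrite /cut wr0l mul0r; case: ifP.
- split; first by move=> j; apply: Mform_wr HF0 (YH _) _; rewrite k0n !intrD; ring.
  exists (N + `|n0| + 2)%N => j jN; rewrite YS; last by lia.
  by apply/funext => z; rewrite /cut wr0r mul0r; case: ifP.
apply/funext => j; apply: offH0_ext (Hspace_offH0 (YH j)) _ _ => z z0.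
  by rewrite /actM !cut_offH0 // !scale0r addr0.
rewrite /actM !subrK; have Wn := wronskian_nonzero z0; rewrite !cutE //.
apply/matrixP => i l; rewrite (ord1 l); apply: (mulfI Wn); rewrite -cramer.
move: (DV k0 F0) Wn => D Wn; rewrite !mxE.
by move: (wr F0 D z) Wn => x xn; field.
Qed.

Lemma Hgraded_decompose_uniq A B A' B' : Mgraded A -> Mgraded B -> Mgraded A' -> Mgraded B' ->
  (fun j z => actM A n0 F0 j z + actM B (n0 + 2) (DV k0 F0) j z) =
  (fun j z => actM A' n0 F0 j z + actM B' (n0 + 2) (DV k0 F0) j z) -> A' = A /\ B' = B.
Proof.
move=> [AM _] [BM _] [A'M _] [B'M _] E.
have key j z : 0 < Im z -> A' (j - n0) z - A (j - n0) z = 0 /\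
    B' (j - (n0 + 2)) z - B (j - (n0 + 2)) z = 0.
  move=> z0; apply: (decompose_zero z0); have := congr1 (fun Y => Y j z) E; rewrite /actM => {}E.
  move: E; move: (F0 z) (DV k0 F0 z) => V V' E.
  by rewrite !scalerBl addrACA -opprD -E subrr.
have off (M' : int -> C R -> C R) : (forall i, Mform i (M' i)) -> forall i, offH0 (M' i).
  by move=> H i z z0; exact: Mform_ext_off z0.
split; apply/funext => i.
  apply: offH0_ext (off _ A'M i) (off _ AM i) _ => z z0.
  by have [] := key (i + n0) z z0; rewrite addrK => /subr0_eq.
apply: offH0_ext (off _ B'M i) (off _ BM i) _ => z z0.
by have [_] := key (i + (n0 + 2)) z z0; rewrite addrK => /subr0_eq.
Qed.

Lemma Hgraded_cyclic Y : Hgraded rho u kw Y <-> exists (J : nat) (Ms : nat -> int -> (C R -> C R)),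
  (forall i, Mgraded (Ms i)) /\ Y = Rcomb J Ms n0 k0 F0.
Proof.
split=> [/Hgraded_decompose[A [B [AM BM ->]]]|[J [Ms [MsM ->]]]]; last exact: Hgraded_Rcomb.
(* The powers 0 and 1 of [D] already generate, so two terms suffice. *)
exists 2%N, (fun i => if i == 0 then A else if i == 1 then B else fun=> fun=> 0); split.
  by do 2?case=> //; split; [move=> j; exact: Mform_0|exists 0%N].
apply/funext => j; apply/funext => z; rewrite /Rcomb sum2 /= !mulr0 !addr0 mulr1.
by [].
Qed.

End Graded.

(** Multiplying bases of the two coefficient spaces by [F0] and [D F0] gives a basis; the second
    weight is smaller by 2 because [D] raises the weight by 2. *)
Lemma Hspace_dim (i : int) d1 d2 : fdim (@Mform R i) d1 -> fdim (@Mform R (i - 2)) d2 ->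
  has_dim (Hspace rho u (k0 + i%:~R)) (d1 + d2).
Proof.
move=> [b1 [M1 I1 S1]] [b2 [M2 I2 S2]].
pose bs (l : 'I_(d1 + d2)) z := match fintype.split l with
  inl j => b1 j z *: F0 z | inr j => b2 j z *: DV k0 F0 z end.
have bl j : bs (lshift d2 j) = fun z => b1 j z *: F0 z.
  by rewrite /bs -[lshift d2 j]/(unsplit (inl j)) unsplitK.
have br j : bs (rshift d1 j) = fun z => b2 j z *: DV k0 F0 z.
  by rewrite /bs -[rshift d1 j]/(unsplit (inr j)) unsplitK.
have bE (c : 'I_(d1 + d2) -> C R) z : \sum_l c l *: bs l z =
    (\sum_j c (lshift d2 j) * b1 j z) *: F0 z + (\sum_j c (rshift d1 j) * b2 j z) *: DV k0 F0 z.
  rewrite big_split_ord /= !scaler_suml; congr (_ + _); apply: eq_bigr => j _.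
    by rewrite bl scalerA.
  by rewrite br scalerA.
have off0 d (e : 'I_d -> C R -> C R) m (c : 'I_d -> C R) : (forall j, Mform m (e j)) ->
    offH0 (fun z => \sum_j c j * e j z).
  by move=> eM z z0; apply: big1 => j _; rewrite (Mform_ext_off (eM j)) // mulr0.
exists bs; split; last split.
- move=> l; rewrite -[l]splitK; case: (fintype.split l) => j /=; rewrite ?bl ?br.
    exact: Hspace_scale.
  have := Hspace_scale (M2 j) (Hspace_DV HF0).
  by rewrite (_ : k0 + 2 + _ = k0 + i%:~R) // intrB; ring.
- move=> c E.
  have Z z : 0 < Im z -> (\sum_j c (lshift d2 j) * b1 j z = 0) /\ (\sum_j c (rshift d1 j) * b2 j z = 0).
    by move=> z0; apply: (decompose_zero z0); rewrite -bE; exact: (congr1 (fun F => F z) E).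
  have c1 : forall j, c (lshift d2 j) = 0.
    apply: I1; apply: offH0_ext (off0 _ _ _ _ M1) _ _ => // z z0; by case: (Z z z0).
  have c2 : forall j, c (rshift d1 j) = 0.
    apply: I2; apply: offH0_ext (off0 _ _ _ _ M2) _ _ => // z z0; by case: (Z z z0).
  by move=> l; rewrite -[l]splitK; case: (fintype.split l) => j; [exact: c1|exact: c2].
move=> F HF; have [A [B [/S1[a' ->] /S2[bs' ->] ->]]] := Hspace_decompose HF erefl.
exists (fun l : 'I_(d1 + d2) => match fintype.split l with inl j => a' j | inr j => bs' j end); apply/funext => z; rewrite bE.
congr (_ *: _ + _ *: _); apply: eq_bigr => j _.
  by rewrite -[lshift d2 j]/(unsplit (inl j)) unsplitK.
by rewrite -[rshift d1 j]/(unsplit (inr j)) unsplitK.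
Qed.

Lemma Hspace_dim_floor (k : nat) : has_dim (Hspace rho u (k0 + 2 * k%:R)) (k %/ 3).+1.
Proof.
have [L [LB L0 LP]] := P_primitive R; have QM := Pfun_quasimodular.
have -> : 2 * k%:R = (2 * k)%N%:Z%:~R :> R by rewrite -pmulrn natrM.
have D := Mform_dim QM LB L0 LP.
case: k => [|k].
  (* For [k = 0] the coefficient of [D F0] would have weight -2 and therefore vanishes. *)
  apply: (@Hspace_dim _ 1 0); first exact: D 0%N.
  by apply: fdim0 => f; exact: (@Mform_neg _ QM L LB L0 LP 1).
(* The exceptional weights, 2 modulo 12, are what makes the two dimensions add up to a quotient by
   3. *)
have -> : (k.+1 %/ 3).+1 = (dimM k.+1 + dimM k)%N by rewrite /dimM; do 2 case: ifP; lia.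
apply: Hspace_dim; first exact: D.
have -> : (2 * k.+1)%N%:Z - 2 = (2 * k)%N%:Z by lia.
exact: D.
Qed.

End Wronskian.
End Main.
End Modules.

Unset Implicit Arguments. Set Strict Implicit. Set Printing Implicit Defensive.

Theorem theorem4p7 (R : realType)
  (rho : 'M[int]_2 -> 'M[C R]_2) (u : 'M[int]_2 -> C R) (kw m r1 r2 l1 l2 k0 : R)
  (n0 : int) (F0 : C R -> 'cV[C R]_2) :
  is_rep rho -> T_determined rho -> T_unitarizable rho ->
  (* u is a multiplier system (of weight kw) with cusp parameter m *)
  is_multiplier kw u -> 0 <= m < 12 -> u Tm = ee (m / 12) ->
  (* eigenvalues of rho(T) are e(r1), e(r2), r_j in [0,1) *)
  0 <= r1 < 1 -> 0 <= r2 < 1 ->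
  char_poly (rho Tm) = ('X - (ee r1)%:P) * ('X - (ee r2)%:P) ->
  (* l_j in [0,1), l_j = r_j + m/12 mod Z *)
  0 <= l1 < 1 -> (exists z : int, l1 = r1 + m / 12 + z%:~R) ->
  0 <= l2 < 1 -> (exists z : int, l2 = r2 + m / 12 + z%:~R) ->
  k0 = 6 * (l1 + l2) - 1 ->
  (* H(rho,u) = (+)_{n in Z} H(kw+n) equals (+)_{k >= 0} H(k0 + 2k) *)
  k0 = kw + n0%:~R ->
  (forall n : int, (exists F, Hspace rho u (kw + n%:~R) F /\ F <> (fun _ => 0)) ->
     exists j : nat, kw + n%:~R = k0 + 2 * j%:R) ->
  (* F0 : nonzero element of H(k0), components a fundamental system of a 2nd order MLDE *)
  Hspace rho u k0 F0 -> F0 <> (fun _ => 0) -> fundamental_system_MLDE2 k0 F0 ->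
  (* (i) free M-module with basis {F0, D F0} *)
  (forall G, Hgraded rho u kw G ->
     exists A B, Mgraded A /\ Mgraded B /\
       G = (fun j z => actM A n0 F0 j z + actM B (n0 + 2) (DV k0 F0) j z) /\
       forall A' B', Mgraded A' -> Mgraded B' ->
         G = (fun j z => actM A' n0 F0 j z + actM B' (n0 + 2) (DV k0 F0) j z) ->
         A' = A /\ B' = B) /\
  (* (ii) H(rho,u) = R F0 *)
  (forall G, Hgraded rho u kw G <->
     exists (J : nat) (Ms : nat -> int -> (C R -> C R)),
       (forall i, Mgraded (Ms i)) /\ G = Rcomb J Ms n0 k0 F0) /\
  (* (iii) dimensions *)
  (forall k : nat, has_dim (Hspace rho u (k0 + 2 * k%:R)) (k %/ 3).+1).
Proof.
move=> rep [irr _] uni [u1 _] _ uT r1I r2I ch l1I [m1 l1E] l2I [m2 l2E] k0E k0n _ HF0 _.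
move=> [M [MM [ode [indep _]]]].
have r12 := eigenvalues_distinct rep irr uni (cabs_ee r1) ch.
have [v [w [vT wT vw]]] := eigen_basis ch r12.
have ua : u Tm * ee r1 = ee l1 by rewrite uT l1E !eeD ee_int mulr1 mulrC.
have ub : u Tm * ee r2 = ee l2 by rewrite uT l2E !eeD ee_int mulr1 mulrC.
(* Multiplication by the nonzero number [u Tm] sends [ee r1], [ee r2] to [ee l1], [ee l2], so
   distinct eigenvalues give distinct exponents. *)
have l12 : l1 != l2.
  apply: contra_neq r12 => e; apply: (mulfI (_ : u Tm != 0)); last by rewrite ua ub e.
  by rewrite uT ee_neq0.
have {}ode i z : 0 < complex.Im z ->
    Dop (k0 + 2) (Dop k0 (fun z => F0 z i 0)) z + M z * F0 z i 0 = 0.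
  by case: (ode i) => _ [_]; exact.
split; [|split].
- move=> G HG.
  have [A [B [AM BM E]]] := Hgraded_decompose rep u1 vT wT ua ub vw l1I l2I l12 k0E HF0 MM ode indep k0n HG.
  exists A, B; do 3![split=> //] => A' B' A'M B'M; rewrite E.
  exact: (Hgraded_decompose_uniq u1 vT wT ua ub vw l1I l2I l12 k0E HF0 ode indep AM BM A'M B'M).
- exact: (Hgraded_cyclic rep u1 vT wT ua ub vw l1I l2I l12 k0E HF0 MM ode indep k0n).
- exact: (Hspace_dim_floor rep u1 vT wT ua ub vw l1I l2I l12 k0E HF0 MM ode indep).
Qed.
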